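(* Let $(X,\mathsf d)$ and $\mathsf E:X\to\mathbb R\cup\{+\infty\}$ satisfy the standing assumptions (A1)–(A3), and let $x,y\in X$ be such that $\mathsf E(x)<\infty$ and $\mathsf E(y)<\infty$. Then $$\Gamma\text{-}\lim_{\varepsilon\to0}\big\{\mathcal A_\varepsilon+\iota_{01}\big\}=\mathcal A+\iota_{01}$$ for the uniform convergence on $C([0,1],X)$. If moreover Assumption (S) holds, then the $\Gamma$-convergence also takes place with respect to the pointwise-in-time $\sigma$-topology.
   Context: Curves: for a metric space $(X,\mathsf d)$, $C([0,1],X)$ denotes the continuous curves $\gamma=(\gamma_t)_{t\in[0,1]}$, $AC([0,1],X)$ the absolutely continuous ones, $|\dot\gamma_t|$ the metric speed, and $AC^2([0,1],X)$ the absolutely continuous curves with $|\dot\gamma|\in L^2(0,1)$. Slope: $D(\mathsf E)=\{x\in X:\mathsf E(x)<\infty\}$. The slope $|\partial\mathsf E|(x)$ is $+\infty$ if $x\notin D(\mathsf E)$, $0$ if $x$ is isolated, and $|\partial\mathsf E|(x)=\limsup_{z\to x}\frac{[\mathsf E(x)-\mathsf E(z)]^+}{\mathsf d(x,z)}$ otherwise. $\mathrm{EVI}_\lambda$-gradient flow of $\mathsf E$ ($\lambda\in\mathbb R$) starting from $x$: a curve $(\gamma_t)_{t>0}$ in $AC_{loc}((0,\infty),X)$ with $\gamma_t\to x$ as $t\downarrow0$ and $\frac12\frac{d}{dt}\mathsf d^2(\gamma_t,z)+\frac\lambda2\mathsf d^2(\gamma_t,z)+\mathsf E(\gamma_t)\le\mathsf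 E(z)$ for all $z\in X$ and a.e. $t>0$. Standing assumptions: (A1) $(X,\mathsf d)$ is a complete separable metric space. (A2) $\mathsf E$ is lower semicontinuous, $\overline{D(\mathsf E)}=X$, and for every $\mathsf d$-bounded $B\subset X$ there is $c_B\in\mathbb R$ with $\mathsf E\ge c_B$ on $B$. (A3) There is $\lambda\in\mathbb R$ such that for every $x\in X$ there exists an $\mathrm{EVI}_\lambda$-gradient flow of $\mathsf E$ starting from $x$. Assumption (S): there is a Hausdorff topology $\sigma$ on $X$ such that every $\mathsf d$-bounded sequence has a $\sigma$-converging subsequence, and $\mathsf d$ (jointly in its two variables) and $|\partial\mathsf E|$ are sequentially $\sigma$-lower semicontinuous. Functionals on $C([0,1],X)$: $\mathcal A(\gamma)=\frac12\int_0^1|\dot\gamma_t|^2dt$ (equal to $+\infty$ if $\gamma$ is not absolutely continuous), $\mathcal I(\gamma)=\frac12\int_0^1|\partial\mathsf E|^2(\gamma_t)dt$, $\mathcal A_\varepsilon=\mathcal A+\varepsilon^2\mathcal I$ for $\varepsilon>0$; $\iota_{01}(\gamma)=0$ if $\gamma_0=x$ and $\gamma_1=y$, and $+\infty$ otherwise. $\Gamma$-convergence is meant sequentially: $\Gamma\text{-}\lim_{\varepsilon\to0}F_\varepsilon=F$ for a given notion of convergence of curves means that (liminf) $F(\gamma)\le\liminf_{\varepsilon\downarrow0}F_\varepsilon(\gamma^\varepsilon)$ whenever $\gamma^\varepsilon\to\gamma$, and (limsup) for every $\gamma$ there are $\gamma^\varepsilon\to\gamma$ with $\limsup_{\varepsilon\downarrow0}F_\varepsilon(\gamma^\varepsilon)\le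 F(\gamma)$. Convergence in the pointwise-in-time $\sigma$-topology means $\gamma^\varepsilon_t\to\gamma_t$ in $\sigma$ for every $t\in[0,1]$. *)

(* Defs.v *)
From HB Require Import structures.
From mathcomp Require Import all_boot all_order all_algebra.
From mathcomp Require Import all_classical all_reals all_analysis.

Set Implicit Arguments.
Unset Strict Implicit.
Unset Printing Implicit Defensive.

Import Order.TTheory GRing.Theory Num.Theory.
Import numFieldNormedType.Exports.

Local Open Scope classical_set_scope.
Local Open Scope ring_scope.

Section metric_spaces.
Context {R : realType} (X : metricType R).

(* [completeType] is not used because it would require a pointed type. *)
Definition cauchy_complete : Prop :=
  forall u : nat -> X, cauchy (u @ \oo) -> exists l : X, u @ \oo --> l.

Definition separable : Prop := exists D : set X, countable D /\ dense D.

Definition mbounded (B : set X) : Prop :=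
  exists M : R, forall y z, B y -> B z -> mdist y z <= M.

End metric_spaces.

(* A curve defined on an interval is a total function R -> X of which only the
   values on that interval are ever used. *)
Section curves.
Context {R : realType} {X : metricType R}.
Local Notation mu := (@lebesgue_measure R).

Definition curves01 : set (R -> X) :=
  [set g : R -> X | {within `[(0 : R), (1 : R)], continuous g}].

Definition abs_cont (a b : R) (g : R -> X) : Prop :=
  exists m : R -> R, mu.-integrable `[a, b] (EFin \o m) /\
    forall s t : R, a <= s -> s <= t -> t <= b ->
      mdist (g s) (g t) <= \int[mu]_(r in `[s, t]) m r.

Definition abs_cont_loc_pos (g : R -> X) : Prop :=
  forall a b : R, 0 < a -> a < b -> abs_cont a b g.

(* For an absolutely continuous curve the limit exists at almost every time;
   elsewhere [lim] takes a default value.  At t = 0 and t = 1 it would involve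
   values of g outside [0, 1], hence the open interval in [kinetic]. *)
Definition metric_speed (g : R -> X) (t : R) : R :=
  lim (mdist (g (t + h)) (g t) / `|h| @[h --> (0 : R)^']).

Local Open Scope ereal_scope.

Definition kinetic (g : R -> X) : \bar R :=
  if `[< abs_cont 0 1 g >]
  then (2^-1)%:E * \int[mu]_(t in `]0%R, 1%R[) (metric_speed g t ^+ 2)%:E
  else +oo.

Definition iota01 (x y : X) (g : R -> X) : \bar R :=
  if `[< g 0%R = x /\ g 1%R = y >] then 0 else +oo.

End curves.

Section energy.
Context {R : realType} {X : metricType R} (E : X -> \bar R).
Local Notation mu := (@lebesgue_measure R).

Local Open Scope ereal_scope.

Definition edomain : set X := [set z | E z < +oo].

(* When E x is finite, [maxe (E x - E z) 0] is finite, also if E z = +oo. *)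
Definition slope (x : X) : \bar R :=
  if `[< ~ edomain x >] then +oo
  else if `[< isolated [set: X] x >] then 0
  else limf_esup
         (fun z => maxe (E x - E z) 0 * ((mdist x z)^-1)%:E) x^'.

Definition fisher (g : R -> X) : \bar R :=
  (2^-1)%:E * \int[mu]_(t in `]0%R, 1%R[) (slope (g t) ^+ 2).

Definition action_eps (e : R) (g : R -> X) : \bar R :=
  kinetic g + (e ^+ 2)%:E * fisher g.

Definition EVI_flow (lambda : R) (x : X) (g : R -> X) : Prop :=
  [/\ abs_cont_loc_pos g,
      g t @[t --> (0 : R)^'+] --> x
    & forall z : X, {ae mu, forall t : R, (0 < t)%R ->
        derivable (fun s : R => mdist (g s) z ^+ 2)%R t 1%R /\
        (2^-1 * derive1 (fun s : R => mdist (g s) z ^+ 2) t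
           + lambda / 2 * mdist (g t) z ^+ 2)%:E + E (g t) <= E z}].

Definition energy_regular : Prop :=
  [/\ lower_semicontinuous E,
      closure edomain = [set: X]
    & forall B : set X, mbounded B ->
        exists c : R, forall z, B z -> c%:E <= E z].

Definition EVI_wellposed : Prop :=
  exists lambda : R, forall x : X, exists g : R -> X, EVI_flow lambda x g.

End energy.

(* A second topology sigma on X is a [Topological] class on the carrier of X;
   [with_topology sigma] is X equipped with it. *)
Definition with_topology (X : Type) (sigma : Topological X) : topologicalType :=
  Topological.Pack sigma.

Section sigma_topology.
Context {R : realType} {X : metricType R}.
Variable sigma : Topological X.

Definition sigma_cvg {I : Type} (F : set_system I) (u : I -> X) (l : X) : Prop :=
  (u : I -> with_topology sigma) @ F --> (l : with_topology sigma).

Local Open Scope ereal_scope.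

Definition assumption_S (E : X -> \bar R) : Prop :=
  [/\ hausdorff_space (with_topology sigma),
      forall u : nat -> X, mbounded (range u) ->
        exists phi : nat -> nat, {homo phi : m n / (m < n)%N} /\
          exists l : X, sigma_cvg \oo (u \o phi) l,
      forall (u v : nat -> X) (x y : X),
        sigma_cvg \oo u x -> sigma_cvg \oo v y ->
        (mdist x y)%:E <= limn_einf (fun n => (mdist (u n) (v n))%:E)
    & forall (u : nat -> X) (x : X), sigma_cvg \oo u x ->
        slope E x <= limn_einf (fun n => slope E (u n))].

End sigma_topology.

Section gamma_convergence.
Context {R : realType}.
Local Open Scope ereal_scope.

(* Gamma-limit as e decreases to 0 of functionals on the subset C of T, for the
   notion of convergence cv of families indexed by e > 0. *)
Definition gamma_lim (T : Type) (C : set T) (cv : (R -> T) -> T -> Prop)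
    (F_ : R -> T -> \bar R) (F : T -> \bar R) : Prop :=
  (forall (g_ : R -> T) (g : T),
     (forall e : R, (0 < e)%R -> C (g_ e)) -> C g -> cv g_ g ->
     F g <= limf_einf (fun e : R => F_ e (g_ e)) (0 : R)^'+) /\
  (forall g : T, C g ->
     exists g_ : R -> T,
       [/\ forall e : R, (0 < e)%R -> C (g_ e), cv g_ g
         & limf_esup (fun e : R => F_ e (g_ e)) (0 : R)^'+ <= F g]).

Definition uniform_cvg {X : metricType R} (g_ : R -> R -> X) (g : R -> X) : Prop :=
  {uniform `[0%R, 1%R], g_ e @[e --> (0 : R)^'+] --> g}.

Definition ptws_sigma_cvg {X : metricType R} (sigma : Topological X)
    (g_ : R -> R -> X) (g : R -> X) : Prop :=
  forall t : R, (0 <= t <= 1)%R -> sigma_cvg sigma (0 : R)^'+ (g_ ^~ t) (g t).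

End gamma_convergence.

(* Main.v *)
Require Import Defs.
From HB Require Import structures.
From mathcomp Require Import all_boot all_order all_algebra.
From mathcomp Require Import all_classical all_reals all_analysis.
From mathcomp Require Import measurable_realfun.
From mathcomp Require Import ring lra.

Set Implicit Arguments.
Unset Strict Implicit.
Unset Printing Implicit Defensive.

Import Order.TTheory GRing.Theory Num.Theory.
Import numFieldNormedType.Exports.

(** The action penalized by the slope dominates the kinetic action, so the
    lower bound is the lower semicontinuity of the kinetic action, and the whole
    point is to approach a curve g of finite action by curves g_eps along which
    eps^2 times the integral of the squared slope tends to 0 while the kinetic
    action does not increase in the limit.  The energy may be infinite along g;
    it is finite at the endpoints, and the gradient flow S regularizes, so
    g_eps t := S (g t) (d * min t (1 - t)) is used, with d proportional to eps:
    the endpoints are kept and every interior point is moved into the domain of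
    the slope.  In a smooth space, with h t the flow time,
      |g_eps'|^2 + h'^2 |dE|^2 (g_eps) + 2 h' (E o g_eps)' <= (1 + o(1)) |g'|^2,
    because the left side is the squared norm of the image of g' under the
    differential of the flow, which is almost a contraction.  Since h' is d on
    the first half and -d on the second, integration gives
      A(g_eps) + C eps^2 I(g_eps) <= (1 + o(1)) A(g) + d (E x + E y - 2 inf E).

    The metric substitute for this computation is a three-point inequality of
    the flow ([start_step_slope]): testing the evolution variational inequality
    of the flow line through g t with the point g_eps s bounds
    d(g_eps s, g_eps t)^2 and the squared slope at g_eps t by d(g s, g t)^2 and
    by the energy difference.  The slope enters through the dissipation of
    energy along the flow ([evi_dissipation]), itself a consequence of the
    contractivity of the flow ([evi_contraction]).  The constant in front of
    the squared slope is not the optimal one: choosing the ratio of d to eps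
    ([slope_rate]) absorbs it.

    All estimates of curves have the form
    d(g s, g t)^2 <= (t - s) (W t - W s) with W nondecreasing.  Such a bound
    makes g absolutely continuous ([energy_ac]) and bounds the integral of its
    squared speed by W 1 - W 0 ([action_bound], by Fatou's lemma applied to
    symmetric difference quotients of W).  Conversely a curve of finite action
    satisfies it with W the integral of its squared speed ([kinetic_fin]), which
    rests on the almost everywhere existence of the metric speed
    ([metric_speed_ae]).  As the inferior limit is superadditive, the bound
    passes to limits of curves, whence the lower semicontinuity of the action
    ([kinetic_lsc]) for any convergence making the distance lower
    semicontinuous.  This covers the topology sigma; for the upper bound in
    sigma, metric convergence is shown to imply sigma-convergence
    ([metric_cvg_sigma]). *)

Local Open Scope classical_set_scope.
Local Open Scope ring_scope.

(** * Stieltjes measures and primitives *)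

Section stieltjes.
Context {R : realType}.
Implicit Types F G : cumulative R R.
Local Notation mu := (@lebesgue_measure R).

Lemma stieltjes_itv F (a b : R) : a <= b ->
  lebesgue_stieltjes_measure F `]a, b] = (F b - F a)%:E.
Proof.
move=> ab; rewrite /lebesgue_stieltjes_measure /measure_extension.
by rewrite measurable_mu_extE/=; [rewrite wlength_itv_bnd|exact: is_ocitv].
Qed.

Lemma stieltjes_add F G (K : cumulative R R) (A : set R) :
  (forall t, K t = F t + G t) -> measurable A ->
  lebesgue_stieltjes_measure K A =
    (lebesgue_stieltjes_measure F A + lebesgue_stieltjes_measure G A)%E.
Proof.
move=> KFG mA; rewrite -measure_addE.
apply: lebesgue_stieltjes_measure_unique => // _ [[a b] _ <-].
rewrite -[RHS]/(measure_add (lebesgue_stieltjes_measure F)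
  (lebesgue_stieltjes_measure G) `]a, b]) measure_addE.
have [ab|ba] := leP a b.
  transitivity ((F b - F a)%:E + (G b - G a)%:E)%E; last first.
    by apply/esym; congr (_ + _)%E; exact: stieltjes_itv.
  by rewrite stieltjes_itv// !KFG -EFinD; congr EFin => /=; ring.
rewrite set_itv_ge ?bnd_simp -?leNgt ?ltW// measure0; apply/esym.
by transitivity (0 + 0 : \bar R)%E; [congr (_ + _)%E; exact: measure0|exact: adde0].
Qed.

(** The difference of the two functions is nondecreasing, hence has a Stieltjes
    measure of its own. *)
Lemma stieltjes_le F G (A : set R) :
  (forall s t, s <= t -> F t - F s <= G t - G s) -> measurable A ->
  (lebesgue_stieltjes_measure F A <= lebesgue_stieltjes_measure G A)%E.
Proof.
move=> FG mA.
have ndH : {homo (fun t => G t - F t) : s t / s <= t}.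
  by move=> s t st; have := FG _ _ st; lra.
have rcH : right_continuous (fun t => G t - F t).
  by move=> t; apply: cvgB; exact: cumulative_is_right_continuous.
pose H : cumulative R R := HB.pack (fun t => G t - F t)
  (isCumulative.Build R _ R (fun t => G t - F t) ndH rcH).
rewrite (@stieltjes_add F H G)//; last by move=> t /=; rewrite addrCA subrr addr0.
exact: leeDl.
Qed.

End stieltjes.

Section almost_everywhere.
Context {R : realType}.
Local Notation mu := (@lebesgue_measure R).
Implicit Types P Q S : R -> Prop.

Lemma ae_imp P Q : (forall t, P t -> Q t) ->
  {ae mu, forall t, P t} -> {ae mu, forall t, Q t}.
Proof. exact: (@filterS _ _ (ae_filter_ringOfSetsType mu)). Qed.

Lemma ae_imp2 P Q S : (forall t, P t -> Q t -> S t) ->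
  {ae mu, forall t, P t} -> {ae mu, forall t, Q t} -> {ae mu, forall t, S t}.
Proof. exact: (@filterS2 _ _ (ae_filter_ringOfSetsType mu)). Qed.

End almost_everywhere.

Section primitive.
Context {R : realType}.
Local Notation mu := (@lebesgue_measure R).
Implicit Types (p m f : R -> R).

(** Integrating from minus infinity makes increments of [prim p] independent of
    a base point; it is used for [p] integrable on the whole line. *)
Definition prim p (t : R) : R := \int[mu]_(r in `]-oo, t]) p r.

Lemma integrable_itv p (i : interval R) : mu.-integrable [set: R] (EFin \o p) ->
  mu.-integrable [set` i] (EFin \o p).
Proof. by move=> ip; apply: integrableS ip. Qed.

Lemma integrable_cst_itv (a b k : R) : mu.-integrable `[a, b] (EFin \o cst k).
Proof.
apply: measurable_bounded_integrable => //.
  by rewrite /= lebesgue_measure_itv/=; case: ifP; rewrite ?ltry.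
exists `|k|; split; first exact: num_real.
by move=> x kx t _; rewrite /= ltW.
Qed.

Lemma prim_itv p s t : mu.-integrable [set: R] (EFin \o p) -> s <= t ->
  \int[mu]_(r in `[s, t]) p r = prim p t - prim p s.
Proof.
move=> ip st; rewrite -Rintegral_itv_obnd_cbnd; last first.
  by apply: integrableS ip.
by rewrite Rintegral_itvB//; apply: integrableS ip.
Qed.

Lemma prim_ae p : mu.-integrable [set: R] (EFin \o p) ->
  {ae mu, forall t, derivable (prim p) t 1 /\ derive1 (prim p) t = p t}.
Proof.
move=> ip; apply: FTC1Ny; first by move=> y; apply: integrableS ip.
by apply: open_integrable_locally => //; exact: openT.
Qed.

Lemma le_prim p m s t : mu.-integrable [set: R] (EFin \o p) ->
  mu.-integrable [set: R] (EFin \o m) -> (forall r, p r <= m r) -> s <= t ->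
  prim p t - prim p s <= prim m t - prim m s.
Proof.
move=> ip im pm st; rewrite -!prim_itv// le_Rintegral//.
  by apply: integrableS ip.
by apply: integrableS im.
Qed.

Lemma prim_nd p : mu.-integrable [set: R] (EFin \o p) -> (forall r, 0 <= p r) ->
  {homo prim p : s t / s <= t}.
Proof. by move=> ip p0 s t st; rewrite -subr_ge0 -prim_itv// Rintegral_ge0. Qed.

Lemma prim_continuous p : mu.-integrable [set: R] (EFin \o p) -> continuous (prim p).
Proof.
move=> ip t.
have ab : t - 1 < t + 1 by lra.
have /(continuous_within_itvP _ ab)[+ _ _] :=
  @parameterized_integral_continuous R (t - 1) (t + 1) p (ltW ab)
  (integrable_itv _ ip).
move=> /(_ t).
rewrite in_itv/=; have -> : (t - 1 < t < t + 1) by lra.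
move=> /(_ isT) ct.
have : (prim p (t - 1) + parameterized_integral mu (t - 1) r p @[r --> t]) -->
   prim p (t - 1) + parameterized_integral mu (t - 1) t p.
  by apply: cvgD ct; exact: cvg_cst.
have E r : t - 1 <= r -> prim p (t - 1) + parameterized_integral mu (t - 1) r p = prim p r.
  by move=> tr; rewrite /parameterized_integral prim_itv//; ring.
rewrite (E t); last by lra.
apply: cvg_trans; apply: near_eq_cvg; near=> r.
have tr : t - 1 <= r by apply/ltW; near: r; apply: lt_nbhsr; lra.
by rewrite (E _ tr).
Unshelve. all: by end_near. Qed.
End primitive.

(** * Densities of absolutely continuous functions *)

Section density.
Context {R : realType}.
Local Notation mu := (@lebesgue_measure R).
Implicit Types F G : cumulative R R.
Implicit Types p m f : R -> R.

Lemma stieltjes_setT_le F (b : R) : (forall s t, F t - F s <= b) ->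
  (lebesgue_stieltjes_measure F [set: R] <= b%:E)%E.
Proof.
move=> Fb; pose I n : set R := `]- (n%:R), n%:R]%classic.
have cvI : (lebesgue_stieltjes_measure F \o I) n @[n --> \oo] -->
    lebesgue_stieltjes_measure F (\bigcup_n I n).
  apply: nondecreasing_cvg_mu; rewrite /I//; first exact: bigcup_measurable.
  by move=> *; apply/subsetPset/subset_itv; rewrite leBSide/= ?lerN2 ler_nat.
rewrite -(bigcup_itvT false false) -(cvg_lim _ cvI)//.
apply: lime_le; first by apply/cvg_ex; eexists; exact: cvI.
apply: nearW => n /=; rewrite /I stieltjes_itv ?lee_fin//.
by rewrite ge0_cp.
Qed.

(** Radon--Nikodym; bounded increments make the Stieltjes measure finite. *)
Lemma stieltjes_density F (b : R) : (forall s t, F t - F s <= b) ->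
  (forall A : set R, measurable A -> mu A = 0 ->
     lebesgue_stieltjes_measure F A = 0)%E ->
  exists p, mu.-integrable [set: R] (EFin \o p) /\
    forall s t, s <= t -> F t - F s = prim p t - prim p s.
Proof.
move=> Fb domF.
have Foo : (lebesgue_stieltjes_measure F [set: R] < +oo)%E.
  by rewrite (le_lt_trans (stieltjes_setT_le Fb))// ltry.
pose nu := @mfrestr _ (measurableTypeR R) R setT
  (lebesgue_stieltjes_measure F) measurableT Foo.
have nuE A : nu A = lebesgue_stieltjes_measure F A.
  by rewrite /nu /mfrestr/= /mrestr setIT.
have numu : nu `<< mu.
  by apply/null_content_dominatesP => A mA A0; rewrite nuE; exact: domF.
have [f [f0 ffin If nuf]] := radon_nikodym_sigma_finite numu.
have fE : EFin \o (fine \o f) = f by apply/funext => t /=; rewrite fineK.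
exists (fine \o f); split; first by rewrite fE.
move=> s t st; rewrite -prim_itv//; last by rewrite fE.
rewrite -Rintegral_itv_obnd_cbnd; last by apply: integrable_itv; rewrite fE.
rewrite /Rintegral; have -> : F t - F s = fine (nu `]s, t]%classic).
  by rewrite nuE stieltjes_itv.
rewrite (_ : nu _ = \int[mu]_(x in `]s, t]) f x)%E; last exact: nuf.
by congr fine; apply: eq_integral => r _ /=; rewrite fineK.
Qed.

Lemma stieltjes_prim m F (A : set R) : mu.-integrable [set: R] (EFin \o m) ->
  (forall r, 0 <= m r) -> (F : R -> R) = prim m -> measurable A ->
  lebesgue_stieltjes_measure F A = (\int[mu]_(r in A) (m r)%:E)%E.
Proof.
move=> im m0 Fm mA.
have nupos B : (0 <= induced_charge im B)%E.
  by apply: integral_ge0 => r _; rewrite lee_fin.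
rewrite (lebesgue_stieltjes_measure_unique (mu := measure_of_charge _ nupos))//.
move=> _ [[a b] _ <-] /=; rewrite /measure_of_charge /induced_charge.
have [ab|ba] := leP a b; last first.
  by rewrite set_itv_ge ?bnd_simp -?leNgt ?ltW// measure0 integral_set0.
rewrite stieltjes_itv// Fm -prim_itv// -Rintegral_itv_obnd_cbnd; last first.
  exact: integrable_itv.
rewrite /Rintegral fineK//; apply: integrable_fin_num => //.
exact: integrable_itv.
Qed.

Lemma continuous_dominated f (g : R -> R) : continuous g ->
  (forall s t, s <= t -> `|f t - f s| <= g t - g s) -> continuous f.
Proof.
move=> cg fg t; apply/cvgrPdist_le => e e0.
have /cvgrPdist_le/(_ _ e0) := cg t; apply: filterS => r gr.
apply: le_trans gr; have [tr|rt] := leP t r.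
  by rewrite distrC (le_trans (fg _ _ tr))// distrC ler_norm.
by rewrite (le_trans (fg _ _ (ltW rt)))// ler_norm.
Qed.

(** Adding the primitive of [m] makes [f] nondecreasing, with increments at most
    twice those of that primitive; its Stieltjes measure is then dominated by
    the one of density [2 * m], so it has a density too. *)
Lemma ac_density f m : mu.-integrable [set: R] (EFin \o m) ->
  (forall r, 0 <= m r) ->
  (forall s t, s <= t -> `|f t - f s| <= prim m t - prim m s) ->
  exists p, mu.-integrable [set: R] (EFin \o p) /\
    forall s t, s <= t -> f t - f s = prim p t - prim p s.
Proof.
move=> im m0 fm.
have cf : continuous f := continuous_dominated (prim_continuous im) fm.
have fm' s t : s <= t -> - (prim m t - prim m s) <= f t - f s <= prim m t - prim m s.
  by move=> st; rewrite -ler_norml fm.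
have i2 : mu.-integrable [set: R] (EFin \o (fun r => 2 * m r)).
  rewrite [X in _.-integrable _ X](_ : _ = fun r => 2%:E * (m r)%:E)%E; last first.
    by apply/funext => r /=; rewrite EFinM.
  exact: integrableZl.
have prim2 t : prim (fun r => 2 * m r) t = 2 * prim m t.
  by rewrite /prim RintegralZl//; exact: integrable_itv.
pose F t := f t + prim m t.
have ndF : {homo F : s t / s <= t}.
  by move=> s t st; have /andP[+ _] := fm' _ _ st; rewrite /F; lra.
have rcF : right_continuous F.
  by apply: right_continuousW => t; apply: cvgD; [exact: cf|exact: prim_continuous].
pose cF : cumulative R R := HB.pack F (isCumulative.Build R _ R F ndF rcF).
have ndG := prim_nd i2 (fun r => mulr_ge0 (ler0n _ 2) (m0 r)).
have rcG := right_continuousW (prim_continuous i2).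
pose cG : cumulative R R := HB.pack (prim (fun r => 2 * m r))
  (isCumulative.Build R _ R _ ndG rcG).
have FG s t : s <= t -> cF t - cF s <= cG t - cG s.
  by move=> st; have /andP[_ +] := fm' _ _ st; rewrite /= !prim2 /F; lra.
have [] := @stieltjes_density cF (2 * \int[mu]_r m r).
- move=> s t /=; have [st|/ltW ts] := leP s t; last first.
    have := ndF _ _ ts; rewrite -subr_le0 => /le_trans; apply.
    by rewrite mulr_ge0// Rintegral_ge0.
  rewrite (le_trans (FG _ _ st))//= !prim2 -mulrBr ler_pM2l// -prim_itv//.
  rewrite /Rintegral fine_le//.
  + by apply: integrable_fin_num => //; exact: integrable_itv.
  + exact: integrable_fin_num.
  + apply: ge0_subset_integral => //; first exact: measurable_int im.
    by move=> r _; rewrite lee_fin.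
- move=> A mA A0; apply/eqP; rewrite eq_le measure_ge0 andbT.
  rewrite (le_trans (stieltjes_le FG mA))//.
  rewrite (@stieltjes_prim (fun r => 2 * m r))//; last first.
    by move=> r; rewrite mulr_ge0.
  rewrite null_set_integral//.
  have /measurable_int := i2.
  exact: measurable_funS.
move=> p [ip pF]; exists (fun r => p r - m r).
have ipm : mu.-integrable [set: R] (EFin \o (fun r => p r - m r)).
  by under [X in _.-integrable _ X]funext do rewrite /= EFinB; exact: integrableB.
split=> // s t st; have := pF _ _ st.
have E r : prim (fun r => p r - m r) r = prim p r - prim m r.
  by rewrite /prim RintegralB//; exact: integrable_itv.
by rewrite /= /F !E; lra.
Qed.

End density.

(** * Absolutely continuous functions on an interval *)

Section clamp.
Context {R : realType}.
Local Notation mu := (@lebesgue_measure R).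

(** Precomposition with [clamp a b] extends a function on `[a, b] by constants. *)
Definition clamp (a b t : R) : R := Num.max a (Num.min b t).

Lemma clamp_id a b t : a <= t <= b -> clamp a b t = t.
Proof. by move=> /andP[at_ tb]; rewrite /clamp min_r// max_r. Qed.

Lemma clamp_itv a b t : a <= b -> a <= clamp a b t <= b.
Proof. by move=> ab; rewrite /clamp le_max lexx/= ge_max ab ge_min lexx. Qed.

Lemma clamp_nd a b s t : s <= t -> clamp a b s <= clamp a b t.
Proof. by move=> st; rewrite /clamp le_max2 ?le_min2. Qed.

(** Transfers a bound by integrals over subintervals of `[a, b] to the whole line,
    where primitives are available.  [D] is arbitrary because the lemma serves
    distances along curves, increments of functions and lengths of intervals. *)
Lemma clamp_bound (D : R -> R -> R) a b (m : R -> R) : a <= b ->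
  mu.-integrable `[a, b] (EFin \o m) ->
  (forall s t, a <= s -> s <= t -> t <= b ->
    D s t <= \int[mu]_(r in `[s, t]) m r) ->
  exists M : R -> R, [/\ mu.-integrable [set: R] (EFin \o M),
    (forall r, 0 <= M r) &
    forall s t, s <= t -> D (clamp a b s) (clamp a b t) <= prim M t - prim M s].
Proof.
move=> ab im Dm.
pose M := (fun r => `|m r|) \_ `[a, b].
have M0 r : 0 <= M r by rewrite /M patchE; case: ifP.
have iM : mu.-integrable [set: R] (EFin \o M).
  rewrite /M -restrict_EFin; apply/(integrable_restrict _ _ _) => //=.
  by rewrite setTI; exact: integrable_norm.
exists M; split => // s t st.
have /andP[a1 b1] := clamp_itv s ab; have /andP[a2 b2] := clamp_itv t ab.
have cst := clamp_nd a b st.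
apply: (le_trans (Dm _ _ a1 cst b2)).
apply: (@le_trans _ _ (prim M (clamp a b t) - prim M (clamp a b s))).
  rewrite -prim_itv//.
  have sub : `[clamp a b s, clamp a b t]%classic `<=` `[a, b]%classic.
    by apply: subset_itv; rewrite bnd_simp.
  apply: le_Rintegral => //.
  - by apply: integrableS im.
  - exact: integrable_itv.
  - by move=> r rst; rewrite /M patchE mem_set ?ler_norm//; exact: sub.
have nd := prim_nd iM M0.
have [ta|at_] := leP t a.
  have -> : clamp a b t = a by rewrite /clamp max_l// ge_min ta orbT.
  have -> : clamp a b s = a by rewrite /clamp max_l// ge_min (le_trans st) ?orbT.
  by rewrite subrr subr_ge0 nd.
have [bs|sb] := leP b s.
  have -> : clamp a b s = b by rewrite /clamp min_l// max_r.
  have -> : clamp a b t = b by rewrite /clamp min_l ?max_r// (le_trans bs).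
  by rewrite subrr subr_ge0 nd.
apply: lerB; apply: nd; rewrite /clamp.
  by rewrite ge_max (ltW at_) ge_min lexx orbT.
by rewrite le_max le_min lexx (ltW sb) orbT.
Qed.

(** An absolutely continuous function is the primitive of its derivative. *)
Lemma ac_derivative_le0 (f : R -> R) a b (m : R -> R) : a < b ->
  mu.-integrable `[a, b] (EFin \o m) ->
  (forall s t, a <= s -> s <= t -> t <= b ->
    `|f t - f s| <= \int[mu]_(r in `[s, t]) m r) ->
  {ae mu, forall t, a < t < b -> derivable f t 1 /\ derive1 f t <= 0} ->
  f b <= f a.
Proof.
move=> ab im fm f'0.
have [M [iM M0 fM]] := @clamp_bound (fun s t => `|f t - f s|) a b m (ltW ab) im fm.
have [p [ip pf]] := @ac_density R (f \o clamp a b) M iM M0 fM.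
have ca : clamp a b a = a by rewrite clamp_id// lexx ltW.
have cb : clamp a b b = b by rewrite clamp_id// lexx ltW.
have := pf a b (ltW ab); rewrite /= ca cb => pab.
rewrite -subr_le0 pab -prim_itv//; last exact: ltW.
rewrite -Rintegral_itv_bndo_bndc; last exact: integrable_itv.
rewrite -Rintegral_itv_obnd_cbnd; last exact: integrable_itv.
have p0 : {ae mu, forall t, `]a, b[%classic t -> (p t)%:E = (- `|p t|)%:E}.
  have := prim_ae ip; apply: ae_imp2 f'0 => t f't [dp p't].
  rewrite /= in_itv/= => /andP[at_ tb].
  have [|df f'] := f't; first by rewrite at_.
  suff -> : p t = derive1 f t by rewrite ler0_norm// opprK.
  rewrite -p't !derive1E.
  rewrite (@near_eq_derive _ _ _ _ (fun r => f r + (prim p a - f a))).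
    by rewrite deriveD// derive_cst addr0.
  exists (Num.min (t - a) (b - t)) => /=; first by rewrite lt_min !subr_gt0 at_.
  move=> r /=; rewrite lt_min !ltr_norml => /andP[/andP[r1 r2] /andP[r3 r4]].
  have ar : a <= r by lra.
  by have := pf _ _ ar; rewrite /= ca clamp_id; [lra|rewrite ar; lra].
have /measurable_int/measurable_EFinP mp := integrable_itv `]a, b[ ip.
rewrite /Rintegral.
have -> : (\int[mu]_(x in `]a, b[) (p x)%:E = \int[mu]_(x in `]a, b[) (- `|p x|)%:E)%E.
  apply: ae_eq_integral => //; first exact/measurable_EFinP.
  by apply/measurable_EFinP; apply: measurableT_comp => //; exact: measurableT_comp.
rewrite -[X in _ <= X]/(fine 0%E).
have i0 : mu.-integrable `]a, b[ (EFin \o (fun r => `|p r|)).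
  by apply: integrable_norm; exact: integrable_itv.
rewrite (_ : (\int[mu]_(x in `]a, b[) _)%E = - \int[mu]_(x in `]a, b[) (`|p x|)%:E)%E.
  rewrite fineN oppr_le0 fine_ge0//.
  by apply: integral_ge0 => r _; rewrite lee_fin.
by rewrite -integralN//; exact: integrable_add_def.
Qed.

End clamp.

(** * Curves of finite energy are absolutely continuous *)

Section energy_ac.
Context {R : realType}.
Local Notation mu := (@lebesgue_measure R).

(** The pointwise infimum of the nonnegative majorants is again a majorant.  It is
    the smallest one: following a majorant [l] up to [s] and then the increments
    of [G] yields a majorant, hence [V t <= V s + (G t - G s)].  For [D] the
    distance along a curve, [V] is the length of the curve. *)
Lemma min_majorant (D : R -> R -> R) (G0 : R -> R) :
  (forall s t r, s <= t -> t <= r -> D s r <= D s t + D t r) ->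
  (forall s t, s <= t -> 0 <= D s t) ->
  (forall t, 0 <= G0 t) -> (forall s t, s <= t -> D s t <= G0 t - G0 s) ->
  exists V : R -> R, (forall s t, s <= t -> D s t <= V t - V s) /\
    forall G : R -> R, (forall s t, s <= t -> D s t <= G t - G s) ->
      forall s t, s <= t -> V t - V s <= G t - G s.
Proof.
move=> tri D0 G00 DG0.
pose F : set (R -> R) := [set l | (forall t, 0 <= l t) /\
  forall s t, s <= t -> D s t <= l t - l s].
pose V t := inf [set l t | l in F].
have hasinf t : has_inf [set l t | l in F].
  split; first by exists (G0 t), G0.
  by exists 0 => _ [l [l0 _] <-]; exact: l0.
have Vl l t : F l -> V t <= l t.
  by move=> Fl; apply: ge_inf; [case: (hasinf t)|exists l].
have lV t x : (forall l, F l -> x <= l t) -> x <= V t.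
  move=> xl; apply: lb_le_inf; first by case: (hasinf t).
  by move=> _ [l Fl <-]; exact: xl.
exists V; split=> [s t st|G DG s t st].
  rewrite lerBrDr; apply: lV => l Fl.
  by case: (Fl) => _ /(_ _ _ st); have := Vl _ s Fl; lra.
rewrite lerBlDr addrC -lerBlDr; apply: lV => l Fl.
rewrite lerBlDr.
pose l' r := if r <= s then l r else l s + (G r - G s).
have G0' r : s <= r -> 0 <= G r - G s.
  by move=> sr; rewrite (le_trans (D0 _ _ sr))// DG.
suff Fl' : F l'.
  have := Vl _ t Fl'; rewrite /l'; case: ifPn => [ts|_]; last by lra.
  by have -> : t = s; [apply/le_anti/andP|lra].
case: Fl => l0 lD; split=> [r|r r' rr'].
  rewrite /l'; case: ifPn => //; rewrite -ltNge => /ltW sr.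
  by rewrite addr_ge0// G0'.
rewrite /l'; case: ifPn => r's; case: ifPn => rs.
- exact: lD.
- by move: rs; rewrite (le_trans rr' r's).
- have sr' : s <= r' by apply/ltW; rewrite ltNge.
  by have := tri _ _ _ rs sr'; have := lD _ _ rs; have := DG _ _ sr'; lra.
- by have := DG _ _ rr'; lra.
Qed.

Lemma le_amgm (d a t w : R) : 0 < a -> 0 <= t -> 0 <= w -> d ^+ 2 <= t * w ->
  d <= (a * w + t / a) / 2.
Proof.
move=> a0 t0 w0 dtw.
have s0 : 0 <= (a * w + t / a) / 2.
  have a0' := ltW a0.
  by apply: divr_ge0 => //; apply: addr_ge0; [exact: mulr_ge0|exact: divr_ge0].
have [d0|d0] := leP d 0; first exact: le_trans s0.
rewrite -(@ler_pXn2r _ 2)// ?nnegrE ?(ltW d0)//.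
apply: (le_trans dtw); rewrite -subr_ge0.
have -> : ((a * w + t / a) / 2) ^+ 2 - t * w = ((a * w - t / a) / 2) ^+ 2.
  by field; rewrite gt_eqF.
exact: sqr_ge0.
Qed.

(** By [le_amgm] the length [L] of the curve grows at most like
    [(a * W + T / a) / 2] for every [a > 0], where [T] is the primitive of [tau].
    The part of [L] not accounted for by [T / (2 * a)] is the minimal majorant [V]
    of its increments; it is continuous, as [L] is, and its total increment is at
    most [a * B / 2].  As the Stieltjes measure of [T] vanishes on null sets, that
    of [L] is at most [a * B / 2] there, hence 0 because [a] is arbitrary. *)
Lemma energy_ac (X : metricType R) (g : R -> X) (W tau : R -> R) (B : R) :
  mu.-integrable [set: R] (EFin \o tau) -> (forall r, 0 <= tau r) ->
  {homo W : s t / s <= t} -> (forall s t, W t - W s <= B) ->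
  (forall s t, s <= t ->
    mdist (g s) (g t) ^+ 2 <= (prim tau t - prim tau s) * (W t - W s)) ->
  exists m : R -> R, mu.-integrable [set: R] (EFin \o m) /\
    forall s t, s <= t -> mdist (g s) (g t) <= prim m t - prim m s.
Proof.
move=> itau tau0 ndW WB gW.
pose T := prim tau.
have ndT := prim_nd itau tau0.
have T0 t : 0 <= T t by apply: Rintegral_ge0.
have B0 : 0 <= B by rewrite -(subrr (W 0)) WB.
have gG a s t : 0 < a -> s <= t ->
    mdist (g s) (g t) <= (a * (W t - W s) + (T t - T s) / a) / 2.
  by move=> a0 st; apply: le_amgm; rewrite ?subr_ge0 ?ndW ?ndT// gW.
have [L [gL Lmin]] : exists L : R -> R,
    (forall s t, s <= t -> mdist (g s) (g t) <= L t - L s) /\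
    forall G : R -> R, (forall s t, s <= t -> mdist (g s) (g t) <= G t - G s) ->
      forall s t, s <= t -> L t - L s <= G t - G s.
  apply: (@min_majorant _ (fun t => (W t - W 0 + B + T t) / 2)).
  - by move=> *; exact: metric_triangle.
  - by move=> *; exact: mdist_ge0.
  - by move=> t; have := WB t 0; have := T0 t; lra.
  - by move=> s t st; have := gG 1 _ _ ltr01 st; rewrite divr1; lra.
have LG a s t : 0 < a -> s <= t ->
    L t - L s <= (a * (W t - W s) + (T t - T s) / a) / 2.
  move=> a0 st.
  have := Lmin (fun t => (a * W t + T t / a) / 2).
  have E u v : (a * W v + T v / a) / 2 - (a * W u + T u / a) / 2 =
    (a * (W v - W u) + (T v - T u) / a) / 2 by field; rewrite gt_eqF.
  move=> /(_ _ _ _ st); rewrite E; apply => u v uv; rewrite E; exact: gG.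
have ndL : {homo L : s t / s <= t}.
  by move=> s t st; rewrite -subr_ge0 (le_trans (mdist_ge0 _ _) (gL _ _ st)).
have LB s t a : 0 < a -> s <= t -> L t - L s <= a * B / 2 + (T t - T s) / a / 2.
  move=> a0 st; apply: (le_trans (LG _ _ _ a0 st)).
  by rewrite mulrDl lerD2r ler_pM2r// ler_pM2l.
have cL : continuous L.
  move=> t; apply/cvgrPdist_le => e e0.
  pose a := e / (B + 1).
  have a0 : 0 < a by rewrite divr_gt0// ltr_wpDl.
  have aB : a * B <= e.
    rewrite /a mulrAC ler_pdivrMr ?ltr_wpDl// ler_pM2l// lerDl//.
  have := @prim_continuous _ _ itau t; move=> /cvgrPdist_le/(_ (e * a)).
  rewrite mulr_gt0// => /(_ isT); apply: filterS => r Tr.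
  have TrE s u : s <= u -> `|T s - T u| <= e * a -> (T u - T s) / a <= e.
    move=> su; rewrite ler0_norm ?subr_le0 ?ndT// opprB => h.
    by rewrite ler_pdivrMr.
  have [tr|/ltW rt] := leP t r.
    rewrite ler0_norm ?subr_le0 ?ndL// opprB.
    by have := LB _ _ _ a0 tr; have := TrE _ _ tr Tr; lra.
  rewrite ger0_norm ?subr_ge0 ?ndL//.
  have := LB _ _ _ a0 rt; have := TrE _ _ rt; rewrite distrC => /(_ Tr); lra.
pose cuL : cumulative R R := HB.pack L
  (isCumulative.Build R _ R L ndL (right_continuousW cL)).
have [|A mA A0|m [im mL]] := @stieltjes_density R cuL (B / 2 + \int[mu]_r tau r / 2).
- move=> s t /=.
  have I0 : 0 <= \int[mu]_r tau r by apply: Rintegral_ge0.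
  have [st|/ltW ts] := leP s t; last by have := ndL _ _ ts; lra.
  have := LB _ _ _ ltr01 st; rewrite mul1r divr1.
  suff : T t - T s <= \int[mu]_r tau r by lra.
  rewrite /T -prim_itv// /Rintegral fine_le//.
  + by apply: integrable_fin_num => //; exact: integrable_itv.
  + exact: integrable_fin_num.
  + apply: ge0_subset_integral => //; first exact: measurable_int itau.
    by move=> r _; rewrite lee_fin.
- apply/eqP; rewrite eq_le measure_ge0 andbT.
  apply/lee_addgt0Pr => e e0; rewrite add0e.
  pose a := e / (B + 1).
  have a0 : 0 < a by rewrite divr_gt0// ltr_wpDl.
  have aB : a * B <= e.
    by rewrite /a mulrAC ler_pdivrMr ?ltr_wpDl// ler_pM2l// lerDl.
  pose D s t := Num.max 0 (L t - L s - (T t - T s) / a / 2).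
  have T2 s t : s <= t -> 0 <= (T t - T s) / a / 2.
    move=> st; apply: divr_ge0 => //; apply: divr_ge0; last exact: ltW.
    by rewrite subr_ge0 ndT.
  have W2 s t : s <= t -> 0 <= a * (W t - W s) / 2.
    move=> st; apply: divr_ge0 => //; apply: mulr_ge0; first exact: ltW.
    by rewrite subr_ge0 ndW.
  have D0 s t : 0 <= D s t by rewrite /D le_max lexx.
  have D1 s t : L t - L s - (T t - T s) / a / 2 <= D s t.
    by rewrite /D le_max lexx orbT.
  have DL s t : s <= t -> D s t <= L t - L s.
    by move=> st; rewrite /D ge_max subr_ge0 ndL//= gerBl T2.
  have [V [DV Vmin]] : exists V : R -> R,
      (forall s t, s <= t -> D s t <= V t - V s) /\
      forall G : R -> R, (forall s t, s <= t -> D s t <= G t - G s) ->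
        forall s t, s <= t -> V t - V s <= G t - G s.
    apply: (@min_majorant _ (fun t => (a * (W t - W 0 + B)) / 2)).
    + move=> s t r st tr.
      have h1 : 0 <= D s t + D t r by apply: addr_ge0.
      have h2 : L r - L s - (T r - T s) / a / 2 <= D s t + D t r.
        by have := D1 s t; have := D1 t r; lra.
      by rewrite [leLHS]/D ge_max h1 h2.
    + by move=> s t _; exact: D0.
    + by move=> t; rewrite divr_ge0// mulr_ge0 ?(ltW a0)//; have := WB t 0; lra.
    + move=> s t st; rewrite /D ge_max -mulrBl -mulrBr.
      have -> : W t - W 0 + B - (W s - W 0 + B) = W t - W s by ring.
      by rewrite W2//=; have := LG _ _ _ a0 st; lra.
  have VL s t : s <= t -> V t - V s <= L t - L s by apply: Vmin.
  have VW s t : s <= t -> V t - V s <= e.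
    move=> st; have := Vmin (fun t => a * W t / 2).
    move=> /(_ _ _ _ st) VW; apply: (le_trans (VW _)).
      move=> u v uv; rewrite -mulrBl -mulrBr /D ge_max.
      by rewrite W2//=; have := LG _ _ _ a0 uv; lra.
    rewrite -mulrBl -mulrBr.
    have : a * (W t - W s) <= a * B by rewrite ler_pM2l.
    lra.
  have ndV : {homo V : s t / s <= t}.
    move=> s t st; by rewrite -subr_ge0 (le_trans _ (DV _ _ st))//; exact: D0.
  have cV : continuous V.
    apply: (continuous_dominated cL) => s t st.
    by rewrite ger0_norm ?subr_ge0 ?ndV// VL.
  pose m r := (a * 2)^-1 * tau r.
  have im : mu.-integrable [set: R] (EFin \o m).
    rewrite [X in _.-integrable _ X](_ : _ = fun r => (a * 2)^-1%:E * (tau r)%:E)%E; last first.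
      by apply/funext => r /=; rewrite EFinM.
    exact: integrableZl.
  have m0 r : 0 <= m r by rewrite mulr_ge0// invr_ge0 mulr_ge0// ltW.
  have mE t : prim m t = (a * 2)^-1 * T t.
    by rewrite /prim RintegralZl//; exact: integrable_itv.
  pose cuV : cumulative R R := HB.pack V
    (isCumulative.Build R _ R V ndV (right_continuousW cV)).
  pose cuM : cumulative R R := HB.pack (prim m)
    (isCumulative.Build R _ R _ (prim_nd im m0) (right_continuousW (prim_continuous im))).
  have ndK : {homo (fun t => V t + prim m t) : s t / s <= t}.
    by move=> s t st; apply: lerD; [exact: (ndV _ _ st)|exact: prim_nd].
  have rcK : right_continuous (fun t => V t + prim m t).
    by apply: right_continuousW => t; apply: cvgD; [exact: cV|exact: prim_continuous].
  pose cuK : cumulative R R := HB.pack (fun t => V t + prim m t)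
    (isCumulative.Build R _ R _ ndK rcK).
  have LK s t : s <= t -> cuL t - cuL s <= cuK t - cuK s.
    move=> st /=; have := DV _ _ st; rewrite /D ge_max => /andP[_].
    by rewrite !mE; have -> : (T t - T s) / a / 2 = (a * 2)^-1 * T t - (a * 2)^-1 * T s;
      [field; rewrite gt_eqF|lra].
  apply: (le_trans (stieltjes_le LK mA)).
  rewrite (@stieltjes_add _ cuV cuM cuK)//.
  rewrite (@stieltjes_prim _ m cuM)// null_set_integral//; last first.
    have /measurable_int := im; exact: measurable_funS.
  rewrite adde0.
  apply: (@le_trans _ _ (lebesgue_stieltjes_measure cuV [set: R])).
    by apply: le_measure; rewrite ?inE.
  apply: stieltjes_setT_le => s t /=.
  have [st|/ltW ts] := leP s t; first exact: VW.
  by rewrite (le_trans _ (ltW e0))// subr_le0 ndV.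
- exists m; split => // s t st.
  by rewrite -mL//=; exact: gL.
Qed.

End energy_ac.

(** * Integrals of nonnegative functions that need not be measurable *)

Section lower_integral.
Import HBNNSimple.
Local Open Scope ereal_scope.
Context {R : realType}.
Local Notation mu := (@lebesgue_measure R).
Implicit Types (D : set (measurableTypeR R)) (f g : measurableTypeR R -> \bar R).

(** The integral of a nonnegative function is the supremum of the integrals of the
    simple functions below it.  Inequalities are proved from this definition
    alone, because the measurability of slopes along curves is not known. *)
Lemma lower_integral_le D f g : measurable D ->
  (forall t, D t -> 0 <= f t) -> (forall t, D t -> 0 <= g t) ->
  measurable_fun D g ->
  {ae mu, forall t, D t -> f t <= g t} ->
  \int[mu]_(t in D) f t <= \int[mu]_(t in D) g t.
Proof.
move=> mD f0 g0 mg fg; rewrite ge0_integralE//.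
apply/ge_ereal_sup => _ [h hf <-].
rewrite [leRHS]integral_mkcond.
have -> : sintegral mu h = \int[mu]_t (h t)%:E.
  by rewrite integral_nnsfun// patch_setT.
apply: ae_ge0_le_integral => //.
- by move=> t _; rewrite lee_fin fun_ge0.
- by apply/measurable_EFinP; apply: measurable_funTS.
- by move=> t _; apply: erestrict_ge0.
- exact/(measurable_restrictT _ _).1.
apply: ae_imp fg => t fg _; apply: (le_trans (hf t)).
by rewrite !patchE; case: ifPn => // /set_mem /fg.
Qed.

Lemma lower_integral_ge D f g : measurable D ->
  (forall t, D t -> 0 <= f t) -> (forall t, D t -> 0 <= g t) ->
  measurable_fun D g ->
  {ae mu, forall t, D t -> g t <= f t} ->
  \int[mu]_(t in D) g t <= \int[mu]_(t in D) f t.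
Proof.
move=> mD f0 g0 mg [N [mN N0 gfN]].
rewrite (ge0_negligible_integral mN)// ge0_integralE; last first.
  by move=> t [/g0].
rewrite [leRHS]ge0_integralE//.
apply: le_ereal_sup => _ [h hg <-]; exists h => // t.
apply: (le_trans (hg t)); rewrite !patchE.
case: ifPn => [/set_mem[Dt Nt]|_]; last by case: ifPn => // /set_mem/f0.
rewrite mem_set//; apply: contrapT => gf; apply: Nt; apply: gfN => /= H.
exact/gf/H.
Qed.

Lemma lower_integral_sup D f (b : \bar R) : measurable D ->
  (forall t, D t -> 0 <= f t) ->
  (forall g, measurable_fun D g -> (forall t, D t -> 0 <= g t <= f t) ->
    \int[mu]_(t in D) g t <= b) ->
  \int[mu]_(t in D) f t <= b.
Proof.
move=> mD f0 gb; rewrite ge0_integralE//.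
apply/ge_ereal_sup => _ [h hf <-].
have hD : h = h \_ D :> (R -> R).
  apply/funext => t; rewrite patchE; case: ifPn => // tD.
  apply/eqP; rewrite eq_le fun_ge0 andbT -lee_fin.
  by have := hf t; rewrite patchE (negbTE tD).
have -> : sintegral mu h = \int[mu]_(t in D) (h t)%:E.
  by rewrite integral_nnsfun// -hD.
apply: gb; first by apply/measurable_EFinP; apply: measurable_funTS.
by move=> t Dt; rewrite lee_fin fun_ge0/=; have := hf t; rewrite patchE mem_set.
Qed.

(** Only this inequality holds without measurability: a sum of two minorants is a
    minorant of the sum, but not every minorant of the sum splits. *)
Lemma lower_integralD D f g : measurable D ->
  (forall t, D t -> 0 <= f t) -> (forall t, D t -> 0 <= g t) ->
  \int[mu]_(t in D) f t + \int[mu]_(t in D) g t <=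
  \int[mu]_(t in D) (f t + g t).
Proof.
move=> mD f0 g0; set b := \int[mu]_(t in D) (f t + g t).
have b0 : 0 <= b by apply: integral_ge0 => t Dt; rewrite adde_ge0 ?f0 ?g0.
have [boo|bfin] := leP +oo b; first by rewrite (le_trans _ boo)// leey.
have bf : b \is a fin_num by rewrite ge0_fin_numE.
have key u v : measurable_fun D u -> (forall t, D t -> 0 <= u t <= f t) ->
    measurable_fun D v -> (forall t, D t -> 0 <= v t <= g t) ->
    \int[mu]_(t in D) u t + \int[mu]_(t in D) v t <= b.
  move=> mu' uf mv vg; rewrite -ge0_integralD//; last 2 first.
  - by move=> t /uf/andP[].
  - by move=> t /vg/andP[].
  apply: lower_integral_ge => //.
  - by move=> t Dt; rewrite adde_ge0 ?f0 ?g0.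
  - by move=> t Dt; have /andP[? _] := uf t Dt; have /andP[? _] := vg t Dt; exact: adde_ge0.
  - exact: emeasurable_funD.
  - by apply/aeW => t Dt; rewrite leeD//; [have/andP[] := uf t Dt|have/andP[] := vg t Dt].
have fb u : measurable_fun D u -> (forall t, D t -> 0 <= u t <= f t) ->
    \int[mu]_(t in D) u t \is a fin_num /\ \int[mu]_(t in D) u t + \int[mu]_(t in D) g t <= b.
  move=> mu' uf.
  have fu : \int[mu]_(t in D) u t \is a fin_num.
    rewrite ge0_fin_numE; last by apply: integral_ge0 => t /uf/andP[].
    apply: le_lt_trans bfin; have := key u (cst 0) mu' uf (@measurable_cst _ _ _ _ _ _).
    by rewrite integral0 adde0; apply => t /g0 ->; rewrite lexx.
  split => //; rewrite -leeBrDl//; apply: lower_integral_sup => // v mv vg.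
  by rewrite leeBrDl//; exact: key.
have fg : \int[mu]_(t in D) g t \is a fin_num.
  rewrite ge0_fin_numE; last exact: integral_ge0.
  apply: le_lt_trans bfin; have := fb (cst 0) (@measurable_cst _ _ _ _ _ _).
  by rewrite integral0 add0e => -[|//] t /f0 ->; rewrite lexx.
rewrite -leeBrDr//; apply: lower_integral_sup => // u mu' uf.
by rewrite leeBrDr//; case: (fb u mu' uf).
Qed.

Lemma lower_integralZ D f (k : R) : measurable D -> (0 <= k)%R ->
  (forall t, D t -> 0 <= f t) ->
  k%:E * \int[mu]_(t in D) f t <= \int[mu]_(t in D) (k%:E * f t).
Proof.
move=> mD k0 f0; have [->|kN0] := eqVneq k 0%R.
  by rewrite mul0e; apply: integral_ge0 => t Dt; rewrite mul0e.
have {}k0 : (0 < k)%R by rewrite lt_neqAle eq_sym kN0.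
rewrite -lee_pdivlMl//; apply: lower_integral_sup => // g mg gf.
have g0 t : D t -> 0 <= g t by move=> /gf/andP[].
rewrite lee_pdivlMl// -ge0_integralZl_EFin//; last exact: ltW.
apply: lower_integral_ge => //.
- by move=> t Dt; rewrite mule_ge0 ?f0 ?lee_fin ?ltW.
- by move=> t Dt; rewrite mule_ge0 ?g0 ?lee_fin ?ltW.
- exact: measurable_funeM.
- apply/aeW => t Dt; rewrite lee_pmul2l//.
  by have /andP[] := gf t Dt.
Qed.

End lower_integral.

(** * Inferior limits and translations *)

Section filters.
Local Open Scope ereal_scope.
Context {R : realType} {T : choiceType} {X : filteredType T}.
Implicit Types (f : X -> \bar R) (F : set_system X) (l : \bar R).

Lemma limf_einf_ge f F l : F [set x | l <= f x] -> l <= limf_einf f F.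
Proof.
move=> Fl; rewrite limf_einfE.
apply: le_trans (ereal_sup_ubound _); last by exists [set x | l <= f x].
by apply: le_ereal_inf_tmp => _ [x lf <-].
Qed.

Lemma limf_einf_gt f F l : Filter F -> l < limf_einf f F ->
  F [set x | l < f x].
Proof.
move=> FF; rewrite limf_einfE => /ereal_sup_gt[_ [V FV <-]] lV.
apply: filterS FV => x Vx; apply: (lt_le_trans lV).
by apply: ereal_inf_lbound; exists x.
Qed.

Lemma limf_esup_le f F l : F [set x | f x <= l] -> limf_esup f F <= l.
Proof.
move=> Fl; rewrite limf_esupE.
apply: le_trans (ereal_inf_lbound _) _; first by exists [set x | f x <= l].
by apply: ge_ereal_sup => _ [x lf <-].
Qed.

Lemma limf_einf_frequently f F l : limf_einf f F < l ->
  forall V, F V -> exists2 x, V x & f x < l.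
Proof.
move=> fl V FV; apply: contrapT => nV.
suff : l <= limf_einf f F by rewrite leNgt fl.
rewrite limf_einfE; apply: le_trans (ereal_sup_ubound _); last by exists V.
apply: le_ereal_inf_tmp => _ [x Vx <-]; rewrite leNgt; apply/negP => fx.
by apply: nV; exists x.
Qed.

End filters.

Section sequences.
Local Open Scope ereal_scope.
Context {R : realType}.
Implicit Types (u : nat -> \bar R) (l : \bar R).

Lemma limn_einf_ge u l : (\forall n \near \oo, l <= u n) -> l <= limn_einf u.
Proof. exact: limf_einf_ge. Qed.

Lemma limn_einf_gt u l : l < limn_einf u -> \forall n \near \oo, l < u n.
Proof. exact: limf_einf_gt. Qed.

End sequences.

Section translation.
Context {R : realType}.
Local Notation mu := (@lebesgue_measure R).

Lemma integral_translation (f : R -> \bar R) (a b h : R) :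
  measurable_fun [set: R] f -> (forall t, 0 <= f t)%E ->
  (\int[mu]_(t in `[a, b]) f (t + h)%R = \int[mu]_(t in `[(a + h)%R, (b + h)%R]) f t)%E.
Proof.
move=> mf f0.
pose phi : measurableTypeR R -> measurableTypeR R := fun t => t + h.
have mphi : measurable_fun [set: measurableTypeR R] phi.
  by apply: measurable_funD => //; exact: measurable_cst.
have muphi (A : set R) : measurable A -> pushforward mu phi A = mu A.
  move=> mA; apply/esym/lebesgue_measure_unique => //= _ [[c d]] _ <-.
  rewrite /pushforward (_ : phi @^-1` _ = `]c - h, d - h]%classic); last first.
    by apply/seteqP; split => r; rewrite /phi /= !in_itv/= ltrBlDr lerBrDr.
  rewrite !lebesgue_measure_itv/= !lte_fin ltrD2r.
  by case: ifP => // _; rewrite -!EFinB; congr EFin => /=; ring.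
rewrite (_ : `[a, b]%classic = phi @^-1` `[(a + h)%R, (b + h)%R]); last first.
  by apply/seteqP; split => r; rewrite /phi /= !in_itv/= !lerD2r.
rewrite -(@ge0_integral_pushforward _ _ _ _ _ phi mphi mu _ f)//; last first.
  exact: measurable_funS mf.
by apply: eq_measure_integral => //= A mA AS; exact: muphi.
Qed.

End translation.

(** * Integral bounds by difference quotients *)

Section energy_bound.
Context {R : realType}.
Local Notation mu := (@lebesgue_measure R).

(** The two translated integrals of [W] cancel except on two intervals of length
    [2 * h] around 0 and 1. *)
Lemma integral_increments_le (W : R -> R) (h : R) : 0 < h -> h < 2^-1 ->
  {homo W : s t / s <= t} -> (forall t, W 0 <= W t <= W 1) ->
  (\int[mu]_(t in `[0%R, 1%R]) (W (t + h)%R - W (t - h)%R)%:E <=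
   (2 * h * (W 1 - W 0))%:E)%E.
Proof.
move=> h0 h2 ndW W01.
pose V t := W t - W 0.
have V0 t : 0 <= V t by have := W01 t; rewrite /V; lra.
have V1 t : V t <= W 1 - W 0 by have := W01 t; rewrite /V; lra.
have ndV : {homo V : s t / s <= t} by move=> s t st; rewrite lerB ?ndW.
have mV : measurable_fun [set: R] V by exact: nondecreasing_measurable.
have mVE : measurable_fun [set: R] (EFin \o V) by exact/measurable_EFinP.
have VE0 t : (0 <= (EFin \o V) t)%E by rewrite lee_fin.
have iV (c d k : R) : mu.-integrable `[c, d] (EFin \o (fun t => V (t + k))).
  apply: measurable_bounded_integrable => //.
  - by rewrite /= lebesgue_measure_itv/=; case: ifP; rewrite ?ltry.
  - apply: (nondecreasing_measurable (measurable_itv _)) => s t st.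
    by apply: ndV; rewrite lerD2r.
  - exists (W 1 - W 0); split; first exact: num_real.
    by move=> x Bx t _ /=; rewrite ger0_norm// (le_trans (V1 _))// ltW.
have -> : (\int[mu]_(t in `[0%R, 1%R]) (W (t + h)%R - W (t - h)%R)%:E =
   \int[mu]_(t in `[0%R, 1%R]) (V (t + h)%R)%:E -
   \int[mu]_(t in `[0%R, 1%R]) (V (t - h)%R)%:E)%E.
  rewrite -integralB_EFin//.
  by apply: eq_integral => t _; rewrite -EFinB /V; congr EFin; ring.
have finV c d k : (\int[mu]_(t in `[c, d]) (V (t + k)%R)%:E \is a fin_num)%E.
  by apply: integrable_fin_num => //; exact: iV.
have finV0 c d : (\int[mu]_(t in `[c, d]) (V t)%:E \is a fin_num)%E.
  have := finV c d 0; under eq_integral do rewrite addr0; by [].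
rewrite leeBlDl//.
rewrite (@integral_translation _ (EFin \o V) 0 1 h)//.
rewrite (@integral_translation _ (EFin \o V) 0 1 (- h))//.
rewrite !add0r.
rewrite (@itv_bndbnd_setU _ _ _ (BRight (1 - h))) ?bnd_simp; [|lra|lra].
rewrite ge0_integral_setU//=; last 3 first.
- exact: measurable_funTS.
- by move=> t _; rewrite lee_fin.
- apply/disj_setPS => y [/=]; rewrite 2!in_itv/= => /andP[_ yx] /andP[].
  by rewrite ltNge yx.
apply: leeD.
  apply: ge0_subset_integral => //=.
  - exact: measurable_funTS.
  - by move=> t _; rewrite lee_fin.
  - by move=> t /=; rewrite !in_itv/= => /andP[t1 t2]; apply/andP; split; lra.
apply: (@le_trans _ _ (\int[mu]_(t in `](1 - h)%R, (1 + h)%R]) (W 1 - W 0)%:E)%E).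
  apply: ge0_le_integral => //.
  - by move=> t _; rewrite lee_fin.
  - exact: measurable_funTS.
  - by move=> t _; rewrite lee_fin.
rewrite integral_cst//= lebesgue_measure_itv/= lte_fin ifT; last by lra.
by rewrite -EFinB -EFinM lee_fin; have := W01 0; nra.
Qed.

(** Where the limit defining the speed does not exist, the speed takes its default
    value 0 and the bound is trivial. *)
Lemma metric_speed_lower (X : metricType R) (g : R -> X) (t e : R) : 0 < e ->
  exists2 d, 0 < d & forall h, h != 0 -> `|h| < d ->
    metric_speed g t ^+ 2 - e <= (mdist (g (t + h)) (g t) / `|h|) ^+ 2.
Proof.
move=> e0; rewrite /metric_speed.
set D := fun h : R => mdist (g (t + h)) (g t) / `|h|.
have [cD|ncD] := pselect (cvg (D h @[h --> (0 : R)^'])); last first.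
  rewrite (dvgP ncD); exists 1 => // h _ _.
  by rewrite /point/= expr0n sub0r (le_trans _ (sqr_ge0 _))// oppr_le0 ltW.
have : D h ^+ 2 @[h --> (0 : R)^'] --> (lim (D h @[h --> (0 : R)^'])) ^+ 2.
  by under eq_fun do rewrite expr2; rewrite expr2; apply: cvgM.
move=> /cvgrPdist_le/(_ _ e0) [d /= d0 Hd]; exists d => // h h0 hd.
have /= := Hd h; rewrite sub0r normrN => /(_ hd h0).
by rewrite ler_norml /D => /andP[_]; lra.
Qed.

(** Fatou's lemma for the symmetric difference quotients of [W].  They see both
    one-sided neighbourhoods of [t], so that [q] may be controlled from the left
    at some times and from the right at others.  The time 1/2, where the flow time
    used below has a corner, is left out. *)
Lemma energy_bound (X : metricType R) (g : R -> X) (W : R -> R) (q : R -> \bar R) :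
  {homo W : s t / s <= t} -> (forall t, W 0 <= W t <= W 1) ->
  (forall t, 0 <= q t)%E ->
  (forall t, 0 < t < 1 -> t != 2^-1 -> exists2 h0, 0 < h0 &
    forall h, 0 < h < h0 ->
    ((mdist (g (t + h)) (g t) ^+ 2 + mdist (g (t - h)) (g t) ^+ 2)%:E +
      (2 * h ^+ 2)%:E * q t <= (h * (W (t + h) - W (t - h)))%:E)%E) ->
  (\int[mu]_(t in `]0%R, 1%R[) ((metric_speed g t ^+ 2)%:E + q t) <=
   (W 1 - W 0)%:E)%E.
Proof.
move=> ndW W01 q0 gW.
pose h n : R := n.+3%:R^-1.
have h0 n : 0 < h n by rewrite invr_gt0 ltr0n.
have h2 n : h n < 2^-1 by rewrite ltf_pV2 ?posrE ?ltr0n// ltr_nat.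
have hcvg : h n @[n --> \oo] --> 0.
  rewrite (_ : h = fun n => harmonic (n + 2)%N).
    by rewrite cvg_shiftn; exact: cvg_harmonic.
  by apply/funext => n; rewrite /h /harmonic addn2.
pose f n t := (W (t + h n) - W (t - h n)) / (2 * h n).
have f0 n t : 0 <= f n t.
  rewrite divr_ge0 ?mulr_ge0 ?(ltW (h0 n))// subr_ge0 ndW//.
  by have := h0 n; lra.
have mf n : measurable_fun [set: R] (f n).
  apply: measurable_funM; last exact: measurable_cst.
  apply: measurable_funB; apply: nondecreasing_measurable => // s t st;
  by apply: ndW; rewrite lerD2r.
have If n : (\int[mu]_(t in `]0%R, 1%R[) (f n t)%:E <= (W 1 - W 0)%:E)%E.
  apply: (@le_trans _ _ (\int[mu]_(t in `[0%R, 1%R]) (f n t)%:E)%E).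
    apply: ge0_subset_integral => //=.
    + by apply/measurable_EFinP; apply: measurable_funTS; exact: mf.
    + by move=> t _; rewrite lee_fin.
    + exact: subset_itv_oo_cc.
  have hn := h0 n.
  rewrite (_ : (\int[mu]_(t in `[0%R, 1%R]) (f n t)%:E)%E =
    (\int[mu]_(t in `[0%R, 1%R])
      ((2 * h n)^-1%:E * (W (t + h n)%R - W (t - h n)%R)%:E))%E); last first.
    by apply: eq_integral => t _; rewrite -EFinM mulrC.
  rewrite ge0_integralZl_EFin//=; last first.
  - by rewrite invr_ge0 mulr_ge0// ltW.
  - apply/measurable_EFinP; apply: measurable_funB;
    apply: nondecreasing_measurable => // s t st;
    by apply: ndW; rewrite lerD2r.
  - by move=> t _; rewrite lee_fin subr_ge0 ndW//; lra.
  apply: (@le_trans _ _ ((2 * h n)^-1%:E * (2 * h n * (W 1 - W 0))%:E)%E).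
    apply: lee_wpmul2l; first by rewrite lee_fin invr_ge0 mulr_ge0// ltW.
    exact: integral_increments_le.
  by rewrite -EFinM mulKf// mulf_neq0// gt_eqF.
apply: (@le_trans _ _ (\int[mu]_(t in `]0%R, 1%R[) limn_einf (fun n => (f n t)%:E))%E).
  apply: lower_integral_le => //.
  - by move=> t _; rewrite adde_ge0// lee_fin sqr_ge0.
  - by move=> t _; apply: limn_einf_ge; apply: nearW => n /=; rewrite lee_fin.
  - rewrite /limn_einf; apply: measurableT_comp => //.
    apply: measurable_fun_limn_esup => n; apply: measurableT_comp => //.
    by apply/measurable_EFinP; apply: measurable_funTS; exact: mf.
  have ae2 : {ae mu, forall t : R, t != 2^-1}.
    exists [set 2^-1]; split; [exact: measurable_set1|exact: lebesgue_measure_set1|].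
    by move=> t /= /negP; rewrite negbK => /eqP.
  apply: ae_imp ae2 => t t2 /=; rewrite in_itv/= => t01.
  have [hh hh0 H] := gW t t01 t2.
  have qfin : q t \is a fin_num.
    rewrite ge0_fin_numE// ltNge leye_eq; apply/negP => /eqP qoo.
    have /H : 0 < hh / 2 < hh by lra.
    by rewrite qoo gt0_muley ?lte_fin ?mulr_gt0 ?exprn_gt0 ?divr_gt0// addey.
  apply/lee_addgt0Pr => e e0.
  rewrite -(fineK qfin) -EFinD -leeBlDr// -EFinB.
  apply: limn_einf_ge => /=.
  have [d d0 sd] := metric_speed_lower g t e0.
  have := hcvg => /cvgrPdist_lt/(_ (Num.min d hh)).
  rewrite lt_min d0 hh0 => /(_ isT); apply: filterS => n.
  rewrite sub0r normrN (gtr0_norm (h0 n)) lt_min => /andP[hd hhh].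
  have := H (h n); rewrite h0 hhh => /(_ isT).
  rewrite -(fineK qfin) -EFinM -EFinD !lee_fin => Hn.
  rewrite /f ler_pdivlMr ?mulr_gt0//.
  have hn := h0 n.
  have := sd (h n); rewrite gt_eqF// gtr0_norm// hd => /(_ isT isT) s1.
  have := sd (- h n); rewrite oppr_eq0 gt_eqF// normrN gtr0_norm// hd => /(_ isT isT) s2.
  move: s1 s2; rewrite !expr_div_n !ler_pdivlMr ?exprn_gt0// => s1 s2.
  rewrite -(ler_pM2l hn).
  move: Hn s1 s2.
  set d1 := mdist _ _ ^+ 2; set d2 := mdist _ _ ^+ 2 => Hn s1 s2.
  by apply: (le_trans _ Hn); lra.
apply: (le_trans (fatou _ _ _ _)) => //.
- by move=> n; apply/measurable_EFinP; apply: measurable_funTS; exact: mf.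
- by move=> n t _; rewrite lee_fin.
rewrite leNgt; apply/negP => Hlt.
have [n Hn] := filter_ex (limn_einf_gt Hlt).
by have := If n; rewrite leNgt Hn.
Qed.

End energy_bound.

(** * Bounding the action of a curve *)

Section action_bound.
Context {R : realType} {X : metricType R}.
Local Notation mu := (@lebesgue_measure R).
Implicit Types g : R -> X.

Lemma abs_cont_prim (g : R -> X) (m : R -> R) (a b : R) :
  mu.-integrable [set: R] (EFin \o m) ->
  (forall s t, a <= s -> s <= t -> t <= b ->
    mdist (g s) (g t) <= prim m t - prim m s) -> abs_cont a b g.
Proof.
move=> im gm; exists m; split; first exact: integrable_itv.
by move=> s t as_ st tb; rewrite prim_itv// gm.
Qed.

Lemma abs_cont_clamp (g : R -> X) (a b : R) : a <= b -> abs_cont a b g ->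
  exists m : R -> R, [/\ mu.-integrable [set: R] (EFin \o m),
    (forall r, 0 <= m r) &
    forall s t, s <= t ->
      mdist (g (clamp a b s)) (g (clamp a b t)) <= prim m t - prim m s].
Proof.
by move=> ab [m [im gm]]; exact: (clamp_bound (D := fun s t => mdist (g s) (g t)) ab im).
Qed.

Lemma continuous_prim (g : R -> X) (m : R -> R) :
  mu.-integrable [set: R] (EFin \o m) ->
  (forall s t, s <= t -> mdist (g s) (g t) <= prim m t - prim m s) ->
  continuous g.
Proof.
move=> im gm t; apply/metricType_numDomainType.cvgrPdist_lt => e e0.
have := @prim_continuous _ _ im t; move=> /cvgrPdist_lt/(_ _ e0).
apply: filterS => r; apply: le_lt_trans.
have [tr|/ltW rt] := leP t r.
  by rewrite distrC; exact: le_trans (gm _ _ tr) (ler_norm _).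
by rewrite metric_sym; exact: le_trans (gm _ _ rt) (ler_norm _).
Qed.

Lemma abs_cont_curves01 g : abs_cont 0 1 g -> curves01 g.
Proof.
move=> /(abs_cont_clamp ler01) [m [im m0 gm]].
have cg : continuous (g \o clamp 0 1) := continuous_prim im gm.
rewrite /curves01 /=.
apply: (@subspace_eq_continuous _ _ _ (g \o clamp 0 1)).
  by move=> t; rewrite inE /= in_itv/= => t01; rewrite clamp_id.
exact: continuous_subspaceT.
Qed.

(** [energy_ac] and [energy_bound] applied to the extensions by constants. *)
Lemma action_bound g (W : R -> R) (q : R -> \bar R) :
  (forall s t, 0 <= s -> s <= t -> t <= 1 -> W s <= W t) ->
  (forall s t, 0 <= s -> s <= t -> t <= 1 ->
    mdist (g s) (g t) ^+ 2 <= (t - s) * (W t - W s)) ->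
  (forall t, 0 <= q t)%E ->
  (forall t, 0 < t < 1 -> t != 2^-1 -> exists2 h0, 0 < h0 &
    forall h, 0 < h < h0 -> 0 <= t - h -> t + h <= 1 ->
    ((mdist (g (t + h)) (g t) ^+ 2 + mdist (g (t - h)) (g t) ^+ 2)%:E +
      (2 * h ^+ 2)%:E * q t <= (h * (W (t + h) - W (t - h)))%:E)%E) ->
  abs_cont 0 1 g /\
  (\int[mu]_(t in `]0%R, 1%R[) ((metric_speed g t ^+ 2)%:E + q t) <=
   (W 1 - W 0)%:E)%E.
Proof.
move=> ndW gW q0 gq.
have c01 t := clamp_itv t (@ler01 R).
have W01 t : W 0 <= W (clamp 0 1 t) <= W 1.
  by have /andP[c0 c1] := c01 t; rewrite !ndW.
have ndW' : {homo (W \o clamp 0 1) : s t / s <= t}.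
  move=> s t st /=; have /andP[c0 c1] := c01 s; have /andP[d0 d1] := c01 t.
  by rewrite ndW// clamp_nd.
have i1 := integrable_cst_itv 0 1 (1 : R).
have len s t : 0 <= s -> s <= t -> t <= 1 -> t - s <= \int[mu]_(r in `[s, t]) cst 1 r.
  move=> _ st _; rewrite Rintegral_cst//= mul1r lebesgue_measure_itv/= lte_fin.
  by case: ifPn => //=; rewrite -leNgt subr_le0.
have [tau [itau tau0 Htau]] :=
  @clamp_bound R (fun s t => t - s) 0 1 (cst 1) ler01 i1 len.
have c0 : clamp 0 1 0 = 0 :> R by rewrite clamp_id// lexx ler01.
have c1 : clamp 0 1 1 = 1 :> R by rewrite clamp_id// lexx ler01.
split.
  have [s t|s t st|m [im gm]] := @energy_ac R X (g \o clamp 0 1) (W \o clamp 0 1) tau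
      (W 1 - W 0) itau tau0 ndW'.
  - by have := W01 s; have := W01 t; rewrite /=; lra.
  - rewrite /=; have /andP[s0 s1] := c01 s; have /andP[t0 t1] := c01 t.
    have cst := clamp_nd 0 1 st.
    apply: (le_trans (gW _ _ s0 cst t1)).
    by apply: ler_wpM2r; [rewrite subr_ge0 ndW|exact: Htau].
  - apply: (abs_cont_prim im) => s t s0 st t1.
    have := gm _ _ st; rewrite /= (@clamp_id _ 0 1 s) ?s0 ?(le_trans st)//.
    by rewrite clamp_id// t1 (le_trans s0).
have /= := @energy_bound R X g (W \o clamp 0 1) q ndW'; rewrite c0 c1; apply => //.
move=> t t01 t2; have [h0 h00 Hh] := gq t t01 t2.
exists (Num.min h0 (Num.min t (1 - t))).
  by rewrite !lt_min h00 subr_gt0.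
move=> h; rewrite !lt_min => /andP[hp /andP[hh /andP[ht h1]]].
have l0 : 0 <= t - h by lra.
have l1 : t + h <= 1 by lra.
by rewrite !clamp_id; [apply: Hh; rewrite ?hp|lra|lra].
Qed.

End action_bound.

(** * Existence of the metric speed *)

Section metric_speed.
Context {R : realType}.
Local Notation mu := (@lebesgue_measure R).

Lemma derive1_quotient (F : R -> R) (t e : R) : derivable F t 1 -> 0 < e ->
  exists2 d, 0 < d & forall h, h != 0 -> `|h| < d ->
    `|(F (t + h) - F t) / h - derive1 F t| <= e.
Proof.
move=> dF e0; have := dF; rewrite /derivable => cF.
have := derive1E F t; rewrite /derive => dE.
have : h^-1 *: (F (h *: (1 : R) + t) - F t) @[h --> (0 : R)^'] --> derive1 F t.
  by rewrite dE.
move=> /cvgrPdist_le/(_ _ e0) [d /= d0 Hd]; exists d => // h h0 hd.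
have /= := Hd h; rewrite sub0r normrN => /(_ hd h0).
by rewrite distrC /GRing.scale/= mulr1 (addrC h) mulrC.
Qed.

Lemma prim_ae_eq (p p' : R -> R) (t : R) :
  measurable_fun [set: R] p -> measurable_fun [set: R] p' ->
  {ae mu, forall r, p r = p' r} -> prim p t = prim p' t.
Proof.
move=> mp mp' pp'; rewrite /prim /Rintegral; congr fine.
apply: ae_eq_integral => //.
- by apply/measurable_EFinP; exact: measurable_funTS.
- by apply/measurable_EFinP; exact: measurable_funTS.
- by apply: ae_imp pp' => r -> _.
Qed.

(** The density is the derivative of [f] almost everywhere, where it is bounded by
    [m]; truncating it makes the bound hold everywhere. *)
Lemma ac_density_le (f m : R -> R) : mu.-integrable [set: R] (EFin \o m) ->
  (forall r, 0 <= m r) ->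
  (forall s t, s <= t -> `|f t - f s| <= prim m t - prim m s) ->
  exists p, [/\ mu.-integrable [set: R] (EFin \o p),
    (forall r, `|p r| <= m r) &
    forall s t, s <= t -> f t - f s = prim p t - prim p s].
Proof.
move=> im m0 fm; have [p [ip pf]] := ac_density im m0 fm.
pose p' r := Num.max (- m r) (Num.min (m r) (p r)).
have /measurable_int/measurable_EFinP mp := ip.
have /measurable_int/measurable_EFinP mm := im.
have mp' : measurable_fun [set: R] p'.
  apply: measurable_maxr; last exact: measurable_minr.
  exact: measurableT_comp.
have p'm r : `|p' r| <= m r.
  rewrite ler_norml /p' le_max lexx/= ge_max ge_min lexx andbT.
  by have := m0 r; lra.
exists p'; split => //.
  apply: (le_integrable measurableT) im; first exact/measurable_EFinP.
  by move=> r _; rewrite /= lee_fin (ger0_norm (m0 r)).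
suff E : {ae mu, forall r, p r = p' r}.
  by move=> s t st; rewrite !(@prim_ae_eq p' p)//; [exact: pf| | ];
    apply: ae_imp E.
apply: ae_imp2 (prim_ae ip) (prim_ae im) => r [dp p'E] [dm m'E].
suff : `|p r| <= m r.
  rewrite ler_norml => /andP[p1 p2].
  by rewrite /p' min_r// max_r.
apply/ler_addgt0Pr => e e0.
have e2 : 0 < e / 2 by lra.
have [d1 d10 H1] := derive1_quotient dp e2.
have [d2 d20 H2] := derive1_quotient dm e2.
pose h := Num.min d1 d2 / 2.
have h0 : 0 < h by rewrite divr_gt0// lt_min d10.
have hd : h < Num.min d1 d2 by rewrite /h; have : 0 < Num.min d1 d2; [rewrite lt_min d10|lra].
move: hd; rewrite lt_min => /andP[hd1 hd2].
have rh : r <= r + h by rewrite lerDl ltW.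
have := H1 h; have := H2 h; rewrite gt_eqF// gtr0_norm// hd1 hd2.
move=> /(_ isT isT) + /(_ isT isT); rewrite p'E m'E.
have := fm _ _ rh; rewrite pf//.
set x := prim p _ - _; set y := prim m _ - _ => xy.
have : `|x / h| <= y / h.
  by rewrite normrM normfV (gtr0_norm h0) ler_pM2r ?invr_gt0.
have := ler_normB (x / h) (x / h - p r); rewrite subKr.
rewrite !ler_norml.
by lra.
Qed.
End metric_speed.

Section metric_speed_ae.
Context {R : realType} {X : metricType R}.
Local Notation mu := (@lebesgue_measure R).

Lemma separable_sequence (x0 : X) : separable X -> exists z : nat -> X,
  forall (x : X) (e : R), 0 < e -> exists n, mdist x (z n) < e.
Proof.
move=> [D [/countable_injP[f injf] dD]].
pose z n := xget x0 [set d | D d /\ f d = n].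
have zf d : D d -> z (f d) = d.
  move=> Dd; rewrite /z; case: xgetP => [y _ [Dy fy]|/(_ d)[]//].
  by apply: injf; rewrite ?inE.
exists z => x e e0.
have [|d [Bd Dd]] := dD (interior (ball x e)) _ (open_interior _).
  by exists x; exact: nbhsx_ballx.
exists (f d); rewrite zf//.
by have := interior_subset Bd; rewrite ballEmdist.
Qed.

(** The distances [f n] to the points of a dense sequence are absolutely
    continuous; [v] is the supremum of the absolute values of their derivatives
    [p n].  Since the distance of two points is the supremum of the differences of
    their distances to the sequence, it is bounded by the integral of [v].  This
    gives the upper bound of the difference quotients at the points where [v] is
    the derivative of its primitive, and the [p n] give the lower bound. *)
Lemma metric_speed_ae (g : R -> X) : separable X -> abs_cont 0 1 g ->
  exists v : R -> R, [/\ mu.-integrable [set: R] (EFin \o v),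
    (forall r, 0 <= v r),
    {ae mu, forall t, 0 < t < 1 -> metric_speed g t = v t} &
    forall s t, 0 <= s -> s <= t -> t <= 1 ->
      mdist (g s) (g t) <= prim v t - prim v s].
Proof.
move=> sepX /(abs_cont_clamp ler01) [m [im m0 gm]].
have [z zdense] := separable_sequence (g 0) sepX.
set G := g \o clamp 0 1.
pose f n t := mdist (G t) (z n).
have tri (x y w : X) : `|mdist x w - mdist y w| <= mdist y x.
  rewrite ler_norml; have := metric_triangle x y w; have := metric_triangle y x w.
  by rewrite (metric_sym x y) => ? ?; apply/andP; split; lra.
have fm n s t : s <= t -> `|f n t - f n s| <= prim m t - prim m s.
  by move=> st; apply: le_trans (gm _ _ st); exact: tri.
have /choice[p Hp] n := ac_density_le im m0 (fm n).
have ip n : mu.-integrable [set: R] (EFin \o p n) by case: (Hp n).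
have pm n r : `|p n r| <= m r by case: (Hp n).
have pf n s t : s <= t -> f n t - f n s = prim (p n) t - prim (p n) s.
  by case: (Hp n) => _ _; exact.
pose v r := sups (fun n => `|p n r|) 0.
have hub r : has_ubound (range (fun n => `|p n r|)).
  by exists (m r) => _ [n _ <-].
have pv n r : `|p n r| <= v r.
  apply: ub_le_sup; last by exists n.
  by have [M HM] := hub r; exists M => _ [k _ <-]; apply: HM; exists k.
have vsup r e : 0 < e -> exists n, v r - e < `|p n r|.
  move=> e0; have [|_ [n _ <-] vn] :=
    @sup_adherent R [set `|p n r| | n in [set k | (0 <= k)%N]] e e0.
    split; first by exists `|p 0%N r|, 0%N.
    by have [M HM] := hub r; exists M => _ [k _ <-]; apply: HM; exists k.
  by exists n.
have v0 r : 0 <= v r by exact: le_trans (pv 0%N r).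
have vm r : v r <= m r.
  by apply/ler_addgt0Pr => e e0; have [n] := vsup r e e0; have := pm n r; lra.
have mv : measurable_fun [set: R] v.
  apply: (@measurable_fun_sups _ _ _ _ (fun n r => `|p n r|)) => // n.
  by have /measurable_int/measurable_EFinP mp := ip n; exact: measurableT_comp.
have iv : mu.-integrable [set: R] (EFin \o v).
  apply: (le_integrable measurableT) im; first exact/measurable_EFinP.
  by move=> r _; rewrite /= lee_fin !ger0_norm.
have Gv s t : s <= t -> mdist (G s) (G t) <= prim v t - prim v s.
  move=> st; apply/ler_addgt0Pr => e e0.
  have [|n zn] := zdense (G s) (e / 2); first by lra.
  have pn : f n t - f n s <= prim v t - prim v s.
    by rewrite pf// le_prim// => r; exact: le_trans (ler_norm _) (pv n r).
  have := metric_triangle (G s) (z n) (G t); rewrite (metric_sym (z n)).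
  by move: pn; rewrite /f; lra.
exists v; split => //; last first.
  move=> s t s0 st t1; have := Gv _ _ st.
  by rewrite /G /= !clamp_id// ?s0 ?t1 ?(le_trans st)// (le_trans s0).
have := ae_foralln (fun n => prim_ae (ip n)).
apply: ae_imp2 (prim_ae iv) => t [dv vE] dp /andP[t0 t1].
apply/cvg_lim => //; apply/cvgrPdist_le => e e0.
have e2 : 0 < e / 2 by lra.
have [n vn] := vsup t _ e2.
have [dpn pE] := dp n.
have [d1 d10 H1] := derive1_quotient dv e2.
have [d2 d20 H2] := derive1_quotient dpn e2.
exists (Num.min (Num.min d1 d2) (Num.min t (1 - t))) => /=.
  by rewrite !lt_min d10 d20 t0 subr_gt0.
move=> h /=; rewrite sub0r normrN !lt_min => /andP[/andP[hd1 hd2] /andP[ht h1]] h0.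
have hn : 0 < `|h| by rewrite normr_gt0.
have := H1 _ h0 hd1; have := H2 _ h0 hd2; rewrite vE pE.
have GE r : 0 <= r <= 1 -> g r = G r by move=> r01; rewrite /G/= clamp_id.
rewrite (GE (t + h)); last first.
  by move: ht h1; rewrite !ltr_norml => /andP[? ?] /andP[? ?]; apply/andP; split; lra.
rewrite (GE t) ?(ltW t0) ?(ltW t1)//.
have upp : mdist (G (t + h)) (G t) / `|h| <= `|(prim v (t + h) - prim v t) / h|.
  rewrite normrM normfV ler_pM2r ?invr_gt0//.
  have [th|/ltW th] := leP t (t + h).
    by rewrite metric_sym (le_trans (Gv _ _ th))// ler_norm.
  by rewrite (le_trans (Gv _ _ th))// distrC ler_norm.
have low : `|(prim (p n) (t + h) - prim (p n) t) / h| <= mdist (G (t + h)) (G t) / `|h|.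
  rewrite normrM normfV ler_pM2r ?invr_gt0//.
  have [th|/ltW th] := leP t (t + h).
    by rewrite -pf// metric_sym; exact: tri.
  by rewrite distrC -pf//; exact: tri.
move: upp low; set a := mdist _ _ / _.
set b := (prim v _ - _) / _; set c := (prim (p n) _ - _) / _ => ab ca c1 b1.
have := ler_normB b (b - v t); rewrite subKr (ger0_norm (v0 t)).
have vb : `|b| <= v t + e / 2.
  by have := ler_normD (b - v t) (v t); rewrite subrK (ger0_norm (v0 t)); lra.
have pc : `|p n t| <= `|c| + e / 2.
  by have := ler_normB c (c - p n t); rewrite subKr; lra.
by move=> _; rewrite ler_norml; apply/andP; split; lra.
Qed.

End metric_speed_ae.

Section kinetic.
Context {R : realType} {X : metricType R}.
Local Notation mu := (@lebesgue_measure R).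
Implicit Types g : R -> X.

Lemma speed_square_ge0 g t : (0 <= (metric_speed g t ^+ 2)%:E)%E.
Proof. by rewrite lee_fin sqr_ge0. Qed.

Lemma kinetic_ge0 g : (0 <= kinetic g)%E.
Proof.
rewrite /kinetic; case: ifPn => // _; apply: mule_ge0; first by rewrite lee_fin.
by apply: integral_ge0 => t _; exact: speed_square_ge0.
Qed.

(** [A] is the primitive of the squared speed; the estimate is the Cauchy--Schwarz
    inequality. *)
Lemma kinetic_fin g : separable X -> (kinetic g < +oo)%E ->
  exists A : R -> R, [/\ kinetic g = ((A 1 - A 0) / 2)%:E,
    {homo A : s t / s <= t} &
    forall s t, 0 <= s -> s <= t -> t <= 1 ->
      mdist (g s) (g t) ^+ 2 <= (t - s) * (A t - A s)].
Proof.
move=> sepX; rewrite /kinetic; case: ifPn => // /asboolP acg kfin.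
have [v [iv v0 vE gv]] := metric_speed_ae sepX acg.
have /measurable_int/measurable_EFinP mv := iv.
have mv2 (D : set (measurableTypeR R)) : measurable_fun D (fun t => (v t ^+ 2)%:E).
  by apply/measurable_EFinP; apply: measurable_funX; exact: measurable_funTS.
pose u := (fun t => v t ^+ 2) \_ `[0, 1].
have Iv : (\int[mu]_(t in `]0%R, 1%R[) (v t ^+ 2)%:E =
    \int[mu]_(t in `]0%R, 1%R[) (metric_speed g t ^+ 2)%:E)%E.
  apply/eqP; rewrite eq_le; apply/andP; split.
    apply: lower_integral_ge => //; [|by move=> t _; rewrite lee_fin sqr_ge0|].
      by move=> t _; exact: speed_square_ge0.
    by apply: ae_imp vE => t tE /=; rewrite in_itv/= => /tE ->.
  apply: lower_integral_le => //; [|by move=> t _; rewrite lee_fin sqr_ge0|].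
    by move=> t _; exact: speed_square_ge0.
  by apply: ae_imp vE => t tE /=; rewrite in_itv/= => /tE ->.
have Iv1 : (\int[mu]_(t in `[0%R, 1%R]) (v t ^+ 2)%:E =
    \int[mu]_(t in `]0%R, 1%R[) (metric_speed g t ^+ 2)%:E)%E.
  by rewrite -Iv; apply: (@integral_itv_bndoo R 0 1 _ true false); exact: mv2.
have Ifin : (\int[mu]_(t in `[0%R, 1%R]) (v t ^+ 2)%:E < +oo)%E.
  rewrite Iv1 ltNge leye_eq; apply/negP => /eqP Ioo; move: kfin.
  by rewrite Ioo gt0_muley ?ltxx// lte_fin invr_gt0.
have iu : mu.-integrable [set: R] (EFin \o u).
  rewrite /u -restrict_EFin; apply/(integrable_restrict _ _ _) => //=.
  rewrite setTI; apply/integrableP; split; first exact: mv2.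
  by under eq_integral do rewrite /= ger0_norm ?sqr_ge0//.
have u0 r : 0 <= u r by rewrite /u patchE; case: ifP => //; rewrite sqr_ge0.
have uv r : 0 <= r <= 1 -> u r = v r ^+ 2.
  by move=> r01; rewrite /u patchE mem_set//= in_itv.
exists (prim u); split; last 1 first.
- move=> s t s0 st t1.
  apply: (@le_trans _ _ ((prim v t - prim v s) ^+ 2)).
    rewrite ler_sqr ?nnegrE ?mdist_ge0 ?gv//.
    by rewrite subr_ge0 (prim_nd iv v0).
  move: st; rewrite le_eqVlt => /predU1P[->|st]; first by rewrite !subrr expr0n mul0r.
  pose c := (prim v t - prim v s) / (t - s).
  have ts0 : 0 < t - s by rewrite subr_gt0.
  have iw : mu.-integrable `[s, t] (EFin \o (fun r => 2 * c * v r)).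
    rewrite [X in _.-integrable _ X](_ : _ = fun r => (2 * c)%:E * (v r)%:E)%E.
      by apply: integrableZl => //; exact: integrable_itv.
    by apply/funext => r /=; rewrite EFinM.
  have ic := integrable_cst_itv s t (c ^+ 2).
  (* Integrate 2 c v - c^2 <= v^2, where c is the mean of v. *)
  have : \int[mu]_(r in `[s, t]) (2 * c * v r - c ^+ 2) <= prim u t - prim u s.
    rewrite -prim_itv//; last exact: ltW.
    apply: le_Rintegral => //.
    - rewrite [X in _.-integrable _ X](_ : _ = (EFin \o (fun r => 2 * c * v r)%R) \-
          (EFin \o cst (c ^+ 2)%R))%E; first exact: integrableB.
      by apply/funext => r /=; rewrite EFinB.
    - exact: integrable_itv.
    - move=> r /=; rewrite in_itv/= => /andP[sr rt].
      rewrite uv; last by rewrite (le_trans s0)//= (le_trans rt).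
      by rewrite -subr_ge0 (_ : _ - _ = (v r - c) ^+ 2) ?sqr_ge0//; ring.
  rewrite RintegralB// RintegralZl//; last exact: integrable_itv.
  rewrite prim_itv//; last exact: ltW.
  rewrite Rintegral_cst//= lebesgue_measure_itv/= lte_fin st /= => H.
  apply: (@le_trans _ _ ((t - s) * (2 * c * (prim v t - prim v s) - c ^+ 2 * (t - s)))).
    rewrite le_eqVlt; apply/orP; left; apply/eqP; rewrite /c; field.
    by rewrite gt_eqF.
  by rewrite ler_pM2l.
- have -> : (prim u 1 - prim u 0) / 2 = 2^-1 * (\int[mu]_(r in `[0, 1]) u r).
    by rewrite prim_itv// mulrC.
  rewrite EFinM; congr (_ * _)%E.
  rewrite /Rintegral (_ : (\int[mu]_(x in `[0%R, 1%R]) (u x)%:E =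
      \int[mu]_(t in `[0%R, 1%R]) (v t ^+ 2)%:E)%E); last first.
    by apply: eq_integral => t; rewrite inE /= in_itv/= => t01; rewrite uv.
  by rewrite fineK// ge0_fin_numE// integral_ge0// => t _; rewrite lee_fin sqr_ge0.
- exact: prim_nd.
Qed.

End kinetic.

(** * Lower semicontinuity of the action *)

Section liminf.
Context {R : realType} {X : metricType R}.
Local Notation mu := (@lebesgue_measure R).

(** The inferior limit [W] of the energies [A n] satisfies
    [d(g s, g t)^2 <= (t - s) * (W t - W s)], because the inferior limit is
    superadditive. *)
Lemma kinetic_lsc (g_ : nat -> R -> X) (g : R -> X) (C : R) : separable X ->
  (forall n, kinetic (g_ n) <= C%:E)%E ->
  (forall s t, (0 <= s <= 1)%R -> (0 <= t <= 1)%R ->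
    (mdist (g s) (g t))%:E <=
    limn_einf (fun n => (mdist (g_ n s) (g_ n t))%:E))%E ->
  (kinetic g <= C%:E)%E.
Proof.
move=> sepX gC glsc.
have /choice[A HA] n := kinetic_fin sepX (le_lt_trans (gC n) (ltry C)).
have AC n : A n 1 - A n 0 <= 2 * C.
  by have [kE _ _] := HA n; have := gC n; rewrite kE lee_fin; lra.
have ndA n : {homo A n : s t / s <= t} by case: (HA n).
have gA n s t : 0 <= s -> s <= t -> t <= 1 ->
    mdist (g_ n s) (g_ n t) ^+ 2 <= (t - s) * (A n t - A n s).
  by case: (HA n) => _ _; exact.
pose w t := limn_einf (fun n => (A n t - A n 0)%:E).
have w0 t : 0 <= t -> (0 <= w t)%E.
  by move=> t0; apply: limn_einf_ge; apply: nearW => n; rewrite lee_fin subr_ge0 ndA.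
have w2 t : t <= 1 -> (w t <= (2 * C)%:E)%E.
  move=> t1; rewrite leNgt; apply/negP => /limn_einf_gt/filter_ex[n].
  by rewrite lte_fin; have := AC n; have := ndA n _ _ t1; lra.
pose W t := fine (w t).
have wE t : 0 <= t -> t <= 1 -> w t = (W t)%:E.
  by move=> t0 t1; rewrite /W fineK// ge0_fin_numE ?w0// (le_lt_trans (w2 _ t1))// ltry.
have WA t e : 0 <= t -> t <= 1 -> 0 < e -> \forall n \near \oo, W t - e < A n t - A n 0.
  move=> t0 t1 e0; have : ((W t - e)%:E < w t)%E.
    by rewrite wE// lte_fin; lra.
  by move=> /limn_einf_gt; apply: filterS => n; rewrite lte_fin.
have key s t : 0 <= s -> s <= t -> t <= 1 ->
    W s <= W t /\ mdist (g s) (g t) ^+ 2 <= (t - s) * (W t - W s).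
  move=> s0 st t1; have s1 := le_trans st t1; have t0 := le_trans s0 st.
  have mono : W s <= W t.
    apply/ler_addgt0Pr => e e0; rewrite -lerBlDr -lee_fin -wE//.
    apply: limn_einf_ge; have := WA s e s0 s1 e0; apply: filterS => n.
    by rewrite lee_fin; have := ndA n _ _ st; lra.
  split => //; have [->|tsN] := eqVneq t s.
    by rewrite mdistxx expr0n /= !subrr mul0r.
  set d := mdist (g s) (g t).
  have d0 : 0 <= d by exact: mdist_ge0.
  move: d0; rewrite le_eqVlt => /predU1P[<-|d0].
    by rewrite expr0n/= mulr_ge0 ?subr_ge0.
  apply/ler_addgt0Pr => e' e'0.
  (* Strictly smaller distances are eventually exceeded; the error made in the
     square of the distance is at most 2 d e. *)
  pose e := Num.min d (e' / (1 + 2 * d)).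
  have e0 : 0 < e by rewrite lt_min d0 divr_gt0//; lra.
  have ed : e <= d by rewrite /e ge_min lexx.
  have ee' : e * (1 + 2 * d) <= e'.
    by rewrite -ler_pdivlMr; [rewrite /e ge_min lexx orbT|lra].
  have de : ((d - e)%:E < limn_einf (fun n => (mdist (g_ n s) (g_ n t))%:E))%E.
    apply: lt_le_trans (glsc s t _ _); rewrite ?s0 ?t0 ?s1 ?t1// lte_fin.
    by rewrite -/d; lra.
  have : (d - e) ^+ 2 <= (t - s) * (W t - W s + e).
    have ts0 : 0 < t - s by rewrite subr_gt0 lt_neqAle eq_sym tsN.
    rewrite mulrC -ler_pdivrMr// -lerBlDr lerBrDr.
    rewrite -lee_fin -wE//; apply: limn_einf_ge.
    have := limn_einf_gt de; have := WA s e s0 s1 e0.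
    apply: filterS2 => n h1; rewrite lte_fin => h2; rewrite lee_fin.
    have := gA n _ _ s0 st t1.
    have : (d - e) ^+ 2 <= mdist (g_ n s) (g_ n t) ^+ 2.
      by rewrite ler_sqr ?nnegrE ?mdist_ge0 ?subr_ge0// ltW.
    move=> h3 h4; have := le_trans h3 h4.
    rewrite mulrC -ler_pdivrMr//; lra.
  have : (t - s) * e <= e by rewrite ler_piMl ?(ltW e0)//; lra.
  have : 0 <= e ^+ 2 by exact: sqr_ge0.
  by move: ee'; rewrite expr2 mulrDr; nra.
have [||||acg] := @action_bound R X g W (cst 0%E).
- by move=> s t s0 st t1; have [] := key s t s0 st t1.
- by move=> s t s0 st t1; have [] := key s t s0 st t1.
- by [].
- move=> t t01 _; exists 1 => // h /andP[h0 _] t0 t1.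
  rewrite mule0 adde0 lee_fin.
  have [||_] := key t (t + h) _ _ t1; [by lra|by lra|].
  have [||_] := key (t - h) t t0; [by lra|by lra|].
  rewrite (metric_sym (g (t + h))).
  by rewrite (_ : t + h - t = h); [rewrite (_ : t - (t - h) = h); [lra|ring]|ring].
under eq_integral do rewrite adde0.
move=> Ig; rewrite /kinetic; case: ifPn => [_|/asboolP//].
apply: (@le_trans _ _ (2^-1%:E * (W 1 - W 0)%:E)%E).
  by apply: lee_wpmul2l => //; rewrite lee_fin.
rewrite -EFinM lee_fin.
have := w0 0 (lexx 0); rewrite wE// lee_fin.
have := w2 1 (lexx 1); rewrite wE// lee_fin.
lra.
Qed.

End liminf.

(** * Gradient flows: the integrated variational inequality *)

Section evi.
Context {R : realType} {X : metricType R} (E : X -> \bar R).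
Local Notation mu := (@lebesgue_measure R).

(** The integral of [expR (K * r)] for [r] between 0 and [h]. *)
Definition evi_gain (K h : R) : R := (expR (K * h) - 1) / K.

(** The variational inequality of parameter [- K], integrated from [s] to [t] with
    the energy estimated by its final, smallest value.  Unlike the differential
    form it is obviously invariant under translations in time. *)
Definition evi_curve (K : R) (g : R -> X) : Prop :=
  (forall t, (0 < t)%R -> E (g t) < +oo)%E /\
  forall s t z, 0 < s -> s <= t -> (E z < +oo)%E ->
    mdist (g t) z ^+ 2 / 2 <= expR (K * (t - s)) * (mdist (g s) z ^+ 2 / 2) +
      evi_gain K (t - s) * (fine (E z) - fine (E (g t))).

Lemma ae_exists (P : R -> Prop) a b : a < b -> {ae mu, forall t, P t} ->
  exists2 t, a < t < b & P t.
Proof.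
move=> ab [N [mN N0 PN]]; apply: contrapT => nP.
have : (mu `]a, b[%classic <= mu N)%E.
  apply: le_measure; rewrite ?inE// => t /=; rewrite in_itv/= => tab.
  by apply: PN => Pt; apply: nP; exists t.
by rewrite N0 lebesgue_measure_itv/= lte_fin ab -EFinB lee_fin subr_le0 leNgt ab.
Qed.

Lemma expR_lipschitz (K s t : R) : 0 <= K -> 0 <= s -> s <= t ->
  `|expR (- (K * t)) - expR (- (K * s))| <= K * (t - s).
Proof.
move=> K0 s0 st.
have nd : - (K * t) <= - (K * s) by rewrite lerN2 ler_wpM2l.
rewrite ler0_norm ?subr_le0 ?ler_expR// opprB.
have -> : - (K * t) = - (K * s) + - (K * (t - s)) by ring.
rewrite expRD -[X in X - _]mulr1 -mulrBr.
have h1 : 1 - expR (- (K * (t - s))) <= K * (t - s).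
  by have := expR_ge1Dx (- (K * (t - s))); lra.
have h0 : 0 <= K * (t - s) by rewrite mulr_ge0// subr_ge0.
have h2 : expR (- (K * s)) <= 1 by rewrite -expR0 ler_expR oppr_le0 mulr_ge0.
apply: (@le_trans _ _ (1 * (1 - expR (- (K * (t - s)))))); last by rewrite mul1r.
apply: ler_wpM2r => //; rewrite subr_ge0 -expR0 ler_expR oppr_le0.
exact: h0.
Qed.

Hypothesis Ereal : forall z : X, E z != -oo%E.

Lemma energyE z : (E z < +oo)%E -> E z = (fine (E z))%:E.
Proof. by move=> Ez; rewrite fineK// fin_numE Ereal lt_eqF. Qed.

Section flow.
Variables (K lambda : R) (x : X) (g : R -> X).
Hypotheses (K0 : 0 < K) (Kl : - K <= lambda) (flow : EVI_flow E lambda x g).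

Lemma flow_continuous t : 0 < t -> {for t, continuous g}.
Proof.
move=> t0; case: flow => acg _ _.
have ab : t / 2 < t + 1 by lra.
have ab0 : 0 < t / 2 by lra.
have [m [im m0 gm]] := abs_cont_clamp (ltW ab) (acg _ _ ab0 ab).
have cg : continuous (g \o clamp (t / 2) (t + 1)) := continuous_prim im gm.
have := cg t; rewrite /continuous_at /= clamp_id; last by apply/andP; split; lra.
apply: cvg_trans; apply: near_eq_cvg.
have t2 : 0 < t / 2 by lra.
exists (Num.min (t / 2) 1) => /=; first by rewrite lt_min t2 ltr01.
move=> r /=; rewrite lt_min !ltr_norml => /andP[/andP[? ?] /andP[? ?]].
by rewrite /= clamp_id//; apply/andP; split; lra.
Qed.

(** The function [expR (- (K * (t - a))) * (mdist (g t) z ^+ 2 / 2 + c / K)] is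
    absolutely continuous and the variational inequality says that its derivative
    is nonpositive. *)
Lemma evi_compare a b c z : 0 < a -> a < b -> (E z < +oo)%E ->
  {ae mu, forall t, a < t < b -> (E z <= E (g t) + c%:E)%E} ->
  expR (- (K * (b - a))) * (mdist (g b) z ^+ 2 / 2) <=
    mdist (g a) z ^+ 2 / 2 + c * ((1 - expR (- (K * (b - a)))) / K).
Proof.
move=> a0 ab Ez Ec; case: flow => acg _ /(_ z) evi.
have [m [im m0 gm]] := abs_cont_clamp (ltW ab) (acg _ _ a0 ab).
have gm' s t : a <= s -> s <= t -> t <= b -> mdist (g s) (g t) <= prim m t - prim m s.
  move=> as_ st tb; have := gm _ _ st.
  by rewrite !clamp_id// ?as_ ?tb ?(le_trans st)// (le_trans as_).
pose f t := mdist (g t) z ^+ 2.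
pose ex t := expR (- (K * (t - a))).
pose D := mdist (g a) z + (prim m b - prim m a).
have ndm := prim_nd im m0.
have D0 : 0 <= D by rewrite addr_ge0 ?mdist_ge0// subr_ge0 ndm// ltW.
have gD t : a <= t -> t <= b -> mdist (g t) z <= D.
  move=> at_ tb; have := metric_triangle (g t) (g a) z.
  rewrite (metric_sym (g t) (g a)); have := gm' _ _ (lexx a) at_ tb.
  by have := ndm _ _ tb; rewrite /D; lra.
have f0 t : 0 <= f t by exact: sqr_ge0.
have fD t : a <= t -> t <= b -> f t <= D ^+ 2.
  by move=> at_ tb; rewrite ler_sqr ?nnegrE ?mdist_ge0 ?gD.
have fm s t : a <= s -> s <= t -> t <= b ->
    `|f t - f s| <= 2 * D * (prim m t - prim m s).
  move=> as_ st tb; have sb := le_trans st tb; have at_ := le_trans as_ st.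
  rewrite /f subr_sqr normrM mulrC.
  have h1 : `|mdist (g t) z + mdist (g s) z| <= 2 * D.
    rewrite ger0_norm ?addr_ge0 ?mdist_ge0//.
    by have := gD _ as_ sb; have := gD _ at_ tb; lra.
  have h2 : `|mdist (g t) z - mdist (g s) z| <= prim m t - prim m s.
    apply: le_trans (gm' _ _ as_ st tb); rewrite ler_norml.
    have := metric_triangle (g t) (g s) z; have := metric_triangle (g s) (g t) z.
    by rewrite (metric_sym (g t) (g s)); lra.
  by apply: ler_pM.
pose F t := ex t * (2^-1 * f t + c / K).
have exa : ex a = 1 by rewrite /ex subrr mulr0 oppr0 expR0.
suff : F b <= F a.
  rewrite /F exa mul1r -[expR _]/(ex b) -/(f b) -/(f a) => H.
  have -> : c * ((1 - ex b) / K) = c / K - ex b * (c / K) by ring.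
  by lra.
pose k := K * D ^+ 2 / 2 + `|c|.
have k0 : 0 <= k by rewrite addr_ge0// divr_ge0// mulr_ge0 ?sqr_ge0// ltW.
have ik := integrable_cst_itv a b k.
have iDm : mu.-integrable `[a, b] (EFin \o (fun r => D * m r)).
  rewrite [X in _.-integrable _ X](_ : _ = fun r => D%:E * (m r)%:E)%E.
    by apply: integrableZl => //; exact: integrable_itv.
  by apply/funext => r /=; rewrite EFinM.
apply: (@ac_derivative_le0 R F a b (fun r => D * m r + k)) => //.
- rewrite [X in _.-integrable _ X](_ : _ = (EFin \o (fun r => D * m r)%R) \+
      (EFin \o cst k))%E; first exact: integrableD.
  by apply/funext => r /=; rewrite EFinD.
- move=> s t as_ st tb; have at_ := le_trans as_ st; have sb := le_trans st tb.
  have sub : `[s, t]%classic `<=` `[a, b]%classic.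
    by apply: subset_itv; rewrite bnd_simp.
  rewrite RintegralD//; [|by apply: integrableS iDm|by apply: integrableS ik].
  rewrite RintegralZl//; last exact: integrable_itv.
  have leb : fine (mu `[s, t]) = t - s.
    rewrite lebesgue_measure_itv/= lte_fin; case: ltgtP st => //= -> _.
    by rewrite subrr.
  rewrite prim_itv// Rintegral_cst//= leb.
  have lip : `|ex t - ex s| <= K * (t - s).
    have -> : t - s = (t - a) - (s - a) by ring.
    by apply: expR_lipschitz; [exact: ltW|lra|lra].
  have ex1 r : a <= r -> 0 <= ex r <= 1.
    move=> ar; rewrite expR_ge0/= -expR0 ler_expR oppr_le0 mulr_ge0 ?subr_ge0//.
    exact: ltW.
  have -> : F t - F s = ex t * ((f t - f s) / 2) + (ex t - ex s) * (f s / 2 + c / K).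
    by rewrite /F; ring.
  rewrite (le_trans (ler_normD _ _))// lerD//.
    rewrite normrM ger0_norm; last by have /andP[] := ex1 _ at_.
    rewrite normrM (ger0_norm (_ : 0 <= 2^-1)) ?invr_ge0//.
    have /andP[e0 e1] := ex1 _ at_; have := fm _ _ as_ st tb => fmst.
    apply: (@le_trans _ _ (1 * (`|f t - f s| / 2))).
      by apply: ler_wpM2r => //; rewrite divr_ge0.
    by lra.
  rewrite normrM.
  apply: (@le_trans _ _ ((K * (t - s)) * (D ^+ 2 / 2 + `|c| / K))).
    apply: ler_pM => //; rewrite (le_trans (ler_normD _ _))// lerD//.
      rewrite ger0_norm ?divr_ge0//; have := fD _ as_ sb; lra.
    by rewrite normrM normfV (gtr0_norm K0).
  rewrite le_eqVlt; apply/orP; left; apply/eqP; rewrite /k; field.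
  by rewrite gt_eqF.
apply: ae_imp2 evi Ec => t evi Ec /andP[at_ tb].
have [|df Et] := evi _; first exact: lt_trans at_.
have {}Ec : (E z <= E (g t) + c%:E)%E by apply: Ec; rewrite at_.
have [p pE] : exists p, derive1 f t = p by eexists.
have Ep : 2^-1 * p <= K / 2 * f t + c.
  have Egt : (E (g t) < +oo)%E.
    rewrite ltNge leye_eq; apply/negP => /eqP Eoo.
    by move: Et; rewrite Eoo addey// leye_eq => /eqP Ezoo; rewrite Ezoo in Ez.
  move: Et; rewrite -[derive1 _ _]/(derive1 f t) pE -/(f t).
  move: Ec; rewrite (energyE Ez) (energyE Egt) -!EFinD !lee_fin => Ec Et.
  have : - K / 2 * f t <= lambda / 2 * f t.
    by apply: ler_wpM2r; rewrite ?f0// ler_pM2r ?invr_gt0.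
  by move: Ec Et; lra.
have dl : is_derive t 1 (fun r : R => - (K * (r - a))) (- K).
  rewrite [X in is_derive _ _ X _](_ : _ = - (K *: (id - cst a))); last by apply/funext.
  by apply: is_derive_eq; rewrite subr0 /GRing.scale/= mulr1.
have dex : is_derive t 1 ex (ex t * - K).
  exact: (@is_derive1_comp R expR (fun r : R => - (K * (r - a))) t).
have dff : is_derive t 1 f p.
  by apply: DeriveDef => //; rewrite -pE derive1E.
have dG : is_derive t 1 (fun r => 2^-1 * f r + c / K) (2^-1 * p).
  rewrite [X in is_derive _ _ X _](_ : _ = (2^-1 *: f) + cst (c / K)); last by apply/funext.
  by apply: is_derive_eq; rewrite addr0.
have dF : is_derive t 1 F (ex t * (2^-1 * p) + (2^-1 * f t + c / K) * (ex t * - K)).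
  exact: is_deriveM.
split; first exact: ex_derive.
rewrite derive1E derive_val.
have -> : ex t * (2^-1 * p) + (2^-1 * f t + c / K) * (ex t * - K) =
   ex t * (2^-1 * p - (K / 2 * f t + c)) by field; rewrite gt_eqF.
by rewrite mulr_ge0_le0 ?expR_ge0// subr_le0.
Qed.

End flow.
End evi.

Section flow_evi.
Context {R : realType} {X : metricType R} (E : X -> \bar R).
Local Notation mu := (@lebesgue_measure R).
Hypothesis Ereal : forall z : X, E z != -oo%E.
Hypothesis Elsc : lower_semicontinuous E.
Variables (K lambda : R) (x : X) (g : R -> X).
Hypotheses (K0 : 0 < K) (Kl : - K <= lambda) (flow : EVI_flow E lambda x g).

Lemma evi_gainE (h : R) : evi_gain K h = expR (K * h) * ((1 - expR (- (K * h))) / K).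
Proof.
rewrite /evi_gain mulrA mulrBr mulr1 -expRD addrN expR0.
by [].
Qed.

(** Otherwise let [r0] be the last time before [t] with energy at most [E (g s)];
    it exists by lower semicontinuity.  As the energy is larger after [r0], testing
    with [g r0] shows that the distance to [g r0] does not increase from 0, so
    [g t = g r0]. *)
Lemma flow_energy_nonincreasing s t : 0 < s -> s <= t -> (E (g t) <= E (g s))%E.
Proof.
move=> s0; rewrite le_eqVlt => /predU1P[->//|st].
rewrite leNgt; apply/negP => Est.
have Es : (E (g s) < +oo)%E by rewrite (lt_le_trans Est)// leey.
pose S := [set r | s <= r <= t /\ (E (g r) <= E (g s))%E].
have Ss : S s by split; rewrite ?lexx// ltW.
have hS : has_sup S by split; [exists s|exists t => r [/andP[]]].
pose r0 := sup S.
have sr0 : s <= r0 by apply: ub_le_sup => //; exists t => r [/andP[]].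
have r0t : r0 <= t by apply: ge_sup; [exists s|move=> r [/andP[]]].
have Er0 : (E (g r0) <= E (g s))%E.
  rewrite leNgt (energyE Ereal Es); apply/negP => /Elsc[V Vr0 EV].
  have cg := flow_continuous flow (lt_le_trans s0 sr0).
  have [d /= d0 dV] := cg _ Vr0.
  have [r Sr rd] := sup_adherent d0 hS.
  have rr0 : r <= r0 by apply: ub_le_sup => //; exists t => ? [/andP[]].
  have : (E (g s) < E (g r))%E.
    rewrite (energyE Ereal Es); apply/EV/dV; rewrite /ball/= ger0_norm ?subr_ge0//.
    by move: rd; rewrite -/r0; lra.
  by case: Sr => _; rewrite leNgt => /negP.
have r0lt : r0 < t.
  rewrite lt_neqAle r0t andbT; apply/negP => /eqP r0E.
  by move: Est; rewrite -r0E ltNge Er0.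
have r00 : 0 < r0 by exact: lt_le_trans sr0.
have Er0' : (E (g r0) < +oo)%E by exact: le_lt_trans Es.
have ae0 : {ae mu, forall r, r0 < r < t -> (E (g r0) <= E (g r) + 0%:E)%E}.
  apply/aeW => r /andP[r0r rt]; rewrite adde0.
  apply: (le_trans Er0); rewrite leNgt; apply/negP => Er.
  have Sr : S r by split; [rewrite (le_trans sr0 (ltW r0r)) ltW|exact: ltW].
  have : r <= r0 by apply: ub_le_sup => //; exists t => ? [/andP[]].
  by rewrite leNgt r0r.
have := evi_compare Ereal K0 Kl flow r00 r0lt Er0' ae0.
rewrite mdistxx mul0r addr0 expr0n mul0r.
rewrite pmulr_rle0 ?expR_gt0// pmulr_lle0 ?invr_gt0// => d0.
have d00 : mdist (g t) (g r0) = 0.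
  by apply/eqP; rewrite -[_ == _](@sqrf_eq0 R) eq_le d0 sqr_ge0.
by move: Est; rewrite (mdist_positivity _ _ d00) ltNge Er0.
Qed.

Lemma flow_evi_curve z0 : (E z0 < +oo)%E -> evi_curve E K g.
Proof.
move=> Ez0.
have Efin t : 0 < t -> (E (g t) < +oo)%E.
  move=> t0; case: (flow) => _ _ /(_ z0)/(ae_exists t0)[s /andP[s0 st]] /(_ s0)[_ Es].
  apply: le_lt_trans (flow_energy_nonincreasing s0 (ltW st)) _.
  rewrite ltNge leye_eq; apply/negP => /eqP Eoo.
  by move: Es; rewrite Eoo addey// leye_eq => /eqP Ezoo; rewrite Ezoo in Ez0.
split => // s t z s0; rewrite le_eqVlt => /predU1P[->|st] Ez.
  by rewrite /evi_gain subrr mulr0 expR0 subrr mul0r mul1r mul0r addr0.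
have Et := Efin _ (lt_trans s0 st).
have aec : {ae mu, forall r, s < r < t ->
    (E z <= E (g r) + (fine (E z) - fine (E (g t)))%R%:E)%E}.
  apply/aeW => r /andP[sr rt]; have r0 := lt_trans s0 sr.
  have := flow_energy_nonincreasing r0 (ltW rt).
  rewrite (energyE Ereal Ez) (energyE Ereal Et) (energyE Ereal (Efin _ r0)) /=.
  by rewrite -EFinD !lee_fin; lra.
have := evi_compare Ereal K0 Kl flow s0 st Ez aec.
rewrite expRN mulrC ler_pdivrMr ?expR_gt0// => H; apply: (le_trans H).
rewrite evi_gainE expRN le_eqVlt; apply/orP; left; apply/eqP.
ring.
Qed.

End flow_evi.

(** * Contraction of the flow *)

Section evi_curves.
Context {R : realType} {X : metricType R} (E : X -> \bar R).
Variable K : R.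
Hypothesis K0 : 0 < K.
Implicit Types (g k : R -> X) (h s t : R).
Local Notation e z := (fine (E z)).
Local Notation gain := (evi_gain K).

Lemma evi_gain_ge h : h <= gain h.
Proof.
rewrite /evi_gain ler_pdivlMr// mulrC.
by have := expR_ge1Dx (K * h); lra.
Qed.

Lemma evi_gain_le h : gain h <= h * expR (K * h).
Proof.
rewrite evi_gainE mulrC ler_pM2r ?expR_gt0// ler_pdivrMr//.
by have := expR_ge1Dx (- (K * h)); lra.
Qed.

Lemma expR1D h : expR (K * h) = 1 + K * gain h.
Proof. by rewrite /evi_gain mulrCA divff ?gt_eqF// mulr1; ring. Qed.

Lemma evi_nonincreasing g s t : evi_curve E K g -> 0 < s -> s <= t ->
  e (g t) <= e (g s).
Proof.
move=> [gfin gevi] s0; rewrite le_eqVlt => /predU1P[->//|st].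
have := gevi s t (g s) s0 (ltW st) (gfin _ s0).
rewrite mdistxx expr0n mul0r mulr0 add0r => H.
have H2 := le_trans (divr_ge0 (sqr_ge0 _) (ler0n _ _)) H.
have G0 : 0 < gain (t - s) by rewrite (lt_le_trans _ (evi_gain_ge _))// subr_gt0.
by move: H2; rewrite pmulr_rge0// subr_ge0.
Qed.

Lemma evi_shift g h : 0 <= h -> evi_curve E K g -> evi_curve E K (fun t => g (t + h)).
Proof.
move=> h0 [gfin gevi]; split=> [t t0|s t z s0 st Ez].
  by apply: gfin; rewrite ltr_wpDr.
have := gevi (s + h) (t + h) z; rewrite lerD2r (ltr_wpDr h0 s0).
have -> : t + h - (s + h) = t - s by ring.
exact.
Qed.

(** Over a short step test the inequality of [g] with the old position of [k], and
    then that of [k] with the new position of [g]: the energies cancel up to a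
    telescoping term and a term of second order in the step. *)
Lemma evi_contraction g k a b : evi_curve E K g -> evi_curve E K k ->
  0 < a -> a <= b ->
  mdist (g b) (k b) <= expR (K * (b - a)) * mdist (g a) (k a).
Proof.
move=> evg evk a0 ab; case: (evg) (evk) => [gfin gevi] [kfin kevi].
set T := b - a; have T0 : 0 <= T by rewrite subr_ge0.
set L := expR (K * T).
have L1 : 1 <= L by rewrite -expR0 ler_expR mulr_ge0// ltW.
pose M := Num.max 0 (e (k a) - e (g b)).
have M0 : 0 <= M by rewrite le_max lexx.
(* L^2 (T / N) B bounds the error accumulated over N steps. *)
pose B := L * (e (k a) - e (k b)) + T * K * L ^+ 2 * M.
have B0 : 0 <= B.
  have L0 : 0 <= L by exact: expR_ge0.
  have K0' := ltW K0.
  apply: addr_ge0; last by do ?apply: mulr_ge0.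
  by apply: mulr_ge0 => //; rewrite subr_ge0 evi_nonincreasing.
pose D t := mdist (g t) (k t) ^+ 2 / 2.
have D0 t : 0 <= D t by rewrite divr_ge0// sqr_ge0.
suff main N : (0 < N)%N -> D b <= L ^+ 2 * (D a + T / N%:R * B).
  have DL : D b <= L ^+ 2 * D a.
    apply/ler_addgt0Pr => eps eps0.
    pose y := L ^+ 2 * (T * B) / eps.
    have y0 : 0 <= y.
      apply: divr_ge0 (ltW eps0); apply: mulr_ge0; first exact: sqr_ge0.
      exact: mulr_ge0.
    have := main (Num.bound y) isT; move=> H; apply: (le_trans H).
    rewrite mulrDr lerD2l.
    rewrite [X in X <= _](_ : _ = L ^+ 2 * (T * B) / (Num.bound y)%:R); last by ring.
    have yb : y < (Num.bound y)%:R by exact: archi_boundP.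
    rewrite ler_pdivrMr ?ltr0n//.
    by have := ltW yb; rewrite {1}/y ler_pdivrMr// (mulrC _ eps).
  rewrite -ler_sqr ?nnegrE ?mulr_ge0 ?expR_ge0 ?mdist_ge0//.
  by move: DL; rewrite /D -/L exprMn; lra.
move=> N0.
set h := T / N%:R; have h0 : 0 <= h by rewrite divr_ge0.
have hN : N%:R * h = T by rewrite /h mulrC divfK// pnatr_eq0 -lt0n.
pose t i := a + i%:R * h.
have t0 i : 0 < t i by rewrite ltr_wpDr// mulr_ge0.
have tN : t N = b by rewrite /t hN /T; ring.
have tnd i j : (i <= j)%N -> t i <= t j.
  by move=> ij; rewrite lerD2l ler_wpM2r// ler_nat.
have hT : h <= T by rewrite -hN ler_peMl// ler1n.
have CL : gain h <= h * L.
  apply: (le_trans (evi_gain_le _)); rewrite ler_wpM2l// ler_expR ler_wpM2l// ltW//.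
have C0 : 0 <= gain h by exact: le_trans (evi_gain_ge _).
have step i : (i < N)%N -> D (t i.+1) <= expR (K * h) ^+ 2 * D (t i) +
    (h * L * (e (k (t i)) - e (k (t i.+1))) + K * h ^+ 2 * L ^+ 2 * M).
  move=> iN.
  have dt : t i.+1 - t i = h by rewrite /t -natr1; ring.
  have s1 := gevi (t i) (t i.+1) (k (t i)) (t0 i) (tnd _ _ (leqnSn _)) (kfin _ (t0 _)).
  have s2 := kevi (t i) (t i.+1) (g (t i.+1)) (t0 i) (tnd _ _ (leqnSn _)) (gfin _ (t0 _)).
  rewrite dt in s1 s2.
  have kk : e (k (t i.+1)) <= e (k (t i)) by exact: evi_nonincreasing (tnd _ _ (leqnSn _)).
  have kM : e (k (t i)) - e (g (t i.+1)) <= M.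
    rewrite /M le_max; apply/orP; right; apply: lerB.
      by apply: evi_nonincreasing => //; rewrite -[X in X <= _]addr0 lerD2l mulr_ge0.
    by apply: evi_nonincreasing => //; rewrite -tN; exact: tnd.
  rewrite (metric_sym (k (t i))) in s2.
  rewrite [D (t i.+1)]/D (metric_sym (g _) (k (t i.+1))).
  apply: (le_trans s2).
  apply: (@le_trans _ _ (expR (K * h) * (expR (K * h) * D (t i) +
    gain h * (e (k (t i)) - e (g (t i.+1)))) + gain h * (e (g (t i.+1)) - e (k (t i.+1))))).
    by rewrite lerD2r ler_pM2l ?expR_gt0.
  rewrite mulrDr mulrA -expr2 -addrA lerD2l.
  rewrite expR1D.
  have E1 : (1 + K * gain h) * (gain h * (e (k (t i)) - e (g (t i.+1)))) +
     gain h * (e (g (t i.+1)) - e (k (t i.+1))) =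
     gain h * (e (k (t i)) - e (k (t i.+1))) +
     K * gain h ^+ 2 * (e (k (t i)) - e (g (t i.+1))) by ring.
  rewrite E1; apply: lerD; first by rewrite ler_wpM2r// subr_ge0.
  apply: (@le_trans _ _ (K * gain h ^+ 2 * M)).
    by rewrite ler_wpM2l// mulr_ge0 ?sqr_ge0// ltW.
  rewrite ler_wpM2r// -mulrA ler_wpM2l ?(ltW K0)// -exprMn.
  by rewrite ler_sqr ?nnegrE// mulr_ge0//; lra.
have ind i : (i <= N)%N -> D (t i) <= expR (K * (i%:R * h)) ^+ 2 * (D a +
    h * L * (e (k a) - e (k (t i))) + i%:R * (K * h ^+ 2 * L ^+ 2 * M)).
  elim: i => [_|i IH iN].
    have ta : t 0%N = a by rewrite /t mul0r addr0.
    by rewrite ta mul0r mulr0 expR0 expr1n mul1r subrr mulr0 mul0r !addr0.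
  have {}IH := IH (ltnW iN).
  apply: (le_trans (step _ iN)).
  set P := D a + _ + _ in IH *.
  set Z := h * L * _ + _.
  have kk : e (k (t i.+1)) <= e (k (t i)) by exact: evi_nonincreasing (tnd _ _ (leqnSn _)).
  have Z0 : 0 <= Z.
    have L0 : 0 <= L by exact: expR_ge0.
    have K0' := ltW K0.
    apply: addr_ge0; last by do ?apply: mulr_ge0.
    by apply: mulr_ge0; [exact: mulr_ge0|rewrite subr_ge0].
  have -> : expR (K * (i.+1%:R * h)) = expR (K * h) * expR (K * (i%:R * h)).
    by rewrite -expRD -natr1; congr expR; ring.
  rewrite [X in _ <= _ * X](_ : _ = P + Z); last by rewrite /P /Z -natr1; ring.
  have gen (x y p d z : R) : 1 <= x -> 1 <= y -> 0 <= z -> d <= y * p ->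
      x * d + z <= x * y * (p + z).
    move=> x1 y1 z0 dyp; have x0 := le_trans ler01 x1.
    rewrite mulrDr; apply: lerD; first by rewrite -mulrA ler_wpM2l.
    by rewrite ler_peMl// -(mulr1 1) ler_pM.
  rewrite exprMn; apply: gen => //.
    by rewrite -(expr1n _ 2) ler_sqr ?nnegrE ?expR_ge0// -expR0 ler_expR mulr_ge0// ltW.
  have K0' := ltW K0.
  rewrite -(expr1n _ 2) ler_sqr ?nnegrE ?expR_ge0// -expR0 ler_expR.
  by do ?apply: mulr_ge0.
have := ind N (leqnn N); rewrite tN hN -/L => H; apply: (le_trans H).
rewrite ler_wpM2l ?sqr_ge0// -addrA lerD2l /B le_eqVlt; apply/orP; left; apply/eqP.
by rewrite -[in RHS]hN; ring.
Qed.

End evi_curves.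

(** * Dissipation of energy and slope *)

Section slope.
Context {R : realType} {X : metricType R} (E : X -> \bar R).
Hypothesis Ereal : forall z : X, E z != -oo%E.
Local Notation e z := (fine (E z)).

Lemma slope_ge0 x : (0 <= slope E x)%E.
Proof.
rewrite /slope; case: ifPn => // Ex; case: ifPn => // /asboolP nis.
have d1 z : (0 <= ((mdist x z)^-1)%:E)%E by rewrite lee_fin invr_ge0 mdist_ge0.
apply: limf_esup_ge0 => [x0|z]; last first.
  by apply: mule_ge0; rewrite ?d1// le_max lexx orbT.
apply: nis; split; first by rewrite in_setT.
exists [set x]; last by rewrite setIT.
have : nbhs x [set z | z != x -> set0 z] := x0.
by apply: filterS => z /= zx; apply: contrapT => /eqP /zx.
Qed.

(** In the superior limit defining the slope, a quotient above a nonnegative number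
    forces the energy to be finite at the competitor. *)
Lemma slope_gt x sigma rho : (E x < +oo)%E -> 0 <= sigma ->
  (sigma%:E < slope E x)%E -> 0 < rho ->
  exists z, [/\ 0 < mdist x z, mdist x z < rho, (E z < +oo)%E &
    sigma * mdist x z < e x - e z].
Proof.
move=> Ex s0 + rho0; rewrite /slope ifF; last first.
  by apply/negbTE/asboolP => /(_ Ex).
case: ifPn => [_|_ sx]; first by rewrite lte_fin ltNge s0.
have : (sigma%:E < ereal_sup [set maxe (E x - E z) 0 * ((mdist x z)^-1)%:E |
     z in [set z | z != x /\ (mdist x z < rho)%R]])%E.
  apply: lt_le_trans sx _; rewrite limf_esupE; apply: ereal_inf_lbound.
  exists [set z | z != x /\ mdist x z < rho] => //.
  rewrite /dnbhs /within/=.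
  have := nbhsx_ballx x rho rho0; apply: filterS => z.
  by rewrite ballEmdist /= => ? ?; split.
move=> /ereal_sup_gt[_ [z [zx zrho] <-] sz].
have d0 : 0 < mdist x z by rewrite mdist_gt0 eq_sym.
have Ez : (E z < +oo)%E.
  rewrite ltNge leye_eq; apply/negP => /eqP Ezoo; move: sz.
  rewrite Ezoo (energyE Ereal Ex) addeNy// maxNye mul0e lte_fin ltNge s0.
  by [].
exists z; split => //; move: sz.
rewrite (energyE Ereal Ex) (energyE Ereal Ez) -EFinB -EFin_max -EFinM lte_fin.
rewrite ltr_pdivlMr// => H; move: H; rewrite lt_max => /orP[//|].
by rewrite ltNge mulr_ge0// ltW.
Qed.

Variable K : R.
Hypothesis K0 : 0 < K.

Lemma expR_le_1D2 (y : R) : 0 <= y -> y <= 2^-1 -> expR y <= 1 + 2 * y.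
Proof.
move=> y0 y2; have := expR_ge1Dx (- y); rewrite expRN => H.
have ey : expR y * (1 - y) <= 1 by rewrite mulrC -ler_pdivlMr ?expR_gt0// mul1r.
by have := expR_gt0 y; nra.
Qed.

(** A large slope at [g b] provides a point [z] near [g b] of much lower energy;
    testing with [z] the variational inequality on the short interval from [b - h]
    to [b] shows that the curve moves by at least a multiple of [h * sigma]. *)
Lemma slope_speed g b sigma : evi_curve E K g -> 0 < b -> 0 < sigma ->
  (sigma%:E < slope E (g b))%E ->
  exists2 h0, 0 < h0 & forall h, 0 < h -> h < h0 -> h < b ->
    h * sigma <= 6 * mdist (g (b - h)) (g b).
Proof.
move=> [gfin gevi] b0 s0 sb.
have rho0 : 0 < sigma / (2 * K) by rewrite divr_gt0// mulr_gt0.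
have [z [d0 drho Ez Hz]] := slope_gt (gfin _ b0) (ltW s0) sb rho0.
set rho := mdist (g b) z in d0 drho Hz *.
have Krho : K * rho <= sigma / 2.
  by move: drho; rewrite ltr_pdivlMr ?mulr_gt0//; lra.
exists (Num.min ((2 * K)^-1) (6 * rho / sigma)).
  by rewrite lt_min invr_gt0 mulr_gt0//= divr_gt0// mulr_gt0.
move=> h h0; rewrite lt_min => /andP[hK hr] hb.
have hK2 : K * h <= 2^-1.
  by move: hK; rewrite -[(2 * K)^-1]mul1r ltr_pdivlMr ?mulr_gt0//; lra.
have hr2 : h * sigma <= 6 * rho by move: hr; rewrite ltr_pdivlMr//; exact: ltW.
have bh : 0 < b - h by rewrite subr_gt0.
have bhb : b - h <= b by lra.
have := gevi (b - h) b z bh bhb Ez.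
rewrite subKr -/rho.
set delta := mdist (g (b - h)) (g b).
have delta0 : 0 <= delta by exact: mdist_ge0.
have tri : mdist (g (b - h)) z <= delta + rho by exact: metric_triangle.
have sq : mdist (g (b - h)) z ^+ 2 <= (delta + rho) ^+ 2.
  by rewrite ler_sqr ?nnegrE ?mdist_ge0 ?addr_ge0// ltW.
have gn : evi_gain K h * (e z - e (g b)) <= - (h * (sigma * rho)).
  rewrite -[X in X <= _]opprK lerN2 -mulrN opprB.
  apply: ler_pM; rewrite ?(ltW h0) ?mulr_ge0 ?(ltW s0) ?(ltW d0) ?(ltW Hz)//.
  exact: evi_gain_ge.
have Kh0 : 0 <= K * h by rewrite mulr_ge0// ltW.
have ex := expR_le_1D2 Kh0 hK2.
move=> H.
have H1 : rho ^+ 2 / 2 + h * (sigma * rho) <= (1 + 2 * (K * h)) * ((delta + rho) ^+ 2 / 2).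
  have : expR (K * h) * (mdist (g (b - h)) z ^+ 2 / 2) <=
      (1 + 2 * (K * h)) * ((delta + rho) ^+ 2 / 2).
    by apply: ler_pM; rewrite ?expR_ge0 ?divr_ge0 ?sqr_ge0// ler_pM2r// invr_gt0.
  by move: H gn; lra.
have H2 : h * sigma * rho <= 2 * (2 * (rho * delta) + delta ^+ 2).
  have h3 : K * h * rho ^+ 2 <= h * (sigma / 2) * rho.
    rewrite expr2 [X in X <= _](_ : _ = h * (K * rho) * rho); last by ring.
    by rewrite ler_wpM2r ?(ltW d0)// ler_wpM2l// ltW.
  have h4 : 0 <= rho * delta + delta ^+ 2 / 2.
    by rewrite addr_ge0 ?mulr_ge0 ?divr_ge0 ?sqr_ge0// ltW.
  have h5 : (2 * (K * h)) * (rho * delta + delta ^+ 2 / 2) <= rho * delta + delta ^+ 2 / 2.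
    by rewrite ler_piMl//; lra.
  have E5 : (1 + 2 * (K * h)) * ((delta + rho) ^+ 2 / 2) = rho ^+ 2 / 2 + K * h * rho ^+ 2
    + (rho * delta + delta ^+ 2 / 2) + (2 * (K * h)) * (rho * delta + delta ^+ 2 / 2) by field.
  by move: H1; rewrite E5; lra.
have [dr|/ltW rd] := leP delta rho.
  have : delta ^+ 2 <= rho * delta by rewrite expr2 ler_wpM2r.
  move=> H3; rewrite -(ler_pM2r d0); lra.
by apply: (le_trans hr2); lra.
Qed.

(** By contraction, the displacement found just before [b] is reached at all
    earlier times up to a factor [expR K]; testing with the starting point of each
    small step turns displacement into a drop of energy. *)
Lemma evi_dissipation g m b sigma : evi_curve E K g -> 0 < m -> m < b -> b <= 1 ->
  0 < sigma -> (sigma%:E < slope E (g b))%E ->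
  (b - m) * sigma ^+ 2 <= 72 * expR K ^+ 3 * (e (g m) - e (g b)).
Proof.
move=> evg m0 mb b1 s0 sb; have b0 := lt_trans m0 mb.
have [gfin gevi] := evg.
have [h0 h00 Hh] := slope_speed evg b0 s0 sb.
have bm0 : 0 < b - m by rewrite subr_gt0.
pose y := (b - m) / h0.
have y0 : 0 < y by rewrite divr_gt0.
pose N := Num.bound y.
have yN : y < N%:R by apply: archi_boundP; exact: ltW.
have N0 : 0 < N%:R :> R by exact: lt_trans yN.
pose h := (b - m) / N%:R.
have hp : 0 < h by rewrite divr_gt0.
have hh0 : h < h0.
  by move: yN; rewrite /y /h ltr_pdivrMr// ltr_pdivrMr// mulrC.
have hN : N%:R * h = b - m by rewrite /h mulrC divfK// gt_eqF.
have hbm : h <= b - m by rewrite -hN ler_peMl ?(ltW hp)// ler1n -(ltr0n R).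
have hb : h < b by lra.
set L := expR K.
have L0 : 0 < L by exact: expR_gt0.
have dh := Hh h hp hh0 hb.
have step r : m <= r -> r <= b - h ->
    h * sigma ^+ 2 <= 72 * L ^+ 3 * (e (g r) - e (g (r + h))).
  move=> mr rb; have r0 := lt_le_trans m0 mr.
  have rh : r <= r + h by lra.
  have c1 := evi_contraction K0 evg (evi_shift (ltW hp) evg) r0 rb.
  rewrite subrK in c1.
  set delta := mdist (g r) (g (r + h)) in c1 *.
  have delta0 : 0 <= delta by exact: mdist_ge0.
  have Lr : expR (K * (b - h - r)) <= L.
    by rewrite ler_expR ler_piMr ?(ltW K0)//; lra.
  have c2 : h * sigma <= 6 * L * delta.
    apply: (le_trans dh); rewrite -mulrA ler_pM2l//; apply: (le_trans c1).
    by rewrite ler_wpM2r.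
  have := gevi r (r + h) (g r) r0 rh (gfin _ r0).
  rewrite mdistxx expr0n mul0r mulr0 add0r metric_sym -/delta.
  have -> : r + h - r = h by ring.
  move=> c3.
  have nd : 0 <= e (g r) - e (g (r + h)).
    by rewrite subr_ge0 (evi_nonincreasing K0 evg).
  have c4 : delta ^+ 2 / 2 <= h * L * (e (g r) - e (g (r + h))).
    apply: (le_trans c3); rewrite ler_wpM2r//; apply: (le_trans (evi_gain_le K0 _)).
    by rewrite ler_pM2l// ler_expR ler_piMr ?(ltW K0)//; lra.
  have c5 : (h * sigma) ^+ 2 <= (6 * L * delta) ^+ 2.
    rewrite ler_sqr// ?nnegrE; first by rewrite mulr_ge0 ?ltW.
    by rewrite !mulr_ge0// ltW.
  rewrite -(ler_pM2l hp).
  have -> : h * (h * sigma ^+ 2) = (h * sigma) ^+ 2 by ring.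
  apply: (le_trans c5).
  have -> : (6 * L * delta) ^+ 2 = 72 * L ^+ 2 * (delta ^+ 2 / 2) by field.
  have -> : h * (72 * L ^+ 3 * (e (g r) - e (g (r + h)))) =
     72 * L ^+ 2 * (h * L * (e (g r) - e (g (r + h)))) by ring.
  by rewrite ler_pM2l// mulr_gt0// exprn_gt0.
have ind i : (i <= N)%N -> i%:R * (h * sigma ^+ 2) <=
    72 * L ^+ 3 * (e (g m) - e (g (m + i%:R * h))).
  elim: i => [_|i IH iN]; first by rewrite !mul0r addr0 subrr mulr0.
  have {}IH := IH (ltnW iN).
  have i1N : i%:R * h + h <= b - m.
    by rewrite -hN -[X in _ + X]mul1r -mulrDl ler_pM2r// natr1 ler_nat.
  have ih : 0 <= i%:R * h by rewrite mulr_ge0// ltW.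
  have := step (m + i%:R * h) _ _.
  rewrite -addrA => /(_ _)/(_ _) st.
  have {}st : h * sigma ^+ 2 <= 72 * L ^+ 3 * (e (g (m + i%:R * h)) - e (g (m + (i%:R * h + h)))).
    by apply: st; lra.
  rewrite -natr1 [(i%:R + 1) * h]mulrDl mul1r.
  by rewrite [X in X <= _]mulrDl mul1r; move: IH st; lra.
have := ind N (leqnn N); rewrite mulrA hN.
by have -> : m + (b - m) = b by ring.
Qed.

End slope.

(** * Flows with a starting point *)

Section start.
Context {R : realType} {X : metricType R} (E : X -> \bar R).
Hypothesis Ereal : forall z : X, E z != -oo%E.
Local Notation e z := (fine (E z)).
Implicit Types (u k : R -> X).

(** Value at time 0 included, so that the regularization below is the identity
    where its flow time vanishes.  The energy of [x] may be infinite. *)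
Definition evi_start (K : R) (x : X) u : Prop :=
  [/\ u 0 = x, evi_curve E K u, u t @[t --> (0 : R)^'+] --> x
    & forall t z, 0 <= t -> (E z < +oo)%E ->
      mdist (u t) z ^+ 2 / 2 <= expR (K * t) * (mdist x z ^+ 2 / 2) +
        evi_gain K t * (e z - e (u t))].

Lemma flow_start (lambda K : R) (x : X) (g : R -> X) (z0 : X) :
  lower_semicontinuous E -> 0 < K -> - K <= lambda -> (E z0 < +oo)%E ->
  EVI_flow E lambda x g -> exists u, evi_start K x u.
Proof.
move=> Elsc K0 Kl Ez0 flow.
have [gfin gevi] := flow_evi_curve Ereal Elsc K0 Kl flow Ez0.
case: (flow) => _ gx _.
pose u t := if t <= 0 then x else g t.
have uE t : 0 < t -> u t = g t by rewrite /u leNgt => ->.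
exists u; split.
- by rewrite /u lexx.
- split=> [t t0|s t z s0 st Ez]; first by rewrite uE ?gfin.
  by rewrite !uE ?gevi// (lt_le_trans s0).
- apply: cvg_trans gx; apply: near_eq_cvg.
  near=> t; rewrite uE//.
move=> t z; rewrite le_eqVlt => /predU1P[<-|t0] Ez.
  by rewrite /u lexx mulr0 expR0 mul1r /evi_gain mulr0 expR0 subrr !mul0r addr0.
rewrite uE//.
pose F s := expR (K * (t - s)) * (mdist (g s) z ^+ 2 / 2) +
  evi_gain K (t - s) * (e z - e (g t)).
have dg : mdist (g s) z @[s --> (0 : R)^'+] --> mdist x z.
  apply/cvgrPdist_lt => eps eps0.
  have /metricType_numDomainType.cvgrPdist_lt/(_ _ eps0) := gx.
  apply: filterS => s; apply: le_lt_trans.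
  rewrite ler_norml; have := metric_triangle x (g s) z; have := metric_triangle (g s) x z.
  by rewrite (metric_sym (g s) x) => ? ?; apply/andP; split; lra.
have ts : t - s @[s --> (0 : R)^'+] --> t.
  rewrite -[X in _ --> X]subr0; apply: cvgB; first exact: cvg_cst.
  by apply: cvg_at_right_filter; exact: cvg_id.
have ex : expR (K * (t - s)) @[s --> (0 : R)^'+] --> expR (K * t).
  apply: (@cvg_comp _ _ _ (fun s => K * (t - s)) expR _ (nbhs (K * t))).
    by apply: cvgM => //; exact: cvg_cst.
  exact: continuous_expR.
have FF : F s @[s --> (0 : R)^'+] -->
    expR (K * t) * (mdist x z ^+ 2 / 2) + evi_gain K t * (e z - e (g t)).
  apply: cvgD; apply: cvgM => //.
  - by apply: cvgM; [rewrite expr2; under eq_fun do rewrite expr2; exact: cvgM|exact: cvg_cst].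
  - by apply: cvgM; [apply: cvgB => //; exact: cvg_cst|exact: cvg_cst].
  - exact: cvg_cst.
rewrite -(cvg_lim _ FF)//; apply: limr_ge; first by apply/cvg_ex; eexists; exact: FF.
near=> s; apply: gevi => //.
by apply: ltW; near: s; exact: nbhs_right_lt.
Unshelve. all: by end_near. Qed.

Variable K : R.
Hypothesis K0 : 0 < K.

Lemma start_contraction x y u k t : evi_start K x u -> evi_start K y k -> 0 <= t ->
  mdist (u t) (k t) <= expR (K * t) * mdist x y.
Proof.
move=> [u0 uevi ux _] [k0 kevi ky _]; rewrite le_eqVlt => /predU1P[<-|t0].
  by rewrite mulr0 expR0 mul1r u0 k0.
apply/ler_addgt0Pr => eps eps0.
pose eta := eps / 2 / expR (K * t).
have eta0 : 0 < eta by rewrite divr_gt0 ?expR_gt0//; lra.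
have /metricType_numDomainType.cvgrPdist_lt/(_ _ eta0) hu := ux.
have /metricType_numDomainType.cvgrPdist_lt/(_ _ eta0) hk := ky.
have ht : \forall s \near (0 : R)^'+, s < t by exact: nbhs_right_lt.
have hp : \forall s \near (0 : R)^'+, 0 < s by exact: nbhs_right_gt.
near (0 : R)^'+ => s.
have us : mdist x (u s) < eta by near: s.
have ks : mdist y (k s) < eta by near: s.
have st : s < t by near: s.
have s0 : 0 < s by near: s.
apply: (le_trans (evi_contraction K0 uevi kevi s0 (ltW st))).
apply: (@le_trans _ _ (expR (K * t) * (mdist x y + 2 * eta))).
  apply: ler_pM; rewrite ?expR_ge0 ?mdist_ge0//.
    by rewrite ler_expR ler_pM2l//; lra.
  have := metric_triangle (u s) x (k s); have := metric_triangle x y (k s).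
  by rewrite (metric_sym (u s) x); move: us ks; rewrite /= ; lra.
rewrite mulrDr lerD2l /eta le_eqVlt; apply/orP; left; apply/eqP; field.
by rewrite gt_eqF ?expR_gt0.
Unshelve. all: by end_near. Qed.

Lemma start_evi x u s t z : evi_start K x u -> 0 <= s -> s <= t -> (E z < +oo)%E ->
  mdist (u t) z ^+ 2 / 2 <= expR (K * (t - s)) * (mdist (u s) z ^+ 2 / 2) +
    evi_gain K (t - s) * (e z - e (u t)).
Proof.
move=> [u0 [ufin uevi] ux start]; rewrite le_eqVlt => /predU1P[<-|s0 st Ez].
  by move=> t0 Ez; rewrite subr0 u0; exact: start.
exact: uevi.
Qed.

Lemma start_bounded x u : evi_start K x u ->
  exists B : R, forall t, 0 <= t <= 1 -> mdist x (u t) <= B.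
Proof.
move=> [u0 uevi ux _]; case: (uevi) => ufin uev.
have /metricType_numDomainType.cvgrPdist_lt/(_ _ ltr01) := ux.
move=> [d /= d0 Hd].
pose a := Num.min (d / 2) 1.
have a0 : 0 < a by rewrite lt_min ltr01 divr_gt0.
have a1 : a <= 1 by rewrite /a ge_min lexx orbT.
have ad : a < d by rewrite (le_lt_trans (_ : _ <= d / 2)) ?ge_min ?lexx//; lra.
have Hd' t : 0 < t -> t < d -> mdist x (u t) < 1.
  by move=> t0 td; apply: Hd => //=; rewrite sub0r normrN gtr0_norm.
pose Q := 2 * (expR K * (e (u a) - e (u 1))).
exists (2 + Q) => t /andP[t0 t1].
have Q0 : 0 <= Q.
  by rewrite mulr_ge0// mulr_ge0 ?expR_ge0// subr_ge0 (evi_nonincreasing K0 uevi).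
move: t0; rewrite le_eqVlt => /predU1P[<-|t0].
  by rewrite u0 mdistxx; lra.
have [ta|/ltW at_] := leP t a.
  by have := Hd' t t0 (le_lt_trans ta ad); lra.
have := uev a t (u a) a0 at_ (ufin _ a0).
rewrite mdistxx expr0n mul0r mulr0 add0r => H.
have gn : evi_gain K (t - a) <= expR K.
  apply: (le_trans (evi_gain_le K0 _)); rewrite -[X in _ <= X]mul1r.
  apply: ler_pM; rewrite ?expR_ge0 ?subr_ge0 ?ler_expR//; first by lra.
  by rewrite ler_piMr ?(ltW K0)//; lra.
have H2 : mdist (u t) (u a) ^+ 2 / 2 <= expR K * (e (u a) - e (u 1)).
  apply: (le_trans H); apply: ler_pM => //.
  - by apply: le_trans (evi_gain_ge K0 _); rewrite subr_ge0.
  - by rewrite subr_ge0 (evi_nonincreasing K0 uevi).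
  - by rewrite lerB// (evi_nonincreasing K0 uevi).
have H3 : mdist (u t) (u a) <= 1 + Q.
  by have := sqr_ge0 (mdist (u t) (u a) - 1); rewrite /Q; nra.
have := metric_triangle x (u a) (u t); rewrite (metric_sym (u a)).
by have := Hd' a a0 ad; lra.
Qed.

(** 288 = 4 * 72: the factor 72 comes from [evi_dissipation], the factor 4 from
    using half of the time interval in [start_step]. *)
Definition slope_rate : R := (288 * expR K ^+ 3)^-1.

Lemma slope_rate_gt0 : 0 < slope_rate.
Proof. by rewrite invr_gt0 mulr_gt0// exprn_gt0// expR_gt0. Qed.

(** The variational inequality is used on both halves of the interval from [a] to
    [b]; on the first half the energy exceeds its final value by the amount
    dissipated on the second.  Subtracting the lower bound [c] makes the energies
    nonnegative, which allows to replace the gain by [h] or [h * expR (K * h)]. *)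
Lemma start_step x u a b z (c sigma : R) : evi_start K x u ->
  0 <= a -> a < b -> b <= 1 -> (E z < +oo)%E ->
  c <= e z -> (forall t, 0 < t -> t <= 1 -> c <= e (u t)) ->
  sigma = 0 \/ 0 < sigma /\ (sigma%:E < slope E (u b))%E ->
  mdist (u b) z ^+ 2 / 2 + slope_rate * (b - a) ^+ 2 * sigma ^+ 2 <=
  expR (K * (b - a)) * (mdist (u a) z ^+ 2 / 2 + (b - a) * (e z - c)) -
    (b - a) * (e (u b) - c).
Proof.
move=> st a0 ab b1 Ez cz cu sb; have [_ uevi _ _] := st.
pose h := (b - a) / 2; have h0 : 0 < h by rewrite divr_gt0// subr_gt0.
pose m := a + h.
have am : a <= m by rewrite lerDl ltW.
have mb : m < b by rewrite /m /h; lra.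
have m0 : 0 < m by rewrite ltr_wpDl.
have ma : m - a = h by rewrite /m; ring.
have bm : b - m = h by rewrite /m /h; field.
have I1 := start_evi st a0 am Ez.
have I2 := start_evi st (ltW m0) (ltW mb) Ez.
rewrite ma in I1; rewrite bm in I2.
set L := expR (K * h) in I1 I2.
have L1 : 1 <= L by rewrite -expR0 ler_expR mulr_ge0// ltW.
have LL : expR (K * (b - a)) = L ^+ 2.
  by rewrite expr2 -expRD; congr expR; rewrite /h; field.
have gain_le v : 0 <= v -> evi_gain K h * (e z - c) - evi_gain K h * v <=
    h * L * (e z - c) - h * v.
  move=> v0; apply: lerB.
    by rewrite ler_wpM2r ?subr_ge0// evi_gain_le.
  by rewrite ler_wpM2r// evi_gain_ge.
have cm : 0 <= e (u m) - c by rewrite subr_ge0 cu//; lra.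
have cb : 0 <= e (u b) - c by rewrite subr_ge0 cu//; lra.
have G1 := gain_le _ cm; have G2 := gain_le _ cb.
have cz0 : 0 <= e z - c by rewrite subr_ge0.
set A := mdist (u a) z ^+ 2 / 2 in I1 *.
set M := mdist (u m) z ^+ 2 / 2 in I1 I2 *.
have I1' : M <= L * A + (h * L * (e z - c) - h * (e (u m) - c)).
  apply: (le_trans I1); rewrite lerD2l; apply: le_trans G1.
  by rewrite le_eqVlt; apply/orP; left; apply/eqP; ring.
have I2' : mdist (u b) z ^+ 2 / 2 <= L * M + (h * L * (e z - c) - h * (e (u b) - c)).
  apply: (le_trans I2); rewrite lerD2l; apply: le_trans G2.
  by rewrite le_eqVlt; apply/orP; left; apply/eqP; ring.
have I3 : mdist (u b) z ^+ 2 / 2 <= L ^+ 2 * (A + 2 * h * (e z - c)) -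
    2 * h * (e (u b) - c) - h * (e (u m) - e (u b)).
  apply: (le_trans I2').
  have : L * M <= L * (L * A + (h * L * (e z - c) - h * (e (u m) - c))).
    by rewrite ler_wpM2l// (le_trans ler01).
  have J1 : h * (e (u m) - c) <= L * (h * (e (u m) - c)).
    by rewrite ler_peMl// mulr_ge0// ltW.
  have J2 : h * L * (e z - c) <= L * (h * L * (e z - c)).
    rewrite ler_peMl//; apply: mulr_ge0 => //.
    by apply: mulr_ge0; [exact: ltW|exact: le_trans L1].
  by rewrite expr2; move: J1 J2; lra.
have dis : slope_rate * (b - a) ^+ 2 * sigma ^+ 2 <= h * (e (u m) - e (u b)).
  have nd : 0 <= e (u m) - e (u b).
    by rewrite subr_ge0 (evi_nonincreasing K0 uevi)// ltW.
  case: sb => [->|[s0 sb]].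
    by rewrite expr0n mulr0 mulr_ge0// ltW.
  have := evi_dissipation Ereal K0 uevi m0 mb b1 s0 sb; rewrite bm.
  have k0 : 0 < 72 * expR K ^+ 3 by rewrite mulr_gt0// exprn_gt0// expR_gt0.
  rewrite mulrC -ler_pdivrMl// => D.
  apply: (@le_trans _ _ (h * ((72 * expR K ^+ 3)^-1 * (sigma ^+ 2 * h)))).
    rewrite le_eqVlt; apply/orP; left; apply/eqP; rewrite /slope_rate /h.
    by field; rewrite gt_eqF// expR_gt0.
  by rewrite ler_pM2l.
rewrite LL; have -> : b - a = 2 * h by rewrite /h; field.
move: dis; have -> : b - a = 2 * h by rewrite /h; field.
by move: I3; lra.
Qed.

(** [start_step] for all [sigma] below the slope, which it bounds. *)
Lemma start_step_slope x u a b z (c : R) : evi_start K x u ->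
  0 <= a -> a < b -> b <= 1 -> (E z < +oo)%E ->
  c <= e z -> (forall t, 0 < t -> t <= 1 -> c <= e (u t)) ->
  ((mdist (u b) z ^+ 2 / 2)%:E + (slope_rate * (b - a) ^+ 2)%:E * slope E (u b) ^+ 2 <=
  (expR (K * (b - a)) * (mdist (u a) z ^+ 2 / 2 + (b - a) * (e z - c)) -
    (b - a) * (e (u b) - c))%:E)%E.
Proof.
move=> st a0 ab b1 Ez cz cu.
have step sigma := @start_step x u a b z c sigma st a0 ab b1 Ez cz cu.
move: step; set A := mdist (u b) z ^+ 2 / 2; set C := expR _ * _ - _.
set B := slope_rate * (b - a) ^+ 2 => step.
have B0 : 0 < B by rewrite mulr_gt0 ?slope_rate_gt0// exprn_gt0// subr_gt0.
have s0 := slope_ge0 E (u b).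
case: (slope E (u b)) s0 step => [s||]; rewrite ?lee_fin => s0 step; last first.
- by [].
- pose y := `|(C - A) / B| + 1.
  have y1 : 1 <= y by rewrite lerDr.
  have := step y (or_intror (conj (lt_le_trans ltr01 y1) (ltry _))).
  rewrite -lerBrDl -ler_pdivlMl// mulrC => H.
  have qy : (C - A) / B < y by rewrite /y ltr_pwDr// ler_norm.
  have yy : y <= y ^+ 2 by rewrite expr2 ler_peMl// (le_trans ler01).
  by have := le_lt_trans (le_trans yy H) qy; rewrite ltxx.
rewrite -expr2.
move: s0; rewrite le_eqVlt => /predU1P[<-|s0].
  by have := step 0 (or_introl erefl).
apply/ler_addgt0Pr => eps eps0.
pose eta := Num.min (s / 2) (eps / (2 * B * s)).
have Bs0 : 0 < 2 * B * s by apply: mulr_gt0 => //; exact: mulr_gt0.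
have eta0 : 0 < eta by rewrite lt_min; apply/andP; split; exact: divr_gt0.
have etas : eta <= s / 2 by rewrite /eta ge_min lexx.
have etae : eta * (2 * B * s) <= eps.
  by rewrite -ler_pdivlMr// /eta ge_min lexx orbT.
have p0 : 0 < s - eta by lra.
have := step (s - eta); rewrite lte_fin => /(_ (or_intror (conj p0 _))) H.
have {}H := H (ltac:(lra)).
have : B * (s ^+ 2 - 2 * s * eta) <= B * (s - eta) ^+ 2.
  by rewrite ler_pM2l//; have := sqr_ge0 eta; nra.
by move: H etae; lra.
Qed.

End start.

(** * The regularized curve and its action *)

Section recovery.
Context {R : realType} {X : metricType R} (E : X -> \bar R).
Local Notation mu := (@lebesgue_measure R).
Hypothesis Ereal : forall z : X, E z != -oo%E.
Local Notation e z := (fine (E z)).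
Variables (K : R) (S : X -> R -> X).
Hypotheses (K0 : 0 < K) (HS : forall z, evi_start E K z (S z)).
Variables (g : R -> X) (A : R -> R).
Hypothesis ndA : {homo A : s t / s <= t}.
Hypothesis gA : forall s t, 0 <= s -> s <= t -> t <= 1 ->
  mdist (g s) (g t) ^+ 2 <= (t - s) * (A t - A s).
Hypotheses (Eg0 : (E (g 0) < +oo)%E) (Eg1 : (E (g 1) < +oo)%E).

Lemma curve_bounded t : 0 <= t <= 1 -> mdist (g 0) (g t) <= 1 + (A 1 - A 0).
Proof.
move=> /andP[t0 t1]; have := gA (lexx 0) t0 t1; rewrite subr0 => H.
have A0t := ndA t0; have At1 := ndA t1.
have H2 : t * (A t - A 0) <= A 1 - A 0.
  by apply: (@le_trans _ _ (A t - A 0)); [rewrite ler_piMl ?subr_ge0|lra].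
by have := sqr_ge0 (mdist (g 0) (g t) - 1); nra.
Qed.

(** The images of the curve under the flow up to time 1 form a bounded set. *)
Lemma tube_lower_bound : energy_regular E ->
  exists c : R, forall t r, 0 <= t <= 1 -> 0 <= r <= 1 -> (E (S (g t) r) < +oo)%E ->
    c <= e (S (g t) r).
Proof.
move=> [_ _ Ebnd].
have [B HB] := start_bounded K0 (HS (g 0)).
pose T : set X := [set w | exists t r, [/\ 0 <= t <= 1, 0 <= r <= 1 & w = S (g t) r]].
have Tb w : T w -> mdist (g 0) w <= B + expR K * (1 + (A 1 - A 0)).
  move=> [t [r [t01 r01 ->]]].
  have := metric_triangle (g 0) (S (g 0) r) (S (g t) r).
  have := HB r r01; have /andP[r0 r1] := r01.
  have := start_contraction K0 (HS (g 0)) (HS (g t)) r0.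
  have : expR (K * r) * mdist (g 0) (g t) <= expR K * (1 + (A 1 - A 0)).
    apply: ler_pM; rewrite ?expR_ge0 ?mdist_ge0 ?curve_bounded//.
    by rewrite ler_expR ler_piMr// ltW.
  lra.
have [|c Hc] := Ebnd T.
  exists (2 * (B + expR K * (1 + (A 1 - A 0)))) => u v /Tb Tu /Tb Tv.
  by have := metric_triangle u (g 0) v; rewrite (metric_sym u (g 0)); lra.
exists c => t r t01 r01 Efin; rewrite -lee_fin -(energyE Ereal Efin).
by apply: Hc; exists t, r.
Qed.

Variable c : R.
Hypothesis Hc : forall t r, 0 <= t <= 1 -> 0 <= r <= 1 ->
  (E (S (g t) r) < +oo)%E -> c <= e (S (g t) r).
Variable d : R.
Hypotheses (d0 : 0 < d) (d1 : d <= 1).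

(** It vanishes at both ends and has slope [d], then [- d]. *)
Definition flow_time (t : R) : R := d * Num.min t (1 - t).
Definition regularized (t : R) : X := S (g t) (flow_time t).

Local Notation eta := flow_time.
Local Notation gg := regularized.
Local Notation P := (expR (K * d)).

Lemma flow_time_itv t : 0 <= t <= 1 -> 0 <= eta t <= d.
Proof.
move=> /andP[t0 t1]; rewrite /flow_time mulr_ge0 ?(ltW d0) ?le_min ?t0 ?subr_ge0//=.
by rewrite ler_piMr ?(ltW d0)// ge_min t1.
Qed.

Lemma flow_timeL t : t <= 2^-1 -> eta t = d * t.
Proof. by move=> t2; rewrite /flow_time min_l//; lra. Qed.

Lemma flow_timeR t : 2^-1 <= t -> eta t = d * (1 - t).
Proof. by move=> t2; rewrite /flow_time min_r//; lra. Qed.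

Lemma regularized0 : gg 0 = g 0.
Proof.
rewrite /regularized flow_timeL ?invr_ge0// mulr0.
by case: (HS (g 0)).
Qed.

Lemma regularized1 : gg 1 = g 1.
Proof.
rewrite /regularized flow_timeR; last by lra.
by rewrite subrr mulr0; case: (HS (g 1)).
Qed.

Lemma regularized_fin t : 0 <= t <= 1 -> (E (gg t) < +oo)%E.
Proof.
move=> /andP[]; rewrite le_eqVlt => /predU1P[<- _|t0]; first by rewrite regularized0.
rewrite le_eqVlt => /predU1P[->|t1]; first by rewrite regularized1.
have [_ [fin _] _ _] := HS (g t); apply: fin.
by rewrite mulr_gt0// lt_min t0 subr_gt0.
Qed.

Lemma regularized_ge t : 0 <= t <= 1 -> c <= e (gg t).
Proof.
move=> t01; apply: Hc => //; last exact: regularized_fin.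
by have /andP[-> /le_trans] := flow_time_itv t01; exact.
Qed.

(** The exponential weight makes the energy terms of [start_step_slope] an exact
    difference: with [tau = eta t - eta s],
    [expR (K * tau) * (e (gg s) - c) - (e (gg t) - c)] is
    [expR (K * eta t) * (Phi s - Phi t)]. *)
Definition excess (t : R) : R := expR (- (K * eta t)) * (e (gg t) - c).
Local Notation Phi := excess.

Lemma excess_ge0 t : 0 <= t <= 1 -> 0 <= Phi t.
Proof. by move=> t01; rewrite mulr_ge0 ?expR_ge0// subr_ge0 regularized_ge. Qed.

(** The flow line of [g t] is followed from the smaller to the larger flow time and
    compared with [gg s], the flow line of [g s] at the smaller one. *)
Lemma regularized_pair s t : 0 <= s <= 1 -> 0 <= t <= 1 -> eta s <= eta t ->
  ((mdist (gg t) (gg s) ^+ 2)%:E +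
    (2 * slope_rate K * (eta t - eta s) ^+ 2)%:E * slope E (gg t) ^+ 2 <=
  (P * (P * mdist (g s) (g t) ^+ 2 + 2 * (eta t - eta s) * (Phi s - Phi t)))%:E)%E.
Proof.
move=> s01 t01 st.
have /andP[es0 esd] := flow_time_itv s01; have /andP[et0 etd] := flow_time_itv t01.
have ctr := start_contraction K0 (HS (g t)) (HS (g s)) es0.
have P1 : 1 <= P by rewrite -expR0 ler_expR mulr_ge0// ltW.
have Pes : expR (K * eta s) <= P by rewrite ler_expR ler_pM2l.
have Pet : expR (K * eta t) <= P by rewrite ler_expR ler_pM2l.
have ctr2 : mdist (S (g t) (eta s)) (gg s) ^+ 2 <=
    expR (K * eta s) ^+ 2 * mdist (g s) (g t) ^+ 2.
  rewrite -exprMn ler_sqr ?nnegrE ?mdist_ge0 ?mulr_ge0 ?expR_ge0 ?mdist_ge0//.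
  by rewrite (metric_sym (g s)).
have D0 : 0 <= mdist (g s) (g t) ^+ 2 by exact: sqr_ge0.
move: st; rewrite le_eqVlt => /predU1P[st|st].
  rewrite st subrr expr0n mulr0 mul0e adde0 lee_fin mulr0 mul0r addr0.
  rewrite {1}/regularized -st; apply: (le_trans ctr2).
  rewrite mulrA -expr2; apply: ler_wpM2r => //.
  by rewrite ler_sqr ?nnegrE ?expR_ge0.
have t1 : eta t <= 1 by exact: le_trans d1.
have cu r : 0 < r -> r <= 1 -> c <= e (S (g t) r).
  move=> r0 r1; apply: Hc => //; first by rewrite (ltW r0).
  by have [_ [fin _] _ _] := HS (g t); exact: fin.
have := start_step_slope Ereal K0 (HS (g t)) es0 st t1 (regularized_fin s01)
  (regularized_ge s01) cu.
rewrite -/(gg t); set tau := eta t - eta s.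
have tau0 : 0 < tau by rewrite subr_gt0.
set C := (X in (_ <= X%:E)%E) => step.
have CE : 2 * C <= P * (P * mdist (g s) (g t) ^+ 2 + 2 * tau * (Phi s - Phi t)).
  pose Q := P * mdist (g s) (g t) ^+ 2 + 2 * tau * (Phi s - Phi t).
  have CQ : 2 * C <= expR (K * eta t) * Q.
    have -> : expR (K * eta t) * Q = P * (expR (K * eta t) * mdist (g s) (g t) ^+ 2) +
        2 * tau * (expR (K * eta t) * Phi s - expR (K * eta t) * Phi t).
      by rewrite /Q; ring.
    have -> : expR (K * eta t) * Phi t = e (gg t) - c.
      by rewrite /excess mulrA -expRD addrN expR0 mul1r.
    have -> : expR (K * eta t) * Phi s = expR (K * tau) * (e (gg s) - c).
      by rewrite /excess mulrA -expRD; congr (expR _ * _); rewrite /tau; ring.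
    have : expR (K * tau) * mdist (S (g t) (eta s)) (gg s) ^+ 2 <=
        P * (expR (K * eta t) * mdist (g s) (g t) ^+ 2).
      have -> : expR (K * eta t) = expR (K * tau) * expR (K * eta s).
        by rewrite -expRD; congr expR; rewrite /tau; ring.
      have -> : P * (expR (K * tau) * expR (K * eta s) * mdist (g s) (g t) ^+ 2) =
        expR (K * tau) * (P * expR (K * eta s) * mdist (g s) (g t) ^+ 2) by ring.
      rewrite ler_pM2l ?expR_gt0//; apply: (le_trans ctr2).
      by rewrite expr2 ler_wpM2r// ler_pM2r ?expR_gt0.
    by rewrite /C; lra.
  have C0 : 0 <= C.
    rewrite -lee_fin; apply: le_trans step; apply: adde_ge0.
      by rewrite lee_fin divr_ge0// sqr_ge0.
    apply: mule_ge0; last exact/expe_ge0/slope_ge0.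
    by rewrite lee_fin mulr_ge0 ?sqr_ge0// ltW// slope_rate_gt0.
  have Q0 : 0 <= Q.
    have : 0 <= expR (K * eta t) * Q by apply: le_trans CQ; rewrite mulr_ge0.
    by rewrite pmulr_rge0 ?expR_gt0.
  by apply: (le_trans CQ); rewrite -/Q ler_wpM2r.
have kt0 : 0 < slope_rate K * tau ^+ 2 by rewrite mulr_gt0 ?slope_rate_gt0// exprn_gt0.
move: step (slope_ge0 E (gg t)); case: (slope E (gg t)) => [s'||//].
  rewrite -EFin_expe -!EFinM -!EFinD !lee_fin => step _; apply: le_trans CE; lra.
by rewrite /expe/= mulyy gt0_muley ?lte_fin// addey// leye_eq.
Qed.

(** The function [W] of [action_bound] for the regularized curve: the energy of the
    original curve plus the energy released by the flow.  The constant in the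
    second case makes it continuous at 1/2. *)
Definition excess_action (t : R) : R :=
  P * (P * A t + if t <= 2^-1 then - (2 * d * Phi t)
                 else 2 * d * Phi t - 4 * d * Phi 2^-1).
Local Notation W := excess_action.

Definition slope_penalty (t : R) : \bar R :=
  ((slope_rate K * d ^+ 2)%:E * slope E (gg t) ^+ 2)%E.
Local Notation q := slope_penalty.

Lemma slope_penaltyE h t : ((2 * h ^+ 2)%:E * q t =
  (2 * slope_rate K * (d * h) ^+ 2)%:E * slope E (gg t) ^+ 2)%E.
Proof. by rewrite /slope_penalty muleA -EFinM; congr (_%:E * _)%E; ring. Qed.

Lemma regularized_left s t : 0 <= s -> s <= t -> t <= 2^-1 ->
  ((mdist (gg s) (gg t) ^+ 2)%:E + (2 * (t - s) ^+ 2)%:E * q t <=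
   ((t - s) * (W t - W s))%:E)%E.
Proof.
move=> s0 st t2; have s2 := le_trans st t2.
have s01 : 0 <= s <= 1 by rewrite s0/=; lra.
have t01 : 0 <= t <= 1 by apply/andP; split; lra.
have := regularized_pair s01 t01; rewrite (flow_timeL s2) (flow_timeL t2).
rewrite ler_pM2l// => /(_ st).
rewrite (metric_sym (gg t)) slope_penaltyE -(mulrBr d) => H; apply: (le_trans H).
rewrite lee_fin /excess_action s2 t2.
rewrite [X in _ <= X](_ : _ = P * (P * ((t - s) * (A t - A s)) +
  2 * (d * (t - s)) * (Phi s - Phi t))); last by ring.
rewrite ler_pM2l ?expR_gt0// lerD2r ler_pM2l ?expR_gt0//; apply: gA => //.
by case/andP: t01.
Qed.

Lemma regularized_right s t : 2^-1 <= s -> s <= t -> t <= 1 ->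
  ((mdist (gg s) (gg t) ^+ 2)%:E + (2 * (t - s) ^+ 2)%:E * q s <=
   ((t - s) * (W t - W s))%:E)%E.
Proof.
move=> s2 st t1; have t2 := le_trans s2 st.
have s0 : 0 <= s by lra.
have s01 : 0 <= s <= 1 by rewrite s0/=; lra.
have t01 : 0 <= t <= 1 by apply/andP; split; lra.
have := regularized_pair t01 s01; rewrite (flow_timeR s2) (flow_timeR t2).
rewrite ler_pM2l// lerD2l lerN2 => /(_ st).
rewrite slope_penaltyE (_ : d * (1 - s) - d * (1 - t) = d * (t - s)); last by ring.
move=> H; apply: (le_trans H).
rewrite lee_fin /excess_action.
have WR r : 2^-1 <= r -> (if r <= 2^-1 then - (2 * d * Phi r)
    else 2 * d * Phi r - 4 * d * Phi 2^-1) = 2 * d * Phi r - 4 * d * Phi 2^-1.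
  move=> r2; case: ifPn => // r2'.
  by have -> : r = 2^-1; [apply/le_anti; rewrite r2' r2|ring].
rewrite !WR//.
rewrite [X in _ <= X](_ : _ = P * (P * ((t - s) * (A t - A s)) +
  2 * (d * (t - s)) * (Phi t - Phi s))); last by ring.
rewrite ler_pM2l ?expR_gt0// lerD2r ler_pM2l ?expR_gt0// metric_sym.
exact: gA.
Qed.

Lemma slope_penalty_ge0 t : (0 <= q t)%E.
Proof.
apply: mule_ge0; last exact/expe_ge0/slope_ge0.
by rewrite lee_fin mulr_ge0 ?sqr_ge0// ltW// slope_rate_gt0.
Qed.

(** Across 1/2 the estimates on the two sides add up. *)
Lemma regularized_distance s t : 0 <= s -> s <= t -> t <= 1 ->
  W s <= W t /\ mdist (gg s) (gg t) ^+ 2 <= (t - s) * (W t - W s).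
Proof.
have drop x (y : \bar R) z : (0 <= y)%E -> (x%:E + y <= z%:E)%E -> x <= z.
  by move=> y0; rewrite -lee_fin; apply: le_trans; exact: leeDl.
have mono u v : u <= v -> mdist (gg u) (gg v) ^+ 2 <= (v - u) * (W v - W u) ->
    W u <= W v.
  rewrite le_eqVlt => /predU1P[->//|uv] H.
  have := le_trans (sqr_ge0 _) H; rewrite pmulr_rge0 ?subr_ge0// subr_gt0//.
have pen u v : (0 <= (2 * (v - u) ^+ 2)%:E * q u)%E.
  by rewrite mule_ge0 ?slope_penalty_ge0// lee_fin mulr_ge0// sqr_ge0.
have pen' u v : (0 <= (2 * (v - u) ^+ 2)%:E * q v)%E.
  by rewrite mule_ge0 ?slope_penalty_ge0// lee_fin mulr_ge0// sqr_ge0.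
have L u v : 0 <= u -> u <= v -> v <= 2^-1 ->
    mdist (gg u) (gg v) ^+ 2 <= (v - u) * (W v - W u).
  by move=> u0 uv v2; exact: drop (pen' u v) (regularized_left u0 uv v2).
have Rr u v : 2^-1 <= u -> u <= v -> v <= 1 ->
    mdist (gg u) (gg v) ^+ 2 <= (v - u) * (W v - W u).
  by move=> u2 uv v1; exact: drop (pen u v) (regularized_right u2 uv v1).
move=> s0 st t1; have [t2|/ltW t2] := leP t 2^-1.
  by have H := L _ _ s0 st t2; split => //; exact: mono H.
have [s2|/ltW s2] := leP 2^-1 s.
  by have H := Rr _ _ s2 st t1; split => //; exact: mono H.
have H1 := L _ _ s0 s2 (lexx _); have H2 := Rr _ _ (lexx _) t2 t1.
have M1 := mono _ _ s2 H1; have M2 := mono _ _ t2 H2.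
split; first exact: le_trans M2.
have := metric_triangle (gg s) (gg 2^-1) (gg t).
move: H1 H2; set x := mdist (gg s) (gg 2^-1); set y := mdist (gg 2^-1) (gg t).
move=> H1 H2 H3.
have x0 : 0 <= x by exact: mdist_ge0.
have y0 : 0 <= y by exact: mdist_ge0.
apply: (@le_trans _ _ ((x + y) ^+ 2)).
  by rewrite ler_sqr ?nnegrE ?mdist_ge0 ?addr_ge0.
have -> : t - s = (2^-1 - s) + (t - 2^-1) by ring.
have -> : W t - W s = (W 2^-1 - W s) + (W t - W 2^-1) by ring.
move: H1 H2; rewrite -(subr_ge0 s) in s2; rewrite -(subr_ge0 _ t) in t2.
rewrite -(subr_ge0 (W s)) in M1; rewrite -(subr_ge0 _ (W t)) in M2.
move: s2 t2 M1 M2; move: (2^-1 - s) (t - 2^-1) (W 2^-1 - W s) (W t - W 2^-1).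
move=> a b v w a0 b0 v0 w0 H1 H2.
(* The cross term is estimated by the Cauchy--Schwarz inequality in the plane. *)
have H4 : 2 * (x * y) <= a * w + b * v.
  have aw0 : 0 <= a * w by exact: mulr_ge0.
  have bv0 : 0 <= b * v by exact: mulr_ge0.
  rewrite -ler_sqr ?nnegrE ?addr_ge0 ?mulr_ge0//.
  have H5 : (x * y) ^+ 2 <= (a * v) * (b * w).
    by rewrite exprMn; apply: ler_pM; rewrite ?sqr_ge0.
  have := sqr_ge0 (a * w - b * v).
  by rewrite exprMn; nra.
by nra.
Qed.

(** Before 1/2 the slope is controlled from the left, after 1/2 from the right. *)
Lemma regularized_action (eps : R) : eps ^+ 2 = slope_rate K * d ^+ 2 ->
  curves01 gg /\
  (action_eps E eps gg <= ((P ^+ 2 * (A 1 - A 0) +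
     2 * d * P * (e (g 0) + e (g 1) - 2 * c)) / 2)%:E)%E.
Proof.
move=> epsE.
have [||||ac HW] := @action_bound R X gg W q.
- by move=> s t s0 st t1; have [] := regularized_distance s0 st t1.
- by move=> s t s0 st t1; have [] := regularized_distance s0 st t1.
- exact: slope_penalty_ge0.
- move=> t /andP[t0 t1] tN.
  have comb h : 0 < h -> forall x y (z : \bar R) a b, (0 <= z)%E ->
      x <= h * a -> (y%:E + (2 * h ^+ 2)%:E * z <= (h * b)%:E)%E ->
      ((x + y)%:E + (2 * h ^+ 2)%:E * z <= (h * (a + b))%:E)%E.
    move=> h0 x y z a b z0 xa yb; rewrite EFinD -addeA mulrDr EFinD.
    by apply: leeD => //; rewrite lee_fin.
  have [t2|t2] := leP t 2^-1.
    have t2' : t < 2^-1 by rewrite lt_neqAle tN.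
    exists (2^-1 - t); first by rewrite subr_gt0.
    move=> h /andP[h0 ht] th0 th1.
    have th : t + h <= 2^-1 by lra.
    have H1 : mdist (gg (t + h)) (gg t) ^+ 2 <= h * (W (t + h) - W t).
      have [|_] := @regularized_distance t (t + h) (ltW t0) _ th1; first by lra.
      by rewrite metric_sym; have -> : t + h - t = h by ring.
    have tht : t - h <= t by lra.
    have := regularized_left th0 tht t2; have -> : t - (t - h) = h by ring.
    move=> H2; have := comb _ h0 _ _ _ _ _ (slope_penalty_ge0 t) H1 H2.
    by have -> : W (t + h) - W t + (W t - W (t - h)) = W (t + h) - W (t - h) by ring.
  exists (t - 2^-1); first by rewrite subr_gt0.
  move=> h /andP[h0 ht] th0 th1.
  have H1 : mdist (gg (t - h)) (gg t) ^+ 2 <= h * (W t - W (t - h)).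
    have [||_] := @regularized_distance (t - h) t th0; [lra|lra|].
    by have -> : t - (t - h) = h by ring.
  have tht : t <= t + h by lra.
  have := regularized_right (ltW t2) tht th1; have -> : t + h - t = h by ring.
  move=> H2; have := comb _ h0 _ _ _ _ _ (slope_penalty_ge0 t) H1 H2.
  rewrite (metric_sym (gg t)) (addrC (mdist _ _ ^+ 2)).
  by have -> : W t - W (t - h) + (W (t + h) - W t) = W (t + h) - W (t - h) by ring.
split; first exact: abs_cont_curves01.
rewrite /action_eps /kinetic ifT; last exact/asboolP.
set IS := (X in (_ * X + _)%E).
have [IQ IQE] : exists IQ, IQ = (\int[mu]_(t in `]0%R, 1%R[) q t)%E by eexists.
have IF : ((eps ^+ 2)%:E * \int[mu]_(t in `]0%R, 1%R[) (slope E (gg t) ^+ 2) <= IQ)%E.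
  rewrite IQE.
  rewrite epsE; apply: lower_integralZ => //.
    by rewrite mulr_ge0 ?sqr_ge0// ltW// slope_rate_gt0.
  by move=> t _; exact/expe_ge0/slope_ge0.
have ISq : (IS + IQ <= (W 1 - W 0)%:E)%E.
  rewrite IQE.
  apply: le_trans HW; apply: lower_integralD => // t _.
    by rewrite lee_fin sqr_ge0.
  exact: slope_penalty_ge0.
have W10 : W 1 - W 0 <= P ^+ 2 * (A 1 - A 0) + 2 * d * P * (e (g 0) + e (g 1) - 2 * c).
  have i01 : 0 <= (2^-1 : R) <= 1 by apply/andP; split; lra.
  have := excess_ge0 i01.
  have P0 : Phi 0 = e (g 0) - c.
    by rewrite /excess regularized0 flow_timeL ?invr_ge0// !mulr0 oppr0 expR0 mul1r.
  have P1 : Phi 1 = e (g 1) - c.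
    rewrite /excess regularized1 flow_timeR; last by lra.
    by rewrite subrr !mulr0 oppr0 expR0 mul1r.
  have W0E : W 0 = P * (P * A 0 - 2 * d * Phi 0).
    by rewrite /excess_action invr_ge0 ler0n.
  have W1E : W 1 = P * (P * A 1 + (2 * d * Phi 1 - 4 * d * Phi 2^-1)).
    have h1 : (1 <= 2^-1 :> R) = false.
      by apply/negbTE; rewrite -ltNge invf_lt1// ltr1n.
    by rewrite /excess_action h1.
  move=> Ph; rewrite W0E W1E P0 P1.
  have : 0 <= P * (4 * d * Phi 2^-1).
    by rewrite mulr_ge0 ?expR_ge0// mulr_ge0// mulr_ge0// ltW.
  by rewrite expr2; lra.
have IS0 : (0 <= IS)%E.
  by apply: integral_ge0 => t _; rewrite lee_fin sqr_ge0.
rewrite /fisher muleCA; clearbody IS.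
apply: (@le_trans _ _ (2^-1%:E * (IS + IQ))%E).
  have IQ0 : (0 <= IQ)%E.
    by rewrite IQE; apply: integral_ge0 => t _; exact: slope_penalty_ge0.
  rewrite (ge0_muleDr _ IS0 IQ0).
  by rewrite leeD2l//; apply: lee_wpmul2l => //; rewrite lee_fin.
apply: (@le_trans _ _ (2^-1%:E * (W 1 - W 0)%:E)%E).
  by apply: lee_wpmul2l => //; rewrite lee_fin.
by rewrite -EFinM lee_fin mulrC ler_pM2r// invr_gt0.
Qed.

End recovery.

(** * Uniform convergence of the regularized curves *)

Section uniform.
Context {R : realType} {X : metricType R} (E : X -> \bar R).
Variables (K : R) (S : X -> R -> X).
Hypotheses (K0 : 0 < K) (HS : forall z, evi_start E K z (S z)).
Variables (g : R -> X) (A : R -> R).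
Hypothesis ndA : {homo A : s t / s <= t}.
Hypothesis gA : forall s t, 0 <= s -> s <= t -> t <= 1 ->
  mdist (g s) (g t) ^+ 2 <= (t - s) * (A t - A s).

Lemma start_continuous x (eps : R) : 0 < eps -> exists2 r0, 0 < r0 &
  forall r, 0 <= r -> r < r0 -> mdist x (S x r) < eps.
Proof.
move=> eps0; have [S0 _ Sx _] := HS x.
have /metricType_numDomainType.cvgrPdist_lt/(_ _ eps0)[r0 /= r00 Hr] := Sx.
exists r0 => // r; rewrite le_eqVlt => /predU1P[<- _|rp rr0].
  by rewrite S0 mdistxx.
by apply: Hr => //=; rewrite sub0r normrN gtr0_norm.
Qed.

Lemma start_continuous_finite (x : nat -> X) (eps : R) n : 0 < eps ->
  exists2 r0, 0 < r0 & forall i r, (i < n)%N -> 0 <= r -> r < r0 ->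
    mdist (x i) (S (x i) r) < eps.
Proof.
move=> eps0; elim: n => [|n [r1 r10 H1]]; first by exists 1.
have [r2 r20 H2] := start_continuous (x n) eps0.
exists (Num.min r1 r2); first by rewrite lt_min r10.
move=> i r; rewrite ltnS leq_eqVlt => /predU1P[->|ni] r0; rewrite lt_min => /andP[? ?].
  exact: H2.
exact: H1.
Qed.

(** The flow moves finitely many points of the curve little; the contraction
    estimate extends this to all of them. *)
Lemma regularized_uniform (eps : R) : 0 < eps -> exists2 d0, 0 < d0 &
  forall d t, 0 < d -> d < d0 -> 0 <= t <= 1 ->
    mdist (g t) (regularized S g d t) < eps.
Proof.
move=> eps0.
pose B := A 1 - A 0; have B0 : 0 <= B by rewrite subr_ge0 ndA.
pose delta := eps / 2 / (1 + expR K).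
have eK : 0 < 1 + expR K by rewrite addr_gt0 ?expR_gt0.
have delta0 : 0 < delta by rewrite divr_gt0//; lra.
pose y := B / delta ^+ 2.
have y0 : 0 <= y by rewrite divr_ge0// sqr_ge0.
pose N := Num.bound y.
have yN : y < N%:R by exact: archi_boundP.
have N0 : 0 < N%:R :> R by exact: le_lt_trans yN.
pose x i := g (i%:R / N%:R).
have e2 : 0 < eps / 2 by lra.
have [r0 r00 Hr] := start_continuous_finite x N.+1 e2.
exists (Num.min r0 1); first by rewrite lt_min r00 ltr01.
move=> d t d0; rewrite lt_min => /andP[dr d1] t01.
have /andP[t0 t1] := t01.
have /andP[ft0 ftd] := flow_time_itv d0 t01.
set r := flow_time d t in ft0 ftd *.
pose i := Num.truncn (t * N%:R).
have tN0 : 0 <= t * N%:R by rewrite mulr_ge0// ltW.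
have /andP[it ti] := truncn_itv tN0.
have iN : (i < N.+1)%N.
  rewrite ltnS -(ler_nat R) (le_trans it)// ler_piMl// ltW//.
have s0 : 0 <= i%:R / N%:R :> R by rewrite divr_ge0// ltW.
have st : i%:R / N%:R <= t by rewrite ler_pdivrMr.
have dN : mdist (x i) (g t) <= delta.
  rewrite -ler_sqr ?nnegrE ?mdist_ge0 ?(ltW delta0)//.
  apply: (le_trans (gA s0 st t1)).
  have h1 : t - i%:R / N%:R <= N%:R^-1.
    by rewrite lerBlDr -[X in _ <= X + _]mul1r -mulrDl ler_pdivlMr// addrC natr1 ltW.
  apply: (@le_trans _ _ (N%:R^-1 * B)).
    apply: ler_pM => //; rewrite ?subr_ge0 ?ndA//.
    by rewrite lerB// ndA.
  by move: (ltW yN); rewrite ler_pdivrMl// /y ler_pdivrMr// exprn_gt0.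
have h2 := Hr i r iN ft0 (le_lt_trans ftd dr).
have h3 := start_contraction K0 (HS (x i)) (HS (g t)) ft0.
have h4 : expR (K * r) * mdist (x i) (g t) <= expR K * delta.
  apply: ler_pM; rewrite ?expR_ge0 ?mdist_ge0//.
  rewrite ler_expR ler_piMr ?(ltW K0)// (le_trans ftd)// ltW//.
have h5 : delta + expR K * delta = eps / 2.
  by rewrite /delta -[X in X + _]mul1r -mulrDl mulrC divfK// gt_eqF.
rewrite /regularized -/r.
have := metric_triangle (g t) (x i) (S (g t) r).
have := metric_triangle (x i) (S (x i) r) (S (g t) r).
by rewrite (metric_sym (g t) (x i)); lra.
Qed.

End uniform.

(** * The lower bound *)

Section gamma.
Context {R : realType} {X : metricType R} (E : X -> \bar R).
Local Notation mu := (@lebesgue_measure R).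

Lemma cvg_at_right0 (u : nat -> R) : (forall n, 0 < u n) ->
  (forall n, u n < n.+1%:R^-1) -> u @ \oo --> (0 : R)^'+.
Proof.
move=> u0 un P [d /= d0 dP].
have [N _ HN] := near_infty_natSinv_lt (PosNum d0).
exists N => // n Nn; apply: dP => /=; last exact: u0.
by rewrite sub0r normrN gtr0_norm// (lt_trans (un n)) ?HN.
Qed.

Lemma einf_sequence (F : R -> \bar R) (C : \bar R) :
  (limf_einf F (0 : R)^'+ < C)%E ->
  exists u : nat -> R, [/\ forall n, 0 < u n, u @ \oo --> (0 : R)^'+ &
    forall n, (F (u n) < C)%E].
Proof.
move=> FC.
have /choice[u Hu] (n : nat) : exists e, [/\ 0 < e, e < n.+1%:R^-1 & (F e < C)%E].
  have [|e /andP[e0 en] Fe] := limf_einf_frequently FC (V := [set e | 0 < e < n.+1%:R^-1]).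
    near=> e; apply/andP; split; near: e; first exact: nbhs_right_gt.
    by apply: nbhs_right_lt; rewrite invr_gt0.
  by exists e.
exists u; split=> [n||n]; [by case: (Hu n)| |by case: (Hu n)].
by apply: cvg_at_right0 => n; case: (Hu n).
Unshelve. all: by end_near. Qed.

Lemma iota01_fin (x y : X) (g : R -> X) : (iota01 x y g < +oo)%E ->
  [/\ iota01 x y g = 0%E, g 0 = x & g 1 = y].
Proof. by rewrite /iota01; case: ifPn => // /asboolP[]. Qed.

Lemma iota01_ge0 (x y : X) (g : R -> X) : (0 <= iota01 x y g)%E.
Proof. by rewrite /iota01; case: ifPn. Qed.

Lemma fisher_ge0 (g : R -> X) : (0 <= fisher E g)%E.
Proof.
apply: mule_ge0; first by rewrite lee_fin.
by apply: integral_ge0 => t _; exact/expe_ge0/slope_ge0.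
Qed.

(** Along a sequence realizing the inferior limit the actions are bounded and the
    endpoints are the prescribed ones.  The hypothesis is what both notions of
    convergence have in common. *)
Lemma gamma_liminf (g_ : R -> R -> X) (g : R -> X) (x y : X) : separable X ->
  (forall u : nat -> R, (forall n, 0 < u n) -> u @ \oo --> (0 : R)^'+ ->
    [/\ forall s t, 0 <= s <= 1 -> 0 <= t <= 1 -> ((mdist (g s) (g t))%:E <=
          limn_einf (fun n => (mdist (g_ (u n) s) (g_ (u n) t))%:E))%E,
        (forall n, g_ (u n) 0 = x) -> g 0 = x &
        (forall n, g_ (u n) 1 = y) -> g 1 = y]) ->
  (kinetic g + iota01 x y g <=
   limf_einf (fun e => action_eps E e (g_ e) + iota01 x y (g_ e)) (0 : R)^'+)%E.
Proof.
move=> sepX H; set L := limf_einf _ _.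
have key (C : R) : (L < C%:E)%E -> (kinetic g + iota01 x y g <= C%:E)%E.
  move=> /einf_sequence[u [u0 ucvg uC]].
  have [Hd H0 H1] := H u u0 ucvg.
  have fe n : (0 <= (u n ^+ 2)%:E * fisher E (g_ (u n)))%E.
    by apply: mule_ge0; [rewrite lee_fin sqr_ge0|exact: fisher_ge0].
  have io n : (iota01 x y (g_ (u n)) < +oo)%E.
    rewrite ltNge leye_eq; apply/negP => /eqP ioo; have := uC n.
    rewrite ioo /action_eps addey ?ltNge ?leey//.
    by rewrite gt_eqF// (lt_le_trans _ (adde_ge0 (kinetic_ge0 _) (fe n))).
  have kC n : (kinetic (g_ (u n)) <= C%:E)%E.
    have [i0 _ _] := iota01_fin (io n).
    have := ltW (uC n); rewrite i0 adde0 /action_eps; apply: le_trans.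
    exact: leeDl.
  have -> : iota01 x y g = 0%E.
    rewrite /iota01 ifT//; apply/asboolP; split.
      by apply: H0 => n; case: (iota01_fin (io n)).
    by apply: H1 => n; case: (iota01_fin (io n)).
  by rewrite adde0; exact: (kinetic_lsc sepX kC Hd).
case: L key => [r||] key; [|exact: leey|].
- by apply/lee_addgt0Pr => e e0; rewrite -EFinD; apply: key; rewrite lte_fin ltrDl.
- have := key (-1) (ltNyr _); rewrite leNgt => /negP[].
  by rewrite (@lt_le_trans _ _ 0%E)// ?lte_fin ?ltrN10// adde_ge0 ?kinetic_ge0 ?iota01_ge0.
Qed.

End gamma.

(** * The upper bound *)

Section conclusion.
Context {R : realType} {X : metricType R} (E : X -> \bar R).
Local Notation mu := (@lebesgue_measure R).
Hypothesis Ereal : forall z : X, E z != -oo%E.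
Local Notation e z := (fine (E z)).

Definition metric_uniform (g_ : R -> R -> X) (g : R -> X) : Prop :=
  forall delta, 0 < delta -> exists2 e0, 0 < e0 & forall eps t,
    0 < eps -> eps < e0 -> 0 <= t <= 1 -> mdist (g t) (g_ eps t) < delta.

Lemma metric_uniform_cst g : metric_uniform (fun=> g) g.
Proof. by move=> delta delta0; exists 1 => // eps t _ _ _; rewrite mdistxx. Qed.

(** The parameter [d] is proportional to [eps] so that [eps ^+ 2] is
    [slope_rate K * d ^+ 2]; for large [eps] the curve itself is taken. *)
Lemma recovery_sequence (x y : X) (g : R -> X) : separable X ->
  energy_regular E -> EVI_wellposed E -> (E x < +oo)%E -> (E y < +oo)%E ->
  curves01 g ->
  exists g_ : R -> R -> X, [/\ forall eps, 0 < eps -> curves01 (g_ eps),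
    metric_uniform g_ g &
    (limf_esup (fun eps => action_eps E eps (g_ eps) + iota01 x y (g_ eps))
      (0 : R)^'+ <= kinetic g + iota01 x y g)%E].
Proof.
move=> sepX Ereg [lambda flows] Ex Ey Cg.
have [Foo|Ffin] := leP +oo%E (kinetic g + iota01 x y g)%E.
  exists (fun=> g); split => //; first exact: metric_uniform_cst.
  by apply: le_trans Foo; exact: leey.
have [i0 g0 g1] : [/\ iota01 x y g = 0%E, g 0 = x & g 1 = y].
  apply: iota01_fin; apply: le_lt_trans Ffin; apply: leeDr; exact: kinetic_ge0.
have kfin : (kinetic g < +oo)%E by move: Ffin; rewrite i0 adde0.
have [A [kE ndA gA]] := kinetic_fin sepX kfin.
pose K := Num.max (- lambda) 0 + 1.
have K0 : 0 < K by rewrite ltr_pwDr// le_max lexx orbT.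
have Kl : - K <= lambda.
  by rewrite lerNl /K (@le_trans _ _ (Num.max (- lambda) 0))// ?le_max ?lexx// lerDl.
have [Elsc _ _] := Ereg.
have /choice[S HS] z : exists u, evi_start E K z u.
  by have [f flow] := flows z; exact: (flow_start Ereal Elsc K0 Kl Ex flow).
have Eg0 : (E (g 0%R) < +oo)%E by rewrite g0.
have Eg1 : (E (g 1%R) < +oo)%E by rewrite g1.
have [c Hc] := tube_lower_bound Ereal K0 HS ndA gA Ereg.
pose kap := Num.sqrt (slope_rate K).
have kap0 : 0 < kap by rewrite sqrtr_gt0 slope_rate_gt0.
pose d eps := eps / kap.
have d0 eps : 0 < eps -> 0 < d eps by move=> ?; rewrite divr_gt0.
have dE eps : eps ^+ 2 = slope_rate K * d eps ^+ 2.
  rewrite /d expr_div_n -[kap ^+ 2]/(Num.sqrt (slope_rate K) ^+ 2).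
  rewrite sqr_sqrtr ?ltW ?slope_rate_gt0// mulrC divfK//.
  by rewrite gt_eqF// slope_rate_gt0.
pose g_ eps := if d eps <= 1 then regularized S g (d eps) else g.
have act eps : 0 < eps -> d eps <= 1 ->
    curves01 (g_ eps) /\ (action_eps E eps (g_ eps) <=
      ((expR (K * d eps) ^+ 2 * (A 1 - A 0) +
     2 * d eps * expR (K * d eps) * (e (g 0) + e (g 1) - 2 * c)) / 2)%R%:E)%E.
  move=> eps0 d1; rewrite /g_ d1 /=.
  exact: (regularized_action Ereal K0 HS gA Eg0 Eg1 Hc (d0 _ eps0) d1 (dE eps)).
exists g_; split.
- move=> eps eps0; have [d1|d1] := leP (d eps) 1.
    by have [] := act eps eps0 d1.
  by rewrite /g_ leNgt d1.
- move=> delta delta0.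
  have [r0 r00 Hr] := regularized_uniform K0 HS ndA gA delta0.
  exists (r0 * kap); first exact: mulr_gt0.
  move=> eps t eps0 er t01; rewrite /g_; case: ifPn => d1; last by rewrite mdistxx.
  by apply: Hr => //; [exact: d0|rewrite ltr_pdivrMr].
pose Th r := (expR (K * r) ^+ 2 * (A 1 - A 0) +
     2 * r * expR (K * r) * (e (g 0) + e (g 1) - 2 * c)) / 2.
have cTh : {for 0, continuous Th}.
  have cid : r @[r --> (0 : R)] --> (0 : R) by exact: cvg_id.
  have ce : expR (K * r) @[r --> (0 : R)] --> expR (K * 0).
    apply: (@cvg_comp _ _ _ (fun r => K * r) expR _ (nbhs (K * 0))).
      by apply: cvgM => //; exact: cvg_cst.
    exact: continuous_expR.
  apply: cvgM; last exact: cvg_cst.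
  apply: cvgD; apply: cvgM; try exact: cvg_cst.
    by rewrite expr2; under eq_fun do rewrite expr2; exact: cvgM.
  by apply: cvgM => //; apply: cvgM => //; exact: cvg_cst.
have Th0 : Th 0 = (A 1 - A 0) / 2.
  by rewrite /Th mulr0 expR0 expr1n mul1r mulr0 !mul0r addr0.
rewrite i0 adde0 kE; apply/lee_addgt0Pr => delta delta0.
apply: limf_esup_le.
have /cvgrPdist_le/(_ _ delta0)[r0 /= r00 Hr] := cTh.
have m0 : 0 < Num.min r0 1 by rewrite lt_min r00 ltr01.
exists (Num.min r0 1 * kap) => /=; first exact: mulr_gt0.
move=> eps /=; rewrite sub0r normrN => + eps0; rewrite gtr0_norm//.
rewrite -ltr_pdivrMr// -/(d eps) lt_min => /andP[dr d1].
have [_ Hact] := act eps eps0 (ltW d1).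
have -> : iota01 x y (g_ eps) = 0%E.
  rewrite /g_ ltW// /iota01 ifT//; apply/asboolP.
  by rewrite (regularized0 HS) (regularized1 HS).
rewrite adde0; apply: (le_trans Hact); rewrite -EFinD lee_fin.
have /= := Hr (d eps); rewrite sub0r normrN gtr0_norm ?d0// Th0 => /(_ dr).
by rewrite ler_norml /Th => /andP[+ _]; lra.
Qed.

Lemma metric_uniform_cvg g_ g : metric_uniform g_ g -> uniform_cvg g_ g.
Proof.
move=> gg P /uniform_nbhs[U [entU UP]].
have [delta /= delta0 dU] : exists2 delta : R, 0 < delta &
    forall a b : X, mdist a b < delta -> U (a, b).
  move: entU; rewrite -entourage_ballE => -[delta /= delta0 dU].
  by exists delta => // a b ab; apply: dU; rewrite /= ballEmdist.
have [e0 e00 He] := gg _ delta0.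
exists e0 => //= eps /=; rewrite sub0r normrN => + eps0.
rewrite gtr0_norm// => epse0; apply: UP => t /=; rewrite in_itv/= => t01.
by apply: dU; exact: He.
Qed.

Lemma uniform_cvg_metric g_ g : uniform_cvg g_ g -> metric_uniform g_ g.
Proof.
move=> gg delta delta0.
have [|e0 /= e00 He] := gg [set h | forall t : R, `[0, 1]%classic t ->
    mdist (g t) (h t) < delta].
  apply/uniform_nbhs; exists [set ab | mdist ab.1 ab.2 < delta]; split => //.
  rewrite -entourage_ballE; exists delta => //= -[a b] /=.
  by rewrite ballEmdist.
exists e0 => // eps t eps0 epse0 t01.
by apply: (He eps) => //=; rewrite ?in_itv// sub0r normrN gtr0_norm.
Qed.

Lemma limn_einf_cvg (u : nat -> R) (l : R) : u @ \oo --> l ->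
  limn_einf (fun n => (u n)%:E) = l%:E.
Proof.
move=> ul; have := @cvg_limn_einf_sup R (fun n => (u n)%:E) l%:E.
by case=> //; apply/cvg_EFin; [exact: nearW|exact: ul].
Qed.

Variable sigma : Topological X.
Hypothesis AS : assumption_S sigma E.

(** Bounded sequences have sigma-convergent subsequences, and by lower
    semicontinuity of the distance the limit of a subsequence is [l]. *)
Lemma metric_cvg_sigma (u : nat -> X) (l : X) :
  (forall n, mdist l (u n) < n.+1%:R^-1) ->
  exists phi : nat -> nat, {homo phi : m n / (m < n)%N} /\
    sigma_cvg sigma \oo (u \o phi) l.
Proof.
move=> ul; case: AS => _ bnd lscd _.
have [|phi [hphi [l' ul']]] := bnd u.
  exists 2 => _ _ [n _ <-] [m _ <-].
  have := metric_triangle (u n) l (u m); rewrite (metric_sym (u n) l).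
  have u1 k : mdist l (u k) < 1.
    by apply: lt_le_trans (ul k) _; rewrite invf_le1// ler1n.
  by have := u1 n; have := u1 m; lra.
exists phi; split => //; suff <- : l' = l by [].
apply: mdist_positivity; apply/eqP; rewrite eq_le mdist_ge0 andbT.
have := lscd (u \o phi) (cst l) l' l ul'; move=> /(_ (@cvg_cst _ _ _ _ _)) H.
rewrite -lee_fin; apply: (le_trans H).
rewrite (limn_einf_cvg (l := 0))//.
apply/cvgrPdist_lt => eps eps0.
have [N _ HN] := near_infty_natSinv_lt (PosNum eps0).
exists N => // n Nn /=; rewrite sub0r normrN ger0_norm ?mdist_ge0// metric_sym.
apply: (lt_trans (ul _)); apply: HN; rewrite /=.
apply: (leq_trans Nn).
elim: n {Nn} => // n IH; apply: (leq_ltn_trans IH); exact: hphi.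
Qed.

(** A neighbourhood of [g t] avoided by arbitrarily small parameters would be
    avoided by a metrically convergent sequence, and so by a sigma-convergent
    subsequence of it. *)
Lemma metric_uniform_sigma g_ g : metric_uniform g_ g -> ptws_sigma_cvg sigma g_ g.
Proof.
move=> gg t t01 V gV; apply: contrapT => nV.
have /choice[u Hu] (n : nat) : exists eps, [/\ 0 < eps,
    mdist (g t) (g_ eps t) < n.+1%:R^-1 & ~ V (g_ eps t)].
  have n0 : 0 < n.+1%:R^-1 :> R by rewrite invr_gt0.
  have [e0 e00 He] := gg _ n0.
  apply: contrapT => nE; apply: nV.
  exists e0 => //= eps /=; rewrite sub0r normrN => + eps0.
  rewrite gtr0_norm// => ee0; apply: contrapT => nVe; apply: nE.
  by exists eps; split => //; exact: He.
have [|phi [_ H]] := @metric_cvg_sigma (fun n => g_ (u n) t) (g t).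
  by move=> n; case: (Hu n).
have [N _ /(_ N (leqnn N))] := H V gV.
by case: (Hu (phi N)).
Qed.

End conclusion.

(** * Gamma-convergence *)

Local Open Scope ereal_scope.

Theorem theorem4p3 (R : realType) (X : metricType R) (E : X -> \bar R)
  (Ereal : forall z : X, E z != -oo)
  (A1 : cauchy_complete X /\ separable X)
  (A2 : energy_regular E)
  (A3 : EVI_wellposed E)
  (x y : X) (Ex : E x < +oo) (Ey : E y < +oo) :
  gamma_lim curves01 uniform_cvg
    (fun (e : R) (g : R -> X) => action_eps E e g + iota01 x y g)
    (fun g : R -> X => kinetic g + iota01 x y g) /\
  (forall sigma : Topological X, assumption_S sigma E ->
     gamma_lim curves01 (ptws_sigma_cvg sigma)
       (fun (e : R) (g : R -> X) => action_eps E e g + iota01 x y g)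
       (fun g : R -> X => kinetic g + iota01 x y g)).
Proof.
have [_ sepX] := A1.
split=> [|sigma AS]; split=> [g_ g _ _ gg|g Cg].
- apply: gamma_liminf => // u u0 ucvg.
  have gu t : (0 <= t <= 1)%R -> (fun n => mdist (g t) (g_ (u n) t)) @ \oo --> (0 : R)%R.
    move=> t01; apply/cvgrPdist_lt => delta delta0.
    have [e0 e00 He] := uniform_cvg_metric gg delta0.
    have [N _ HN] : \forall n \near \oo, (u n < e0)%R.
      exact: (ucvg _ (nbhs_right_lt e00)).
    exists N => // n Nn /=; rewrite sub0r normrN ger0_norm ?mdist_ge0//.
    by apply: He => //; exact: HN.
  have ends t z : (0 <= t <= 1)%R -> (forall n, g_ (u n) t = z) -> g t = z.
    move=> t01 gz; apply: mdist_positivity.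
    have := gu t t01; under eq_fun do rewrite gz.
    by move=> /cvg_lim <- //; rewrite lim_cst.
  split; [|by apply: ends; rewrite lexx ler01|by apply: ends; rewrite lexx ler01].
  move=> s t s01 t01; apply/lee_addgt0Pr => delta delta0.
  rewrite -leeBlDr// -EFinB; apply: limn_einf_ge.
  have d2 : (0 < delta / 2)%R by rewrite divr_gt0.
  have /cvgrPdist_lt/(_ _ d2) Hs := gu s s01.
  have /cvgrPdist_lt/(_ _ d2) Ht := gu t t01.
  near=> n.
  have : (mdist (g s) (g_ (u n) s) < delta / 2)%R.
    near: n; apply: filterS Hs => n.
    by rewrite sub0r normrN ger0_norm ?mdist_ge0.
  have : (mdist (g t) (g_ (u n) t) < delta / 2)%R.
    near: n; apply: filterS Ht => n.
    by rewrite sub0r normrN ger0_norm ?mdist_ge0.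
  rewrite lee_fin.
  have := metric_triangle (g s) (g_ (u n) s) (g t).
  have := metric_triangle (g_ (u n) s) (g_ (u n) t) (g t).
  by rewrite (metric_sym (g_ (u n) t) (g t)); lra.
- have [g_ [Cg_ gg gsup]] := recovery_sequence Ereal sepX A2 A3 Ex Ey Cg.
  by exists g_; split => //; exact: metric_uniform_cvg.
- apply: gamma_liminf => // u u0 ucvg.
  case: AS => hS _ lscd _.
  have gu t : (0 <= t <= 1)%R -> sigma_cvg sigma \oo (fun n => g_ (u n) t) (g t).
    by move=> t01; apply: cvg_comp ucvg (gg t t01).
  have ends t z : (0 <= t <= 1)%R -> (forall n, g_ (u n) t = z) -> g t = z.
    move=> t01 gz; have := gu t t01.
    rewrite (_ : (fun n => g_ (u n) t) = cst z); last exact/funext.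
    by move=> /(cvg_unique hS); apply; exact: cvg_cst.
  split; [|by apply: ends; rewrite lexx ler01|by apply: ends; rewrite lexx ler01].
  by move=> s t s01 t01; apply: lscd; exact: gu.
- have [g_ [Cg_ gg gsup]] := recovery_sequence Ereal sepX A2 A3 Ex Ey Cg.
  by exists g_; split => //; exact: (metric_uniform_sigma AS).
Unshelve. all: by end_near. Qed.
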